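(* If $\delta\in(0,1)$, then $\Omega_n(S_\delta)\sim\ln n$; that is, there are constants $0<c\le C<\infty$ depending only on $\delta$ such that for all $n\ge2$ $$c\ln n\le \Omega_n(S_\delta)\le C\ln n .$$
   Context: $\mathbb T$ is the unit circle, identified with $(-\pi,\pi]$ via $\theta\mapsto e^{i\theta}$. For $\delta\in(0,1)$ the Steklov class $S_\delta$ is the set of probability measures $\sigma$ on $\mathbb T$ such that $\sigma'(\theta)\ge \delta/(2\pi)$ at every Lebesgue point of $\sigma$ (equivalently a.e.), where $\sigma'$ is the density of the absolutely continuous part with respect to $d\theta$. For $\sigma\in S_\delta$, $\phi_n=\phi_n(z,\sigma)=\lambda_nz^n+\ldots$, $\lambda_n>0$, are the polynomials orthonormal with respect to $\sigma$. For a class $\mathcal K$ of probability measures on $\mathbb T$ define $$\Omega_n(\mathcal K)=\sup_{\sigma\in\mathcal K}\int_{\mathbb T}|\phi_n|^2\ln^+|\phi_n|\,d\sigma,\qquad \ln^+x=\max(\ln x,0).$$ *)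

(* Defs.v *)
From HB Require Import structures.
From mathcomp Require Import all_boot all_order all_algebra.
From mathcomp Require Import all_classical all_reals all_analysis.
From mathcomp Require Import complex.

Set Implicit Arguments.
Unset Strict Implicit.
Unset Printing Implicit Defensive.

Import Order.TTheory GRing.Theory Num.Theory.
Import numFieldNormedType.Exports.

Local Open Scope classical_set_scope.
Local Open Scope ring_scope.
Local Open Scope complex_scope.

(* The unit circle is identified with ]-pi, pi] through theta |-> e^(i theta);
   a probability measure on it is a Borel probability measure on the real line
   that gives full mass to ]-pi, pi]. *)
Definition circle {R : realType} : set R := `]-pi, pi]%classic.

Definition on_circle {R : realType}
    (sigma : probability (measurableTypeR R) R) : Prop :=
  sigma circle = 1%E.

Definition expi {R : realType} (theta : R) : R[i] := cos theta +i* sin theta.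

Definition mutually_singular d (T : measurableType d) (R : realType)
    (mu nu : set T -> \bar R) : Prop :=
  exists N : set T, [/\ measurable N, mu N = 0%E & nu (~` N) = 0%E].

(* Lebesgue decomposition: sigma = f d(theta) + (singular part). The density f
   is determined up to a Lebesgue null set. *)
Definition is_ac_density {R : realType}
    (sigma : probability (measurableTypeR R) R) (f : R -> R) : Prop :=
  [/\ measurable_fun [set: measurableTypeR R] f,
      (forall theta, 0 <= f theta) &
      exists sigma_s : {measure set (measurableTypeR R) -> \bar R},
        mutually_singular (@lebesgue_measure R) sigma_s /\
        forall A : set (measurableTypeR R), measurable A ->
          sigma A =
          (\int[@lebesgue_measure R]_(theta in A) (f theta)%:E + sigma_s A)%E].

Definition steklov {R : realType} (delta : R) :
    set (probability (measurableTypeR R) R) :=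
  [set sigma | on_circle sigma /\
     exists f : R -> R, is_ac_density sigma f /\
       {ae @lebesgue_measure R, forall theta,
          circle theta -> delta / (2 * pi) <= f theta}].

(* Used only for trigonometric polynomials, which are bounded, so that both
   real integrals are genuine. *)
Definition circle_cintegral {R : realType}
    (sigma : probability (measurableTypeR R) R) (F : R -> R[i]) : R[i] :=
  (\int[sigma]_(theta in circle) complex.Re (F theta)) +i*
  (\int[sigma]_(theta in circle) complex.Im (F theta)).

Definition orthonormal_polys {R : realType}
    (sigma : probability (measurableTypeR R) R) (phi : nat -> {poly R[i]}) :
    Prop :=
  (forall n, size (phi n) = n.+1 /\ 0 < lead_coef (phi n)) /\
  (forall n m,
     circle_cintegral sigma
       (fun theta => (phi n).[expi theta] * ((phi m).[expi theta])^*) =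
     (n == m)%:R).

Definition lnp {R : realType} (x : R) : R := Num.max (ln x) 0.

Definition entropy {R : realType} (sigma : probability (measurableTypeR R) R)
    (p : {poly R[i]}) : \bar R :=
  (\int[sigma]_(theta in circle)
     (let r := complex.Re `|p.[expi theta]| in r ^+ 2 * lnp r)%:E)%E.

(* On measures of infinite support, such as those of a Steklov class, the
   orthonormal polynomials exist and are unique, so each sigma in K contributes
   exactly one value. *)
Definition Omega {R : realType} (n : nat)
    (K : set (probability (measurableTypeR R) R)) : \bar R :=
  ereal_sup [set x | exists sigma (phi : nat -> {poly R[i]}),
    [/\ K sigma, orthonormal_polys sigma phi & x = entropy sigma (phi n)]].

(* Main.v *)
Require Import Defs.
From HB Require Import structures.
From mathcomp Require Import all_boot all_order all_algebra.
From mathcomp Require Import all_classical all_reals all_analysis.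
From mathcomp Require Import measurable_realfun complex ring lra zify.

(** The upper bound holds measure by measure.  A measure of the Steklov class
    dominates [delta] times the normalized Lebesgue measure, so the
    normalization of [phi_n] bounds the sum of the squared moduli of its [n+1]
    coefficients by [1/delta]; by Cauchy-Schwarz [|phi_n|^2 <= (n+1)/delta] on
    the whole circle, and the entropy is at most [ln ((n+1)/delta) / 2] because
    [|phi_n|^2] has integral 1 (lemma [Omega_le]).

    The lower bound rests on an explicit family of measures whose n-th
    orthonormal polynomial is known in advance.  Let [V] and [G] be polynomials
    of degree small with respect to [n], with positive real part on the circle,
    [V(0) > 0] and [G(0) = 1], and let [U = V G].  On the circle put
    [[
      phi = (U - V + z^n conj(U + V)) / 2,
      E   = U V + z^n (conj U V - U conj V) / 2,     w = Re(U conj V) / |E|^2.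
    ]]
    A direct computation gives
    [phi w = (z^n (U + V)/E - conj((V - U)/E)) / 2].  Both quotients are
    boundary values of functions analytic in the disc, and the second one
    vanishes at 0; hence [phi w] is orthogonal to [1, z, ..., z^(n-1)], which
    says that [phi] is, up to normalization, the n-th orthonormal polynomial of
    the weight [w] (lemma [frame_orth]).  Analyticity is expressed by uniform
    approximation by polynomials (predicate [inA]), so that only the mean value
    property of polynomials is used.

    Write [E = U V (1 + y)].  Then [|y| = |Im G|/|G| < 1] and
    [w = Re((1-y)/(1+y)) / (|V|^2 Re G)].  This yields a pointwise lower bound
    for [w] (lemma [frame_w_ge]) and, since [y] vanishes at 0 to an order larger
    than [d], an upper bound for its mean by the value at 0 of any polynomial of
    degree at most [d] whose real part dominates [1/(|V|^2 Re G)] (lemma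
    [frame_mass]).  When the quotient of these two bounds is at most [1/delta],
    [w] divided by its mean is the density of a measure of the Steklov class.
    On the other hand the factor [z^n] oscillates faster than everything else,
    so on average [|phi|^2] is [(|U|^2 + |V|^2)/2] (lemma [frame_test]).  It thus
    suffices to choose [V] and [G] so that [|U|^2] has a fixed amount of mass on
    an arc where [|U|] is at least a power of [n] (lemma [frame_Omega_ge]).

    Let [N = B 64^J] and let [k_j] be a kernel behaving like
    [1/(1 + N_j (1 - z))] with [N_j = B 64^j].  The choice is
    [[
      G = c + eta (sum_(j <= J) 16^j k_j + 64^J k_J),
      V = 8^-J + (15/16) sum_(j <= J) 16^-j (1 - k_j).
    ]]
    At distance [64^-i] (in the scale [B |1 - z|]) from the point 1, [V] has size
    [16^-i], while [|G|] has size at most [64^i], which is the size of the slowly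
    decaying imaginary part of [64^J k_J], and [Re G] has size at least [16^i].
    So [|V|^2 |G|^2] is at most of the order of [Re G] at every scale.  Far from
    1 both [V] and [G] are close to 1, and a small [eta] followed by a large [B]
    brings the quotient of the two bounds as close to 1 as [delta < 1] requires.
    On the arc of length [1/N] around 1 one has [|U|^2] of order [64^J], that is
    of order [N], so this arc carries a fixed mass, and on it [ln |phi|] is of
    order [J].
    The degrees that occur are at most of order [N^2], whence the entropy is at
    least a multiple of [ln n] for large [n] (lemma [Omega_ge_log]).  For the
    remaining degrees the Bernstein-Szego weights, which are the case [G = 1],
    give a positive lower bound (lemma [Omega_ge_small]). *)

Set Implicit Arguments.
Unset Strict Implicit.
Unset Printing Implicit Defensive.

Import Order.TTheory GRing.Theory Num.Theory.
Import numFieldNormedType.Exports.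

Local Open Scope classical_set_scope.
Local Open Scope ring_scope.
Local Open Scope complex_scope.
Local Notation "x ^*" := (conjc x) : ring_scope.

(** * Means over the circle *)

Section RealMean.
Variable R : realType.
Implicit Types f g : R -> R.

Lemma contM f g : continuous f -> continuous g -> continuous (fun t => f t * g t).
Proof. by move=> cf cg x; exact: cvgM (cf x) (cg x). Qed.

Lemma contD f g : continuous f -> continuous g -> continuous (fun t => f t + g t).
Proof. by move=> cf cg x; exact: cvgD (cf x) (cg x). Qed.

Lemma contN f : continuous f -> continuous (fun t => - f t).
Proof. by move=> cf x; exact: cvgN (cf x). Qed.

Lemma contC (c : R) : continuous (fun _ : R => c).
Proof. by move=> x; exact: cvg_cst. Qed.

Lemma contV f : continuous f -> (forall t, f t != 0) ->
  continuous (fun t => (f t)^-1).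
Proof. by move=> cf f0 x; exact: cvgV (f0 x) (cf x). Qed.

Definition mean f : R :=
  (\int[@lebesgue_measure R]_(t in circle) f t) / (2 * pi).

Lemma pi2_gt0 : 0 < 2 * pi :> R.
Proof. by rewrite mulr_gt0 ?ltr0n ?pi_gt0. Qed.

Lemma measurable_circle : measurable (@circle R : set (measurableTypeR R)).
Proof. exact: measurable_itv. Qed.

Lemma lebesgue_circle : @lebesgue_measure R circle = (2 * pi)%:E.
Proof.
rewrite /circle lebesgue_measure_itv /= lte_fin.
have p0 := @pi_gt0 R.
by rewrite (_ : - pi < pi :> R) -?EFinB; [congr EFin; lra | lra].
Qed.

Lemma continuous_integrable_circle f : continuous f ->
  (@lebesgue_measure R).-integrable circle (EFin \o f).
Proof.
move=> cf.
have h : (@lebesgue_measure R).-integrable `[- pi, pi]%classic (EFin \o f).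
  apply: continuous_compact_integrable; first exact: segment_compact.
  exact: continuous_subspaceT.
apply: integrableS h.
- exact: measurable_itv.
- exact: measurable_itv.
- by apply: subset_itvr; rewrite bnd_simp.
Qed.

Lemma meanD f g : continuous f -> continuous g ->
  mean (fun t => f t + g t) = mean f + mean g.
Proof.
move=> cf cg; rewrite /mean RintegralD ?mulrDl//.
- exact: measurable_circle.
- exact: continuous_integrable_circle.
- exact: continuous_integrable_circle.
Qed.

Lemma meanZ (c : R) f : continuous f -> mean (fun t => c * f t) = c * mean f.
Proof.
move=> cf; rewrite /mean RintegralZl ?mulrA//.
  exact: measurable_circle.
exact: continuous_integrable_circle.
Qed.

Lemma mean_cst (c : R) : mean (fun=> c) = c.
Proof.
rewrite /mean Rintegral_cst; last exact: measurable_circle.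
have := pi2_gt0 => h.
have -> : fine (@lebesgue_measure R circle) = 2 * pi :> R.
  by rewrite lebesgue_circle.
by rewrite mulfK// gt_eqF.
Qed.

Lemma mean_le f g : continuous f -> continuous g ->
  (forall t, f t <= g t) -> mean f <= mean g.
Proof.
move=> cf cg fg; rewrite /mean ler_wpM2r ?invr_ge0 ?(ltW pi2_gt0)//.
apply: le_Rintegral => //.
- exact: measurable_circle.
- exact: continuous_integrable_circle.
- exact: continuous_integrable_circle.
Qed.

Lemma eq_mean f g : f =1 g -> mean f = mean g.
Proof. by move=> fg; rewrite (funext fg). Qed.

Lemma meanB f g : continuous f -> continuous g ->
  mean (fun t => f t - g t) = mean f - mean g.
Proof.
move=> cf cg; have ->: (fun t => f t - g t) = (fun t => f t + (-1) * g t).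
  by apply/funext => t; rewrite mulN1r.
rewrite meanD ?meanZ ?mulN1r//.
by apply: contM => //; exact: contC.
Qed.

Lemma meanN f : continuous f -> mean (fun t => - f t) = - mean f.
Proof.
move=> cf; rewrite -[RHS]mulN1r -meanZ//.
by apply: eq_mean => t; rewrite mulN1r.
Qed.

Lemma mean_norm_le f (e : R) : continuous f ->
  (forall t, `|f t| <= e) -> `|mean f| <= e.
Proof.
move=> cf fe; rewrite ler_norml -{1}[e]mean_cst -meanN; last exact: contC.
have cc (c : R) : continuous (fun _ : R => c) by exact: contC.
apply/andP; split.
  apply: mean_le => // t.
  by have := fe t; rewrite ler_norml => /andP[].
rewrite -[leRHS]mean_cst; apply: mean_le => // t.
by have := fe t; rewrite ler_norml => /andP[].
Qed.

(** The primitive is periodic, so the fundamental theorem of calculus gives 0. *)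
Lemma mean_derive (F f : R -> R) : continuous f ->
  (forall x : R, is_derive x 1 F (f x)) -> F pi = F (- pi) -> mean f = 0.
Proof.
move=> cf dF Fpi; rewrite /mean Rintegral_itv_obnd_cbnd; last first.
  exact: continuous_integrable_circle.
have p0 := @pi_gt0 R.
have dd (x : R) : derivable F x 1 by have := dF x; case.
have cF : continuous F.
  by move=> x; apply: differentiable_continuous; apply/derivable1_diffP.
rewrite /Rintegral (@continuous_FTC2 _ f F) //=.
- by rewrite Fpi subrr mul0r.
- by lra.
- exact: continuous_subspaceT.
- split=> [x _|//|//]; first exact: dd.
  by apply: cvg_at_right_filter; exact: cF.
  by apply: cvg_at_left_filter; exact: cF.
- by move=> x _; rewrite derive1E; apply: derive_val.
Qed.

Lemma is_derive_lin (c x : R) : is_derive x 1 (fun t : R => c * t) c.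
Proof.
have h := @is_deriveZ R R R (fun t : R => t) c x 1 1 _.
apply: (is_derive_eq (h _)).
by rewrite -[_ *: _]/(_ * _) mulr1.
Qed.

Lemma mean_cosM (k : nat) : (0 < k)%N -> mean (fun t => cos (k%:R * t)) = 0.
Proof.
move=> k0; have kn0 : k%:R != 0 :> R by rewrite pnatr_eq0 -lt0n.
have cl (c : R) : continuous (fun t => c * t).
  by apply: contM; [exact: contC | move=> x; exact: cvg_id].
apply: (@mean_derive (fun t => k%:R^-1 * sin (k%:R * t))).
- move=> x; apply: (@continuous_comp _ _ _ (fun t : R => k%:R * t) (@cos R)).
    exact: cl.
  exact: continuous_cos.
- move=> x; have h := is_derive1_comp (is_derive_sin (k%:R * x)) (is_derive_lin k%:R x).
  apply: (is_derive_eq (is_derive1_comp (is_derive_lin k%:R^-1 _) h)).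
  by rewrite [_ * k%:R]mulrC mulKf.
- have sk n : sin (n%:R * pi) = 0 :> R.
    elim: n => [|n IH]; first by rewrite mul0r sin0.
    by rewrite -natr1 mulrDl mul1r sinD IH sinpi mul0r mulr0 addr0.
  by rewrite mulrN sinN sk oppr0.
Qed.

Lemma mean_sinM (k : nat) : (0 < k)%N -> mean (fun t => sin (k%:R * t)) = 0.
Proof.
move=> k0; have kn0 : k%:R != 0 :> R by rewrite pnatr_eq0 -lt0n.
have cl (c : R) : continuous (fun t => c * t).
  by apply: contM; [exact: contC | move=> x; exact: cvg_id].
apply: (@mean_derive (fun t => (- k%:R^-1) * cos (k%:R * t))).
- move=> x; apply: (@continuous_comp _ _ _ (fun t : R => k%:R * t) (@sin R)).
    exact: cl.
  exact: continuous_sin.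
- move=> x; have h := is_derive1_comp (is_derive_cos (k%:R * x)) (is_derive_lin k%:R x).
  apply: (is_derive_eq (is_derive1_comp (is_derive_lin (- k%:R^-1) _) h)).
  by rewrite !mulNr mulrN opprK mulrCA mulVf// mulr1.
- by rewrite mulrN cosN.
Qed.

End RealMean.

(** * Complex-valued functions on the circle *)

Section ComplexMean.
Variable R : realType.
Notation C := R[i].
Notation Re := complex.Re.
Notation Im := complex.Im.
Implicit Types F G : R -> C.
Implicit Types x y : C.

Lemma cReD x y : Re (x + y) = Re x + Re y. Proof. by case: x y => [a b] [c d]. Qed.
Lemma cImD x y : Im (x + y) = Im x + Im y. Proof. by case: x y => [a b] [c d]. Qed.
Lemma cReN x : Re (- x) = - Re x. Proof. by case: x. Qed.
Lemma cImN x : Im (- x) = - Im x. Proof. by case: x. Qed.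
Lemma cReB x y : Re (x - y) = Re x - Re y. Proof. by rewrite cReD cReN. Qed.
Lemma cImB x y : Im (x - y) = Im x - Im y. Proof. by rewrite cImD cImN. Qed.
Lemma cReM x y : Re (x * y) = Re x * Re y - Im x * Im y.
Proof. by case: x y => [a b] [c d]. Qed.
Lemma cImM x y : Im (x * y) = Re x * Im y + Im x * Re y.
Proof. by case: x y => [a b] [c d]. Qed.
Lemma cReJ x : Re x^* = Re x. Proof. by case: x. Qed.
Lemma cImJ x : Im x^* = - Im x. Proof. by case: x. Qed.
Lemma cReV x : Re x^-1 = Re x / (Re x ^+ 2 + Im x ^+ 2). Proof. by case: x. Qed.
Lemma cImV x : Im x^-1 = - (Im x / (Re x ^+ 2 + Im x ^+ 2)). Proof. by case: x. Qed.
Lemma complex_ext x y : Re x = Re y -> Im x = Im y -> x = y.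
Proof. by case: x y => [a b] [c d] /= -> ->. Qed.

(** Continuity is asked of the two parts: [R[i]] is used here as a field only,
    not as a topological space. *)
Definition ccont F := continuous (fun t => Re (F t)) /\ continuous (fun t => Im (F t)).

Lemma ccont_ext F G : F =1 G -> ccont F -> ccont G.
Proof. by move=> FG; rewrite (funext FG). Qed.

Lemma ccont_cst (c : C) : ccont (fun=> c).
Proof. by split; exact: contC. Qed.

Lemma ccontD F G : ccont F -> ccont G -> ccont (fun t => F t + G t).
Proof.
move=> [F1 F2] [G1 G2]; split.
  under eq_fun do rewrite cReD; exact: contD.
under eq_fun do rewrite cImD; exact: contD.
Qed.

Lemma ccontN F : ccont F -> ccont (fun t => - F t).
Proof.
move=> [F1 F2]; split.
  under eq_fun do rewrite cReN; exact: contN.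
under eq_fun do rewrite cImN; exact: contN.
Qed.

Lemma ccontB F G : ccont F -> ccont G -> ccont (fun t => F t - G t).
Proof. by move=> cF cG; apply: ccontD => //; exact: ccontN. Qed.

Lemma ccontM F G : ccont F -> ccont G -> ccont (fun t => F t * G t).
Proof.
move=> [F1 F2] [G1 G2]; split.
  under eq_fun do rewrite cReM; apply: contD; first exact: contM.
  by apply: contN; exact: contM.
by under eq_fun do rewrite cImM; apply: contD; exact: contM.
Qed.

Lemma ccontJ F : ccont F -> ccont (fun t => (F t)^*).
Proof.
move=> [F1 F2]; split.
  by under eq_fun do rewrite cReJ.
by under eq_fun do rewrite cImJ; exact: contN.
Qed.

Lemma cont_sqr f : continuous f -> continuous (fun t : R => (f t : R) ^+ 2).
Proof. by move=> cf; under eq_fun do rewrite expr2; exact: contM. Qed.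

Lemma sqReIm_neq0 x : x != 0 -> Re x ^+ 2 + Im x ^+ 2 != 0.
Proof.
move: x => [a b]; rewrite eq_complex /=; apply: contraNN.
by rewrite paddr_eq0 ?sqr_ge0// !sqrf_eq0.
Qed.

Lemma ccontV F : ccont F -> (forall t, F t != 0) -> ccont (fun t => (F t)^-1).
Proof.
move=> [F1 F2] F0; split.
  under eq_fun do rewrite cReV; apply: contM => //; apply: contV.
    by apply: contD; exact: cont_sqr.
  by move=> t; exact: sqReIm_neq0.
under eq_fun do rewrite cImV; apply: contN; apply: contM => //; apply: contV.
  by apply: contD; exact: cont_sqr.
by move=> t; exact: sqReIm_neq0.
Qed.

Lemma ccont_expi : ccont (@expi R).
Proof. by split; [exact: continuous_cos | exact: continuous_sin]. Qed.

Lemma ccont_horner (p : {poly C}) : ccont (fun t => p.[expi t]).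
Proof.
elim/poly_ind: p => [|p c IH].
  by apply: ccont_ext (ccont_cst 0) => t; rewrite horner0.
apply: ccont_ext (ccontD (ccontM IH ccont_expi) (ccont_cst c)) => t.
by rewrite !hornerE.
Qed.

Lemma expi_norm1 t : `|expi t : C| = 1.
Proof. by rewrite normc_def /= cos2Dsin2 sqrtr1. Qed.

Lemma expiJ t : expi t * (expi t)^* = 1 :> C.
Proof.
apply: complex_ext; rewrite ?cReM ?cImM cReJ cImJ /= ?mulrN ?opprK.
  by rewrite -!expr2 cos2Dsin2.
by rewrite mulrC addNr.
Qed.

Lemma expiX t n : expi t ^+ n = expi (n%:R * t) :> C.
Proof.
elim: n => [|n IH]; first by rewrite expr0 mul0r /expi cos0 sin0.
rewrite exprS IH -natr1 mulrDl mul1r; apply: complex_ext; rewrite ?cReM ?cImM /=.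
  by rewrite cosD; ring.
by rewrite sinD; ring.
Qed.

Definition cmean F : C := mean (fun t => Re (F t)) +i* mean (fun t => Im (F t)).

Lemma eq_cmean F G : F =1 G -> cmean F = cmean G.
Proof. by move=> FG; rewrite (funext FG). Qed.

Lemma cmeanD F G : ccont F -> ccont G ->
  cmean (fun t => F t + G t) = cmean F + cmean G.
Proof.
move=> [F1 F2] [G1 G2]; apply: complex_ext; rewrite ?cReD ?cImD /=.
  by rewrite -meanD//; apply: eq_mean => t; rewrite cReD.
by rewrite -meanD//; apply: eq_mean => t; rewrite cImD.
Qed.

Lemma cmeanZ (c : C) F : ccont F -> cmean (fun t => c * F t) = c * cmean F.
Proof.
move=> [F1 F2].
have cZ (a : R) f : continuous f -> continuous (fun t : R => a * (f t : R)).
  by move=> cf; apply: contM => //; exact: contC.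
apply: complex_ext; rewrite ?cReM ?cImM /=.
  rewrite -!meanZ// -meanB ?cZ//; try exact: cZ.
  by apply: eq_mean => t; rewrite cReM.
rewrite -!meanZ// -meanD; try exact: cZ.
by apply: eq_mean => t; rewrite cImM.
Qed.

Lemma cmean_cst (c : C) : cmean (fun=> c) = c.
Proof. by apply: complex_ext; rewrite /= mean_cst. Qed.

Lemma cmeanN F : ccont F -> cmean (fun t => - F t) = - cmean F.
Proof.
by move=> cF; rewrite -[RHS]mulN1r -cmeanZ//; apply: eq_cmean => t; rewrite mulN1r.
Qed.

Lemma cmeanB F G : ccont F -> ccont G ->
  cmean (fun t => F t - G t) = cmean F - cmean G.
Proof. by move=> cF cG; rewrite cmeanD ?cmeanN//; exact: ccontN. Qed.

Lemma cmeanJ F : ccont F -> cmean (fun t => (F t)^*) = (cmean F)^*.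
Proof.
move=> [F1 F2]; apply: complex_ext; rewrite ?cReJ ?cImJ /=.
  by apply: eq_mean => t; rewrite cReJ.
by rewrite -meanN//; apply: eq_mean => t; rewrite cImJ.
Qed.

Lemma Im_le_norm x : (`|Im x|)%:C <= `|x|.
Proof.
by rewrite normc_def lecR -sqrtr_sqr ler_wsqrtr// lerDr sqr_ge0.
Qed.

Lemma norm_le_ReIm x : `|x| <= (`|Re x| + `|Im x|)%:C.
Proof.
rewrite {1}(complexE x) (le_trans (ler_normD _ _))// normrM.
have -> : `|'i : C| = 1 by rewrite normc_def /= expr0n expr1n add0r sqrtr1.
have nr (a : R) : `|a%:C| = (`|a|)%:C.
  by rewrite normc_def /= expr0n addr0 sqrtr_sqr.
by rewrite mul1r !nr rmorphD.
Qed.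

Lemma cmean_norm_le F (e : R) : ccont F -> (forall t, `|F t| <= e%:C) ->
  `|cmean F| <= (e *+ 2)%:C.
Proof.
move=> [F1 F2] Fe; apply: le_trans (norm_le_ReIm _) _.
rewrite lecR mulr2n /= lerD//; apply: mean_norm_le => // t; rewrite -lecR.
  exact: le_trans (normc_ge_Re _) (Fe t).
exact: le_trans (Im_le_norm _) (Fe t).
Qed.

Lemma cmean_expiX n : (0 < n)%N -> cmean (fun t => expi t ^+ n) = 0.
Proof.
move=> n0; apply: complex_ext => /=.
  by rewrite -[RHS](@mean_cosM R n)//; apply: eq_mean => t; rewrite expiX.
by rewrite -[RHS](@mean_sinM R n)//; apply: eq_mean => t; rewrite expiX.
Qed.

Lemma ccontX n : ccont (fun t => expi t ^+ n).
Proof.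
by apply: ccont_ext (ccont_horner 'X^n) => t; rewrite hornerXn.
Qed.

Lemma cmean_hornerMX (p : {poly C}) n : (0 < n)%N ->
  cmean (fun t => p.[expi t] * expi t ^+ n) = 0.
Proof.
elim/poly_ind: p n => [|p c IH] n n0.
  by rewrite -[RHS](cmean_cst 0); apply: eq_cmean => t; rewrite horner0 mul0r.
rewrite (@eq_cmean _ (fun t => p.[expi t] * expi t ^+ n.+1 + c * expi t ^+ n)).
  rewrite cmeanD ?cmeanZ ?IH ?cmean_expiX ?mulr0 ?addr0//.
  - exact: ccontX.
  - by apply: ccontM; [exact: ccont_horner | exact: ccontX].
  - by apply: ccontM; [exact: ccont_cst | exact: ccontX].
by move=> t; rewrite !hornerE exprS; ring.
Qed.

Lemma cmean_horner (p : {poly C}) : cmean (fun t => p.[expi t]) = p.[0].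
Proof.
elim/poly_ind: p => [|p c _].
  by rewrite horner0 -[RHS](cmean_cst 0); apply: eq_cmean => t; rewrite horner0.
rewrite (@eq_cmean _ (fun t => p.[expi t] * expi t ^+ 1 + c)).
  rewrite cmeanD ?cmean_hornerMX ?cmean_cst ?hornerE //.
  - by apply: ccontM; [exact: ccont_horner | exact: ccontX].
  - exact: ccont_cst.
by move=> t; rewrite !hornerE expr1.
Qed.

End ComplexMean.

(** * The disc algebra *)

Section DiscAlgebra.
Variable R : realType.
Notation C := R[i].
Notation Re := complex.Re.
Notation Im := complex.Im.
Implicit Types f g : R -> C.

(** [f] is the boundary function of an element of the disc algebra whose value
    at the centre is [a].  Uniform approximation by polynomials replaces any
    reference to the interior of the disc. *)
Definition inA f (a : C) := ccont f /\ forall e : C, 0 < e ->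
  exists p : {poly C}, `|p.[0] - a| <= e /\ forall t, `|f t - p.[expi t]| <= e.

Lemma inA_ext f g a : f =1 g -> inA f a -> inA g a.
Proof. by move=> fg; rewrite (funext fg). Qed.

Lemma inA_horner (p : {poly C}) : inA (fun t => p.[expi t]) p.[0].
Proof.
split; first exact: ccont_horner.
by move=> e e0; exists p; split=> [|t]; rewrite subrr normr0 ltW.
Qed.

Lemma inA_cst (c : C) : inA (fun=> c) c.
Proof.
have := inA_horner c%:P; rewrite hornerC; apply: inA_ext => t.
by rewrite hornerC.
Qed.

Lemma inAD f g a b : inA f a -> inA g b -> inA (fun t => f t + g t) (a + b).
Proof.
move=> [cf fa] [cg gb]; split; first exact: ccontD.
move=> e e0; have e2 : 0 < e / 2 by rewrite divr_gt0.
have [p [p0 pf]] := fa _ e2; have [q [q0 qg]] := gb _ e2.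
exists (p + q); split=> [|t]; rewrite hornerD (splitr e).
  by rewrite opprD addrACA (le_trans (ler_normD _ _))// lerD.
by rewrite opprD addrACA (le_trans (ler_normD _ _))// lerD.
Qed.

Lemma horner_bounded (p : {poly C}) : exists2 B : C, 0 < B &
  forall z : C, `|z| <= 1 -> `|p.[z]| <= B.
Proof.
elim/poly_ind: p => [|p c [B B0 Bp]].
  by exists 1 => // z _; rewrite horner0 normr0.
exists (B + `|c| + 1) => [|z z1]; first by rewrite ltr_wpDl// addr_ge0// ltW.
rewrite hornerMXaddC (le_trans (ler_normD _ _))// -addrA lerD//.
  by rewrite normrM -[leRHS]mulr1 ler_pM// Bp.
by rewrite lerDl ler01.
Qed.

Lemma inA_bounded f a : inA f a -> exists2 B : C, 0 < B &
  `|a| <= B /\ forall t, `|f t| <= B.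
Proof.
move=> [_ /(_ 1 ltr01) [p [p0 pf]]]; have [B B0 Bp] := horner_bounded p.
exists (B + 1); first by rewrite ltr_wpDl// ltW.
split=> [|t].
  rewrite -[a](subKr p.[0]) (le_trans (ler_normB _ _))// lerD//.
  by apply: Bp; rewrite normr0 ler01.
rewrite -[f t](subrK p.[expi t]) addrC (le_trans (ler_normD _ _))// lerD//.
by apply: Bp; rewrite expi_norm1.
Qed.

(** Both factors are bounded, so the approximations can be multiplied. *)
Lemma inAM f g a b : inA f a -> inA g b -> inA (fun t => f t * g t) (a * b).
Proof.
move=> fA [cg gb]; have [B B0 [aB fB]] := inA_bounded fA.
case: fA => cf fa; split; first exact: ccontM.
move=> e e0.
have e1 : 0 < e / 2 / B by rewrite !divr_gt0.
have [q [q0 qg]] := gb _ e1; have [D D0 Dq] := horner_bounded q.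
have e2 : 0 < e / 2 / D by rewrite !divr_gt0.
have [p [p0 pf]] := fa _ e2.
exists (p * q); split=> [|t]; rewrite hornerM (splitr e).
  have -> : p.[0] * q.[0] - a * b = a * (q.[0] - b) + (p.[0] - a) * q.[0] by ring.
  rewrite (le_trans (ler_normD _ _))// !normrM lerD//.
    apply: le_trans (_ : B * (e / 2 / B) <= _); first by rewrite ler_pM.
    by rewrite mulrC divfK// gt_eqF.
  apply: le_trans (_ : (e / 2 / D) * D <= _).
    by rewrite ler_pM// Dq// normr0 ler01.
  by rewrite divfK// gt_eqF.
have -> : f t * g t - p.[expi t] * q.[expi t] =
  f t * (g t - q.[expi t]) + (f t - p.[expi t]) * q.[expi t] by ring.
rewrite (le_trans (ler_normD _ _))// !normrM lerD//.
  apply: le_trans (_ : B * (e / 2 / B) <= _); first by rewrite ler_pM.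
  by rewrite mulrC divfK// gt_eqF.
apply: le_trans (_ : (e / 2 / D) * D <= _).
  by rewrite ler_pM// Dq// expi_norm1.
by rewrite divfK// gt_eqF.
Qed.

Lemma inAN f a : inA f a -> inA (fun t => - f t) (- a).
Proof.
move=> fA; rewrite -mulN1r; apply: inA_ext (inAM (inA_cst (-1)) fA) => t.
by rewrite mulN1r.
Qed.

Lemma inAB f g a b : inA f a -> inA g b -> inA (fun t => f t - g t) (a - b).
Proof. by move=> fA gB; apply: inAD => //; exact: inAN. Qed.

Lemma inAX f a n : inA f a -> inA (fun t => f t ^+ n) (a ^+ n).
Proof.
move=> fA; elim: n => [|n IH]; first exact: inA_cst.
by rewrite exprS; apply: inA_ext (inAM fA IH) => t; rewrite exprS.
Qed.

(** The disc algebra is closed under uniform limits. *)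
Lemma inA_lim f a : ccont f ->
  (forall e : C, 0 < e -> exists g b, [/\ inA g b, `|b - a| <= e &
      forall t, `|f t - g t| <= e]) -> inA f a.
Proof.
move=> cf fl; split => // e e0.
have e2 : 0 < e / 2 by rewrite divr_gt0.
have [g [b [[_ gb] ba fg]]] := fl _ e2.
have [p [p0 pg]] := gb _ e2.
exists p; split=> [|t]; rewrite (splitr e).
  by rewrite -(subrK b p.[0]) -addrA (le_trans (ler_normD _ _))// lerD.
by rewrite -(subrK (g t) (f t)) -addrA (le_trans (ler_normD _ _))// lerD.
Qed.

(** The geometric series of [g] converges uniformly. *)
Lemma inA_geom g b (q : C) : inA g b -> 0 <= q < 1 -> `|b| <= q ->
  (forall t, `|g t| <= q) -> inA (fun t => (1 - g t)^-1) (1 - b)^-1.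
Proof.
move=> gA /andP[q0 q1] bq gq.
have n0 (x : C) : `|x| <= q -> 1 - x != 0.
  move=> xq; rewrite subr_eq0; apply/eqP => x1.
  by have := le_lt_trans xq q1; rewrite -x1 normr1 ltxx.
have geo (x : C) n : `|x| <= q ->
  `|(1 - x)^-1 - \sum_(i < n) x ^+ i| <= q ^+ n / (1 - q).
  move=> xq; have x0 := n0 _ xq.
  have h : (1 - x) * \sum_(i < n) x ^+ i = 1 - x ^+ n.
    have := subrX1 x n; rewrite -opprB => /(congr1 -%R); rewrite opprK => ->.
    by rewrite -mulNr opprB.
  have -> : (1 - x)^-1 - \sum_(i < n) x ^+ i = x ^+ n / (1 - x).
    apply: (mulfI x0); rewrite mulrBr mulfV// h [RHS]mulrC divfK//.
    by rewrite opprB addrC subrK.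
  rewrite normrM normrX normfV ler_pM ?exprn_ge0 ?invr_ge0//.
    by rewrite lerXn2r ?nnegrE.
  rewrite lef_pV2 ?posrE ?subr_gt0 ?normr_gt0//.
  apply: le_trans (lerB_dist _ _); rewrite normr1 lerB//.
apply: inA_lim.
  apply: ccontV; last by move=> t; exact: n0.
  by apply: ccontB; [exact: ccont_cst | case: gA].
move=> e e0.
have [n hn] : exists n, q ^+ n / (1 - q) <= e.
  have d0 : 0 < 1 - q by rewrite subr_gt0.
  have qr : q \is Num.real by rewrite ger0_real.
  have er : e \is Num.real by rewrite ger0_real// ltW.
  have /complex_realP [qq qE] := qr; have /complex_realP [ee eE] := er.
  have qq1 : `|qq| < 1.
    by rewrite ger0_norm -?ltcR -?lecR -qE.
  have ee0 : 0 < ee * (1 - qq).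
    rewrite mulr_gt0 ?subr_gt0 -?ltcR -?eE -?qE//.
  have /cvgrPdist_lt /(_ _ ee0) [N _ /(_ N)] := cvg_expr qq1.
  rewrite /= sub0r normrN => /(_ (leqnn _)) hN; exists N.
  rewrite ler_pdivrMr// eE qE -[1 - _]/((1 : R)%:C - _) -rmorphB -rmorphXn -rmorphM lecR.
  exact: le_trans (ler_norm _) (ltW hN).
exists (fun t => \sum_(i < n) g t ^+ i), (\sum_(i < n) b ^+ i); split.
- elim: n {hn} => [|n IH].
    by rewrite big_ord0; apply: inA_ext (inA_cst 0) => t; rewrite big_ord0.
  rewrite big_ord_recr; apply: inA_ext (inAD IH (inAX n gA)) => t.
  by rewrite big_ord_recr.
- by rewrite distrC; exact: le_trans (geo _ n bq) hn.
- by move=> t; exact: le_trans (geo _ n (gq t)) hn.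
Qed.

(** The mean value property, and the vanishing of the Fourier coefficients of
    negative index: both hold for polynomials and pass to uniform limits. *)
Lemma inA_mean f a n : inA f a -> cmean (fun t => f t * expi t ^+ n) =
  if n == 0%N then a else 0.
Proof.
move=> [cf fa]; set v := if _ then _ else _.
have cfX : ccont (fun t => f t * expi t ^+ n) by apply: ccontM => //; exact: ccontX.
apply/eqP; rewrite -subr_eq0 -normr_le0.
suff h (e : R) : 0 < e -> `|cmean (fun t => f t * expi t ^+ n) - v| <= (e *+ 3)%:C.
  rewrite normc_def -[0]/(0%:C) lecR leNgt; apply/negP => lt0.
  set N := Num.sqrt _ in lt0; have := h (N / 4); rewrite normc_def -/N lecR.
  rewrite divr_gt0// => /(_ isT); apply/negP; rewrite -ltNge.
  by rewrite -mulr_natr; lra.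
move=> e0; have e0' : 0 < e%:C by rewrite ltcR.
have [p [p0 pf]] := fa _ e0'.
have hp : cmean (fun t => p.[expi t] * expi t ^+ n) = if n == 0%N then p.[0] else 0.
  case: n {v cfX} => [|n] /=; last by rewrite cmean_hornerMX.
  by rewrite -cmean_horner; apply: eq_cmean => t; rewrite expr0 mulr1.
have cpX : ccont (fun t => p.[expi t] * expi t ^+ n).
  by apply: ccontM; [exact: ccont_horner | exact: ccontX].
rewrite -(subrK (cmean (fun t => p.[expi t] * expi t ^+ n)) (cmean _)) -addrA.
rewrite (le_trans (ler_normD _ _))// mulrSr rmorphD lerD//.
  rewrite -cmeanB//; apply: cmean_norm_le; first exact: ccontB.
  by move=> t; rewrite -mulrBl normrM normrX expi_norm1 expr1n mulr1.
rewrite hp /v; case: (n == 0%N) => //.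
by rewrite subrr normr0 ltW.
Qed.

End DiscAlgebra.

(** * Real-valued moduli, and inversion in the disc algebra *)

Section SquaredModulus.
Variable R : realType.
Notation C := R[i].
Notation Re := complex.Re.
Notation Im := complex.Im.
Implicit Types x y : C.

(** The modulus of an element of [R[i]] lies in [R[i]] again; [sq] and [nrm] are
    its square and its value as real numbers. *)
Definition sq x : R := Re x ^+ 2 + Im x ^+ 2.
Definition nrm x : R := Num.sqrt (sq x).

Lemma sq_ge0 x : 0 <= sq x. Proof. by rewrite addr_ge0 ?sqr_ge0. Qed.

Lemma normE x : `|x| = (nrm x)%:C. Proof. exact: normc_def. Qed.

Lemma nrm_ge0 x : 0 <= nrm x. Proof. exact: sqrtr_ge0. Qed.

Lemma sq_nrm x : nrm x ^+ 2 = sq x. Proof. by rewrite sqr_sqrtr ?sq_ge0. Qed.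

Lemma mulJ_sq x : x * x^* = (sq x)%:C.
Proof.
apply: complex_ext; rewrite ?cReM ?cImM cReJ cImJ /=; first by rewrite /sq; ring.
by ring.
Qed.

Lemma nrmM x y : nrm (x * y) = nrm x * nrm y.
Proof.
by apply: (@complexI R); rewrite rmorphM /= -!normE normrM.
Qed.

Lemma sqM x y : sq (x * y) = sq x * sq y.
Proof. by rewrite -!sq_nrm nrmM exprMn. Qed.

Lemma sqJ x : sq x^* = sq x. Proof. by rewrite /sq cReJ cImJ sqrrN. Qed.

Lemma sqN x : sq (- x) = sq x. Proof. by rewrite /sq cReN cImN !sqrrN. Qed.

Lemma nrmN x : nrm (- x) = nrm x. Proof. by rewrite /nrm sqN. Qed.

Lemma sqR (a : R) : sq a%:C = a ^+ 2.
Proof. by rewrite /sq /= expr0n addr0. Qed.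

Lemma nrmR (a : R) : nrm a%:C = `|a|.
Proof. by rewrite /nrm sqR sqrtr_sqr. Qed.

Lemma sq_eq0 x : (sq x == 0) = (x == 0).
Proof. by rewrite paddr_eq0 ?sqr_ge0// !sqrf_eq0 eq_complex. Qed.

Lemma sq_gt0 x : (0 < sq x) = (x != 0).
Proof. by rewrite lt_def sq_ge0 andbT sq_eq0. Qed.

Lemma nrmD x y : nrm (x + y) <= nrm x + nrm y.
Proof. by rewrite -lecR rmorphD /= -!normE ler_normD. Qed.

Lemma nrmB x y : nrm x - nrm y <= nrm (x - y).
Proof. by rewrite -lecR rmorphB /= -!normE lerB_dist. Qed.

Lemma Re_le_nrm x : Re x <= nrm x.
Proof.
apply: le_trans (ler_norm _) _; rewrite -lecR -normE; exact: normc_ge_Re.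
Qed.

Lemma Im_le_nrm x : `|Im x| <= nrm x.
Proof. by rewrite -lecR -normE; exact: Im_le_norm. Qed.

Lemma sq_expiX t n : sq (expi t ^+ n : C) = 1.
Proof.
rewrite -sq_nrm; have -> : nrm (expi t ^+ n : C) = 1.
  by apply: (@complexI R); rewrite -normE normrX expi_norm1 expr1n.
by rewrite expr1n.
Qed.

Lemma sqV x : sq x^-1 = (sq x)^-1.
Proof.
have [->|x0] := eqVneq x 0; first by rewrite invr0 /sq /= expr0n addr0 invr0.
have s0 : sq x != 0 by rewrite sq_eq0.
by apply: (mulfI s0); rewrite -sqM !mulfV// /sq /= expr1n expr0n addr0.
Qed.

Lemma Re_div x y : Re (x / y) = Re (x * y^*) / sq y.
Proof. by rewrite !cReM cReV cImV cReJ cImJ -/(sq y); ring. Qed.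

Lemma conjcM x y : (x * y)^* = x^* * y^*.
Proof. exact: rmorphM. Qed.

Lemma cont_sq (F : R -> C) : ccont F -> continuous (fun t => sq (F t)).
Proof. by move=> [F1 F2]; apply: contD; exact: cont_sqr. Qed.

Lemma ccontR (f : R -> R) : continuous f -> ccont (fun t => (f t)%:C).
Proof. by move=> cf; split => //; exact: contC. Qed.

End SquaredModulus.

Section Inverse.
Variable R : realType.
Notation C := R[i].
Notation Re := complex.Re.
Notation Im := complex.Im.
Implicit Types f g : R -> C.

(** The value at the centre is the mean of the boundary values. *)
Lemma inA_Re_ge f a (v : R) : inA f a -> (forall t, v <= Re (f t)) -> v <= Re a.
Proof.
move=> fA fv; have cf : ccont f by case: fA.
have <- : cmean f = a.
  have := inA_mean 0 fA; rewrite eqxx => <-.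
  by apply: eq_cmean => t; rewrite expr0 mulr1.
by rewrite -[v]mean_cst /=; apply: mean_le => //; [exact: contC | case: cf].
Qed.

(** The intersection of the half-plane [v <= Re x] with a disc of radius [B] is
    carried by the homothety of ratio [v / B^2] into a disc around 1 of radius
    smaller than 1. *)
Lemma nrm_sub1_le (x : C) (v B : R) : 0 < v -> v <= Re x -> sq x <= B ^+ 2 -> 0 < B ->
  nrm (1 - (v / B ^+ 2)%:C * x) <= 1 - (v / B) ^+ 2 / 2.
Proof.
move=> v0 vx xB B0.
have vB : v <= B.
  rewrite -(@ler_pXn2r _ 2) ?nnegrE ?(ltW v0) ?(ltW B0)//.
  apply: (le_trans _ xB); rewrite /sq -[leLHS]addr0 lerD ?sqr_ge0//.
  by rewrite ler_pXn2r ?nnegrE ?(ltW v0)// (le_trans (ltW v0)).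
have s1 : (v / B) ^+ 2 <= 1.
  by rewrite expr_le1 ?ler_pdivrMr ?mul1r// divr_ge0// ltW.
rewrite -(@ler_pXn2r _ 2) ?nnegrE ?nrm_ge0//; last first.
  by rewrite subr_ge0; move: s1; lra.
rewrite sq_nrm /sq cReB cImB cReM cImM /=.
set c := v / B ^+ 2.
have c0 : 0 < c by rewrite divr_gt0// exprn_gt0.
have -> : (v / B) ^+ 2 = c * v by rewrite /c; field; exact: lt0r_neq0.
have h : c * (c * sq x) <= c * v.
  rewrite ler_pM2l// -ler_pdivlMl//; apply: le_trans xB _.
  by rewrite /c invf_div divfK ?gt_eqF.
have h2 : c * v <= c * Re x by rewrite ler_pM2l.
have h3 := sqr_ge0 (c * v / 2); move: h h2 h3; rewrite /sq.
by move: (Re x) (Im x) => a b; nra.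
Qed.

(** After multiplication by a small constant the values of [f] stay in a disc
    around 1 of radius smaller than 1, where the inverse is a geometric series. *)
Lemma inAV f a (v : R) : inA f a -> 0 < v -> (forall t, v <= Re (f t)) ->
  inA (fun t => (f t)^-1) a^-1.
Proof.
move=> fA v0 fv; have av := inA_Re_ge fA fv.
have [B' B0 [aB fB]] := inA_bounded fA.
have /complex_realP [B BE] : B' \is Num.real by rewrite ger0_real// ltW.
rewrite {B'}BE ltcR in B0 aB fB *.
have sB (x : C) : `|x| <= B%:C -> sq x <= B ^+ 2.
  by rewrite normE lecR -sq_nrm => h; rewrite ler_pXn2r ?nnegrE ?nrm_ge0 ?(ltW B0).
set c := v / B ^+ 2; set q := 1 - (v / B) ^+ 2 / 2.
have c0 : c%:C != 0 by rewrite eq_complex /= eqxx andbT gt_eqF// divr_gt0// exprn_gt0.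
have hq (x : C) : v <= Re x -> `|x| <= B%:C -> `|1 - c%:C * x| <= q%:C.
  by move=> vx xB; rewrite normE lecR; apply: nrm_sub1_le => //; exact: sB.
have q01 : 0 <= q%:C < 1.
  apply/andP; split; first exact: le_trans (normr_ge0 _) (hq _ av aB).
  by rewrite -[1]/(1%:C) ltcR /q ltrBlDr ltrDl divr_gt0// exprn_gt0// divr_gt0.
have gA : inA (fun t => 1 - c%:C * f t) (1 - c%:C * a).
  by apply: inAB (inA_cst 1) (inAM (inA_cst _) fA).
have h := inA_geom gA q01 (hq _ av aB) (fun t => hq _ (fv t) (fB t)).
have := inAM (inA_cst c%:C) h.
have E (x : C) : c%:C * (1 - (1 - c%:C * x))^-1 = x^-1.
  by rewrite subKr invfM mulrA mulfV// mul1r.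
by rewrite E; apply: inA_ext => t; rewrite E.
Qed.

End Inverse.

(** * A weight with a prescribed orthogonal polynomial *)

Section Reversal.
Variable R : realType.
Notation C := R[i].

(** Reversal of the coefficients: on the circle it is [z^n conj p]. *)
Definition revp n (p : {poly C}) : {poly C} := \poly_(j < n.+1) (p`_(n - j))^*.

Lemma horner_revp n (p : {poly C}) t : (size p <= n.+1)%N ->
  (revp n p).[expi t] = expi t ^+ n * (p.[expi t])^*.
Proof.
move=> sp; rewrite horner_poly (horner_coef_wide _ sp) rmorph_sum mulr_sumr.
rewrite (reindex_inj rev_ord_inj); apply: eq_bigr => i _ /=.
have il : (i <= n)%N by rewrite -ltnS.
rewrite subSS subKn// rmorphM rmorphXn /= mulrCA; congr (_ * _).
have -> : expi t ^+ n = expi t ^+ (n - i) * expi t ^+ i :> C.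
  by rewrite -exprD subnK.
by rewrite -mulrA -exprMn expiJ expr1n mulr1.
Qed.

End Reversal.

(** The polynomials [V] and [G], together with the weight and the polynomial that
    they determine; [d] is the margin left between [n] and the degrees of [V]
    and [V G]. *)
Section Frame.
Variable R : realType.
Notation C := R[i].
Notation Re := complex.Re.
Notation Im := complex.Im.

Variables (V G : {poly C}) (n d : nat) (v0 v1 g1 : R).
Hypothesis v1_gt0 : 0 < v1.
Hypothesis g1_gt0 : 0 < g1.
Hypothesis V0 : V.[0] = v0%:C.
Hypothesis G0 : G.[0] = 1.
Hypothesis ReV_ge : forall t, v1 <= Re V.[expi t].
Hypothesis ReG_ge : forall t, g1 <= Re G.[expi t].

Let U := V * G.
Hypothesis sizeU : (size U + d <= n)%N.
Hypothesis sizeV : (size V + d <= n)%N.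

Let u t := U.[expi t].
Let v t := V.[expi t].
Let g t := G.[expi t].
Let z t : C := expi t ^+ n.

Let Re_neq0 (x : C) (a : R) : 0 < a -> a <= Re x -> x != 0.
Proof.
move=> a0 ax; rewrite eq_complex negb_and; apply/orP; left.
by rewrite /= gt_eqF// (lt_le_trans a0).
Qed.

Let v_neq0 t : v t != 0. Proof. exact: Re_neq0 v1_gt0 (ReV_ge t). Qed.
Let g_neq0 t : g t != 0. Proof. exact: Re_neq0 g1_gt0 (ReG_ge t). Qed.
Let uE t : u t = v t * g t. Proof. by rewrite /u hornerM. Qed.
Let u_neq0 t : u t != 0. Proof. by rewrite uE mulf_neq0. Qed.

Lemma frame_v0_gt0 : 0 < v0.
Proof.
have := inA_Re_ge (inA_horner V) ReV_ge; rewrite V0 /= => h.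
exact: lt_le_trans h.
Qed.

Let U0 : U.[0] = v0%:C. Proof. by rewrite hornerM V0 G0 mulr1. Qed.

Let inA_iV : inA (fun t => (v t)^-1) v0%:C^-1.
Proof. by rewrite -V0; exact: inAV (inA_horner V) v1_gt0 ReV_ge. Qed.

Let inA_iU : inA (fun t => (u t)^-1) v0%:C^-1.
Proof.
have := inAM inA_iV (inAV (inA_horner G) g1_gt0 ReG_ge).
rewrite G0 invr1 mulr1; apply: inA_ext => t.
by rewrite uE invfM.
Qed.

(** The function [y] such that [E = U V (1 + y)], where
    [E = U V + z^n (conj U V - U conj V) / 2]. *)
Definition frame_y t : C := (z t * (u t)^* / u t - z t * (v t)^* / v t) / 2.
Let y := frame_y.

(** As [U] and [V] have degree smaller than [n - d], [z^n conj U] and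
    [z^n conj V] are [z^(d+1)] times polynomials, and [y] is [z^(d+1)] times
    the following element of the disc algebra. *)
Let y' t : C :=
  ((revp (n - d.+1) U).[expi t] / u t - (revp (n - d.+1) V).[expi t] / v t) / 2.

Let d_lt_n : (d < n)%N.
Proof.
apply: leq_trans sizeU; rewrite -addn1 addnC leq_add2r size_poly_gt0.
by apply/eqP => U00; have /eqP := u_neq0 0; rewrite /u U00 horner0.
Qed.

Let zE t : z t = expi t ^+ d.+1 * expi t ^+ (n - d.+1).
Proof. by rewrite -exprD subnKC. Qed.

Let yE t : y t = expi t ^+ d.+1 * y' t.
Proof.
have h (p : {poly C}) : (size p + d <= n)%N -> (size p <= (n - d.+1).+1)%N.
  by move=> sp; rewrite subnSK// leq_subRL 1?addnC// ltnW.
by rewrite /y /frame_y /y' !horner_revp ?h// zE -/(u t) -/(v t); ring.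
Qed.

Let inA_y' : exists a, inA y' a.
Proof.
eexists; apply: inAM (inA_cst _); apply: inAB.
  exact: inAM (inA_horner _) inA_iU.
exact: inAM (inA_horner _) inA_iV.
Qed.

(** [y] is a unimodular factor times [(conj G - G) / (2 G)], so that
    [|y| = |Im G| / |G|]. *)
Let sq_y t : sq (y t) = 1 - Re (g t) ^+ 2 / sq (g t).
Proof.
have -> : y t = z t * (v t)^* / v t * ((g t)^* - g t) / (2 * g t).
  rewrite /y /frame_y uE rmorphM /=; field.
  by rewrite v_neq0 g_neq0 ?pnatr_eq0.
have sz : sq (z t) = 1 by exact: sq_expiX.
have sv : sq (v t) != 0 by rewrite sq_eq0.
have sg : sq (g t) != 0 by rewrite sq_eq0.
rewrite !sqM !sqV sqJ sz mul1r mulfV// mul1r sqM.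
have -> : sq (2 : C) = 4.
  have -> : (2 : C) = (2 : R)%:C by rewrite rmorph_nat.
  by rewrite sqR; ring.
rewrite /sq cReB cImB cReJ cImJ in sg *; move: sg.
move: (Re (g t)) (Im (g t)) => a b sg.
by field.
Qed.

(** [|y|^2 = 1 - (Re G)^2 / |G|^2], where [Re G >= g1] and [|G|] is bounded. *)
Let y_lt1 : exists2 q : C, 0 <= q < 1 & forall t, `|y t| <= q.
Proof.
have [B' B0 [aB fB]] := inA_bounded (inA_horner G).
have /complex_realP [B BE] : B' \is Num.real by rewrite ger0_real// ltW.
rewrite {B' aB}BE ltcR in B0 fB *.
have sB t : sq (g t) <= B ^+ 2.
  by have := fB t; rewrite normE lecR -sq_nrm => h; rewrite ler_pXn2r ?nnegrE ?nrm_ge0 ?(ltW B0).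
pose s := (g1 / B) ^+ 2.
have s0 : 0 < s by rewrite exprn_gt0// divr_gt0.
have ys t : sq (y t) <= 1 - s.
  rewrite sq_y lerD2l lerN2 /s exprMn exprVn.
  rewrite ler_pM ?exprn_ge0 ?invr_ge0 ?(ltW g1_gt0) ?exprn_ge0 ?(ltW B0)//.
    rewrite lerXn2r ?nnegrE ?(ltW g1_gt0)//.
      exact: le_trans (ltW g1_gt0) (ReG_ge t).
    exact: ReG_ge.
  by rewrite lef_pV2 ?posrE ?sq_gt0 ?exprn_gt0.
have s1 : s <= 1 by have := ys 0; have := sq_ge0 (y 0); lra.
exists (1 - s / 2)%:C.
  by rewrite ler0c (_ : 1 = 1%:C)// ltcR; apply/andP; split; lra.
move=> t; rewrite normE lecR -(@ler_pXn2r _ 2) ?nnegrE ?nrm_ge0//; last by lra.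
by rewrite sq_nrm; apply: le_trans (ys t) _; have := sqr_ge0 (s / 2); nra.
Qed.

Let y1_neq0 t : 1 + y t != 0.
Proof.
have [q /andP[q0 q1] yq] := y_lt1.
rewrite addrC -[1]opprK subr_eq0; apply/eqP => h.
by have := le_lt_trans (yq t) q1; rewrite h normrN normr1 ltxx.
Qed.

Let inA_y : inA y 0.
Proof.
have [a ya] := inA_y'.
have := inAM (inAX d.+1 (inA_horner 'X)) ya.
rewrite hornerX expr0n /= mul0r; apply: inA_ext => t.
by rewrite hornerX yE.
Qed.

Let inA_i1y : inA (fun t => (1 + y t)^-1) 1.
Proof.
have [q q01 yq] := y_lt1.
have := @inA_geom R (fun t => - y t) 0 q.
rewrite subr0 invr1 => h.
suff : inA (fun t => (1 - - y t)^-1) 1 by apply: inA_ext => t; rewrite opprK.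
apply: h => //.
- by rewrite -oppr0; exact: inAN.
- by rewrite normr0; case/andP: q01.
- by move=> t; rewrite normrN.
Qed.

(** Equal to [Re(U conj V) / |E|^2], after simplification by [|V|^2]; see [wE]. *)
Definition frame_w t : R :=
  Re (g t) / (sq (v t) * sq (g t) * sq (1 + y t)).
Let w := frame_w.

Let Reg_gt0 t : 0 < Re (g t). Proof. exact: lt_le_trans (ReG_ge t). Qed.

Lemma frame_w_gt0 t : 0 < w t.
Proof.
by rewrite /w /frame_w divr_gt0// !mulr_gt0// sq_gt0.
Qed.

Lemma frame_w_cont : continuous w.
Proof.
have cV := ccont_horner V; have cG := ccont_horner G.
apply: contM; first by case: cG.
apply: contV.
  apply: contM; last first.
    apply: cont_sq; apply: ccontD; first exact: ccont_cst.
    by case: inA_y.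
  by apply: contM; exact: cont_sq.
by move=> t; rewrite !mulf_neq0// sq_eq0.
Qed.

Definition frame_phi : {poly C} := 2^-1 *: (U - V + revp n (U + V)).
Let phi := frame_phi.

Let sizeUV : (size (U + V)%R <= n.+1)%N.
Proof.
apply: leq_trans (size_polyD _ _) _; rewrite geq_max.
have h (p : {poly C}) : (size p + d <= n)%N -> (size p <= n.+1)%N.
  by move=> hp; apply: leqW; apply: leq_trans hp; exact: leq_addr.
by rewrite !h.
Qed.

Let phiE t : phi.[expi t] = (u t - v t + z t * (u t + v t)^*) / 2.
Proof.
rewrite /phi /frame_phi hornerZ !hornerD hornerN horner_revp// hornerD.
by rewrite mulrC.
Qed.

Let f1 t : C := ((u t)^-1 + (v t)^-1) * (1 + y t)^-1.
Let f2 t : C := ((u t)^-1 - (v t)^-1) * (1 + y t)^-1.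

Let inA_f1 : inA f1 (2 / v0%:C).
Proof.
have := inAM (inAD inA_iU inA_iV) inA_i1y.
by rewrite mulr1 -mulr2n -[_ *+ 2]mulr_natl.
Qed.

Let inA_f2 : inA f2 0.
Proof.
have := inAM (inAB inA_iU inA_iV) inA_i1y.
by rewrite subrr mul0r.
Qed.

Let zJ t : z t * (z t)^* = 1.
Proof. by rewrite mulJ_sq sq_expiX. Qed.

Let E t : C := u t * v t * (1 + y t).

Let EE t : E t = u t * v t + 2^-1 * z t * ((u t)^* * v t - u t * (v t)^*).
Proof.
rewrite /E /y /frame_y; field.
by rewrite v_neq0 u_neq0 ?pnatr_eq0.
Qed.

Let E_neq0 t : E t != 0. Proof. by rewrite !mulf_neq0. Qed.

Let wE t : (w t)%:C = (u t * (v t)^* + (u t)^* * v t) / 2 / (E t * (E t)^*).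
Proof.
have s0 (x : C) : x != 0 -> sq x != 0 by rewrite sq_eq0.
have sv := s0 _ (v_neq0 t); have sg := s0 _ (g_neq0 t); have s1 := s0 _ (y1_neq0 t).
have -> : u t * (v t)^* + (u t)^* * v t = (sq (v t))%:C * (g t + (g t)^*).
  by rewrite -mulJ_sq uE rmorphM /=; ring.
rewrite mulJ_sq -[_ * (g t + _) / 2]mulrA -ReJ_add -rmorphM -fmorphV -rmorphM; congr _%:C.
rewrite /w /frame_w /E uE !sqM; field.
by rewrite sv sg s1.
Qed.

(** The identity from which the orthogonality follows.  The polynomial identity
    [core] treats a complex number and its conjugate as independent variables,
    subject only to [z conj z = 1]. *)
Let phi_w t : phi.[expi t] * (w t)%:C = 2^-1 * (z t * f1 t) - 2^-1 * (f2 t)^*.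
Proof.
have f1E : f1 t = (u t + v t) / E t.
  by rewrite /f1 /E; field; rewrite u_neq0 v_neq0 y1_neq0.
have f2E : f2 t = (v t - u t) / E t.
  by rewrite /f2 /E; field; rewrite u_neq0 v_neq0 y1_neq0.
have Ec0 : (E t)^* != 0 by rewrite conjc_eq0.
have core (a b a' b' c c' : C) : c * c' = 1 ->
   (a - b + c * (a' + b')) * (a * b' + a' * b) / 2 =
   c * (a + b) * (a' * b' + 2^-1 * c' * (a * b' - a' * b))
   - (b' - a') * (a * b + 2^-1 * c * (a' * b - a * b')).
  move=> zz; apply/eqP; rewrite -subr_eq0; apply/eqP.
  transitivity ((1 - c * c') * (2^-1 * (a + b) * (a * b' - a' * b))).
    by field.
  by rewrite zz subrr mul0r.
have := core (u t) (v t) ((u t)^*) ((v t)^*) (z t) ((z t)^*).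
move=> /(_ (zJ t)).
have -> : (u t)^* * (v t)^* + 2^-1 * (z t)^* * (u t * (v t)^* - (u t)^* * v t) = (E t)^*.
  by rewrite EE rmorphD !rmorphM rmorphB !rmorphM fmorphV rmorph_nat /= !conjcK.
rewrite -EE => K.
have f2J : (f2 t)^* = ((v t)^* - (u t)^*) / (E t)^*.
  by rewrite f2E rmorphM fmorphV rmorphB.
rewrite wE phiE f1E f2J [(u t + v t)^*]rmorphD /=.
have -> : (u t - v t + z t * ((u t)^* + (v t)^*)) / 2 *
  ((u t * (v t)^* + (u t)^* * v t) / 2 / (E t * (E t)^*)) =
  (u t - v t + z t * ((u t)^* + (v t)^*)) * (u t * (v t)^* + (u t)^* * v t) / 2 / 2 / (E t * (E t)^*).
  by field; rewrite E_neq0 Ec0.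
rewrite K; field.
by rewrite E_neq0 Ec0.
Qed.

(** By [phi_w], [phi w] is the difference of [z^n] times an analytic function
    and of the conjugate of an analytic function that vanishes at 0, divided by
    2.  The latter has no Fourier coefficient of nonnegative index, and the
    former none of index smaller than [n]. *)
Lemma frame_orth k : (k <= n)%N ->
  cmean (fun t => phi.[expi t] * (w t)%:C * (expi t ^+ k)^*) =
  if k == n then v0%:C^-1 else 0.
Proof.
move=> kn.
have cf1 : ccont f1 by case: inA_f1.
have cf2 : ccont f2 by case: inA_f2.
have zk t : z t * (expi t ^+ k)^* = expi t ^+ (n - k).
  by rewrite /z -{1}(subnK kn) exprD -mulrA mulJ_sq sq_expiX mulr1.
rewrite (@eq_cmean _ _ (fun t => 2^-1 * (f1 t * expi t ^+ (n - k))
    - 2^-1 * (f2 t * expi t ^+ k)^*)); last first.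
  move=> t; rewrite phi_w [(f2 t * _)^*]rmorphM -zk /=.
  by move: ((f2 t)^*) ((expi t ^+ k)^*) => a b; ring.
have c1 : ccont (fun t => f1 t * expi t ^+ (n - k)) by apply: ccontM => //; exact: ccontX.
have c2 : ccont (fun t => f2 t * expi t ^+ k) by apply: ccontM => //; exact: ccontX.
rewrite cmeanB; last 2 first.
- by apply: ccontM => //; exact: ccont_cst.
- by apply: ccontM; [exact: ccont_cst | exact: ccontJ].
rewrite !cmeanZ//; last exact: ccontJ.
rewrite cmeanJ// (inA_mean _ inA_f1) (inA_mean _ inA_f2).
have -> : (if k == 0%N then 0 else 0 : C) = 0 by case: eqP.
rewrite conjc0 mulr0 subr0 subn_eq0.
have -> : (n <= k)%N = (k == n) by rewrite eqn_leq kn.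
case: eqP => _; last by rewrite mulr0.
by rewrite mulrA mulVf ?mul1r// pnatr_eq0.
Qed.

(** The leading coefficient comes from the constant term of [U + V], which the
    reversal sends to degree [n]. *)
Lemma frame_size : size phi = n.+1 /\ lead_coef phi = v0%:C.
Proof.
have h (p : {poly C}) : (size p + d <= n)%N -> (size p <= n)%N.
  by move=> hp; apply: leq_trans hp; exact: leq_addr.
have cn : phi`_n = v0%:C.
  rewrite coefZ !coefD coefN (nth_default 0 (h _ sizeU)) (nth_default 0 (h _ sizeV)) subrr add0r.
  rewrite coef_poly ltnSn subnn -horner_coef0.
  by rewrite hornerD V0 U0 -rmorphD conjc_real rmorphD -mulr2n -[v0%:C *+ 2]mulr_natl mulKf// pnatr_eq0.
have sp : (size phi <= n.+1)%N.
  apply: leq_trans (size_scale_leq _ _) _.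
  apply: leq_trans (size_polyD _ _) _; rewrite geq_max; apply/andP; split.
    apply: leq_trans (size_polyD _ _) _; rewrite size_polyN geq_max.
    by rewrite !leqW// h.
  exact: size_poly.
have sE : size phi = n.+1.
  apply/eqP; rewrite eqn_leq sp /=.
  rewrite ltnNge; apply/negP => /leq_sizeP /(_ n (leqnn n)); rewrite cn.
  by move=> /eqP; rewrite eq_complex /= eqxx andbT gt_eqF// frame_v0_gt0.
by split=> //; rewrite lead_coefE sE.
Qed.

(** [w = Re G / (|V|^2 |G (1 + y)|^2)], and [G (1 + y)] differs from [G] by a
    number of modulus [|Im G|]. *)
Lemma frame_w_ge (b : R) t : 0 < b ->
  sq (v t) * (nrm (g t) + `|Im (g t)|) ^+ 2 <= b * Re (g t) -> b^-1 <= w t.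
Proof.
move=> b0 hb; rewrite /w /frame_w.
have s0 (x : C) : x != 0 -> 0 < sq x by rewrite sq_gt0.
rewrite ler_pdivlMr; last by rewrite !mulr_gt0// s0.
rewrite ler_pdivrMl//; apply: le_trans hb.
rewrite -mulrA ler_pM2l ?s0// -sqM -sq_nrm.
rewrite lerXn2r ?nnegrE ?addr_ge0 ?nrm_ge0//.
have -> : g t * (1 + y t) = g t + z t * (v t)^* / v t * (((g t)^* - g t) / 2).
  rewrite /y /frame_y uE rmorphM; field.
  by rewrite v_neq0 g_neq0 ?pnatr_eq0.
apply: le_trans (nrmD _ _) _; rewrite lerD2l !nrmM.
have n1 : nrm (z t) = 1 by apply: (@complexI R); rewrite -normE normrX expi_norm1 expr1n.
have n2 : nrm (v t)^* * nrm (v t)^-1 = 1.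
  rewrite -nrmM -(@sqrtr1 R) /nrm sqM sqJ sqV mulfV// sq_eq0.
  exact: v_neq0.
rewrite n1 mul1r -!mulrA mulrA n2 mul1r -nrmM.
have -> : ((g t)^* - g t) / 2 = - (0 +i* Im (g t)).
  have -> : (g t)^* - g t = 2 * - (0 +i* Im (g t)).
    rewrite mulr_natl mulr2n.
    apply: complex_ext; rewrite ?cReB ?cImB ?cReD ?cImD ?cReN ?cImN ?cReJ ?cImJ /=.
      by rewrite subrr oppr0 addr0.
    by rewrite /=; ring.
  by rewrite mulrAC mulfV ?mul1r// pnatr_eq0.
by rewrite nrmN /nrm /sq /= expr0n add0r sqrtr_sqr.
Qed.

(** [w |V|^2 Re G = Re((1-y)/(1+y)) = 1 - 2 Re(y/(1+y))], where [y/(1+y)] is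
    [z^(d+1)] times an analytic function.  Multiplied by [Re r], where [r] has
    degree at most [d], the second term has mean 0. *)
Lemma frame_mass (r : {poly C}) : (size r <= d.+1)%N ->
  (forall t, 1 <= sq (v t) * Re (g t) * Re r.[expi t]) ->
  mean w <= Re r.[0].
Proof.
move=> sr hr.
have [a ya] := inA_y'.
pose k' t := y' t / (1 + y t).
have k'A : inA k' (a * 1) := inAM ya inA_i1y.
pose q t : C := r.[expi t] * (k' t * expi t ^+ d.+1).
pose q' t : C := (revp d r).[expi t] * k' t * expi t ^+ 1.
have cq : ccont q.
  by apply: ccontM; [exact: ccont_horner | apply: ccontM; [case: k'A | exact: ccontX]].
have cq' : ccont q'.
  apply: ccontM; last exact: ccontX.
  by apply: ccontM; [exact: ccont_horner | case: k'A].
have mq : cmean q = 0.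
  rewrite (@eq_cmean _ _ (fun t => (r.[expi t] * k' t) * expi t ^+ d.+1)); last first.
    by move=> t; rewrite /q mulrA.
  by rewrite (inA_mean _ (inAM (inA_horner r) k'A)).
have mq' : cmean q' = 0.
  by rewrite (inA_mean _ (inAM (inA_horner _) k'A)).
have cr : ccont (fun t => r.[expi t]) := ccont_horner r.
have wle t : w t <= Re r.[expi t] - (Re (q t) + Re (q' t)).
  have -> : Re r.[expi t] - (Re (q t) + Re (q' t)) =
     Re r.[expi t] * Re ((1 - y t) / (1 + y t)).
    set b : C := k' t * expi t ^+ d.+1.
    have -> : (1 - y t) / (1 + y t) = 1 - (b + b).
      have -> : b = y t / (1 + y t) by rewrite /b /k' mulrAC [y' t * _]mulrC -yE.
      by field; exact: y1_neq0.
    have -> : Re (q' t) = Re ((r.[expi t])^* * b).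
      by rewrite /q' /b horner_revp//; congr Re; rewrite expr1 exprS; ring.
    have core (a' b' : C) : Re a' - (Re (a' * b') + Re (a'^* * b')) =
        Re a' * Re (1 - (b' + b')).
      rewrite !cReM cReB cReD cReJ cImJ (_ : Re 1 = 1)//.
      by move: (Re a') (Im a') (Re b') (Im b') => *; ring.
    exact: core.
  have cay : w t * (sq (v t) * Re (g t)) = Re ((1 - y t) / (1 + y t)).
    have -> : Re ((1 - y t) / (1 + y t)) = (1 - sq (y t)) / sq (1 + y t).
      rewrite Re_div; congr (_ / _); move: (y t) => [c e].
      by rewrite /sq cReM cReB cImB cReJ cImJ cReD cImD /=; ring.
    rewrite sq_y /w /frame_w; field.
    by rewrite !sq_eq0 v_neq0 g_neq0 y1_neq0.
  have Y0 : 0 <= w t by rewrite ltW// frame_w_gt0.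
  by rewrite -cay mulrCA ler_peMr// mulrC.
apply: le_trans (_ : mean (fun t => Re r.[expi t] - (Re (q t) + Re (q' t))) <= _).
  apply: mean_le wle; first exact: frame_w_cont.
  by apply: contD; [case: cr | apply: contN; apply: contD; [case: cq | case: cq']].
rewrite meanB; [|by case: cr|by apply: contD; [case: cq | case: cq']].
rewrite meanD; [|by case: cq|by case: cq'].
have -> : mean (fun t => Re (q t)) = 0 by have := congr1 (@complex.Re R) mq.
have -> : mean (fun t => Re (q' t)) = 0 by have := congr1 (@complex.Re R) mq'.
by rewrite addr0 subr0 -cmean_horner.
Qed.

(** In [|phi|^2] the terms without [z^n] sum up to [(|U|^2 + |V|^2)/2]; the cross
    term is the real part of [z^n conj(U^2 - V^2)/2], which has mean 0 against
    [|tau|^2] as soon as [tau (U^2 - V^2)] has degree smaller than [n]. *)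
Lemma frame_test (tau : {poly C}) :
  (size (tau * (U ^+ 2 - V ^+ 2))%R <= n)%N ->
  mean (fun t => sq tau.[expi t] * sq phi.[expi t]) =
  mean (fun t => sq tau.[expi t] * (sq (u t) + sq (v t))) / 2.
Proof.
move=> st.
set P := (tau * (U ^+ 2 - V ^+ 2))%R in st.
have n0 : (0 < n)%N := leq_ltn_trans (leq0n d) d_lt_n.
pose q t : C := (revp n.-1 P * tau).[expi t] * expi t ^+ 1.
have mq : cmean q = 0 by rewrite (inA_mean _ (inA_horner _)).
have cq : ccont q by apply: ccontM; [exact: ccont_horner | exact: ccontX].
have cc (p : {poly C}) : continuous (fun t => sq p.[expi t]).
  by apply: cont_sq; exact: ccont_horner.
have cs : continuous (fun t => sq tau.[expi t] * (sq (u t) + sq (v t))).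
  by apply: contM => //; apply: contD; exact: cc.
rewrite mulrC -meanZ//.
rewrite (@eq_mean _ _ (fun t => 2^-1 * (sq tau.[expi t] * (sq (u t) + sq (v t))) + 2^-1 * Re (q t))).
  rewrite meanD ?meanZ; last 4 first.
  - by case: cq.
  - exact: cs.
  - by apply: contM => //; exact: contC.
  - by apply: contM; [exact: contC | case: cq].
  have -> : mean (fun t => Re (q t)) = 0 by have := congr1 (@complex.Re R) mq.
  by rewrite mulr0 addr0.
move=> t.
have -> : q t = z t * (tau.[expi t])^* * tau.[expi t] * (((u t) ^+ 2)^* - ((v t) ^+ 2)^*).
  have zE' : z t = expi t ^+ n.-1 * expi t ^+ 1 by rewrite -exprD addn1 prednK.
  have PJ : (P.[expi t])^* = (tau.[expi t])^* * ((u t ^+ 2)^* - (v t ^+ 2)^*).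
    by rewrite -rmorphB -rmorphM /P hornerM hornerD hornerN !horner_exp.
  rewrite /q hornerM horner_revp ?prednK// PJ zE'.
  move: (expi t ^+ n.-1) (expi t ^+ 1) ((tau.[_])^*) ((u t ^+ 2)^*) ((v t ^+ 2)^*).
  by move=> *; ring.
rewrite phiE -[z t * _ * _]mulrA [_^* * tau.[_]]mulrC mulJ_sq.
set s := sq tau.[_].
have zs : sq (z t) = 1 by exact: sq_expiX.
have -> : (u t - v t + z t * (u t + v t)^*) / 2 = (2^-1 : R)%:C * (u t - v t + z t * (u t + v t)^*).
  by rewrite mulrC fmorphV rmorph_nat.
rewrite sqM sqR rmorphXn rmorphXn /= rmorphD /=.
move: zs; rewrite /sq; move: (z t) (u t) (v t) => [z1 z2] [u1 u2] [v1' v2].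
rewrite !expr2; simpc => /= zs.
apply/eqP; rewrite -subr_eq0; apply/eqP.
transitivity ((z1 * z1 + z2 * z2 - 1) * (s / 4) * ((u1 + v1') ^+ 2 + (u2 + v2) ^+ 2)).
  by field.
by rewrite zs subrr !mul0r.
Qed.

End Frame.

(** * The Parseval identity and orthonormal families *)

Section Parseval.
Variable R : realType.
Notation C := R[i].
Notation Re := complex.Re.
Notation Im := complex.Im.

Lemma cmean_sum (I : Type) (r : seq I) (F : I -> R -> C) :
  (forall i, ccont (F i)) ->
  cmean (fun t => \sum_(i <- r) F i t) = \sum_(i <- r) cmean (F i) /\
  ccont (fun t => \sum_(i <- r) F i t).
Proof.
move=> cF; elim: r => [|i r [IH1 IH2]].
  rewrite big_nil (@eq_cmean _ _ (fun=> 0)) ?cmean_cst; last by move=> t; rewrite big_nil.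
  by split=> //; apply: ccont_ext (ccont_cst 0) => t; rewrite big_nil.
rewrite big_cons -IH1 -cmeanD//; split.
  by apply: eq_cmean => t; rewrite big_cons.
by apply: ccont_ext (ccontD (cF i) IH2) => t; rewrite big_cons.
Qed.

Lemma cmean_coef (p : {poly C}) k :
  cmean (fun t => p.[expi t] * (expi t ^+ k)^*) = p`_k.
Proof.
have cXJ j : ccont (fun t : R => (expi t ^+ j : C)^*) by apply: ccontJ; exact: ccontX.
elim/poly_ind: p k => [|p c IH] k.
  by rewrite coef0 -[RHS](cmean_cst 0); apply: eq_cmean => t; rewrite horner0 mul0r.
case: k => [|k].
  rewrite -horner_coef0 -cmean_horner; apply: eq_cmean => t.
  by rewrite expr0 conjc1 mulr1.
rewrite coefD coefMX coefC /= addr0 -IH.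
rewrite (@eq_cmean _ _ (fun t => p.[expi t] * (expi t ^+ k)^* + c * (expi t ^+ k.+1)^*)).
  rewrite cmeanD ?cmeanZ ?cmeanJ ?cmean_expiX ?conjc0 ?mulr0 ?addr0//.
  - exact: ccontX.
  - by apply: ccontM => //; exact: ccont_horner.
  - by apply: ccontM => //; exact: ccont_cst.
move=> t; rewrite hornerMXaddC mulrDl; congr (_ + _).
rewrite exprS rmorphM /= -mulrA; congr (_ * _).
by rewrite mulrA expiJ mul1r.
Qed.

Lemma mean_sq_horner (p : {poly C}) :
  mean (fun t => sq p.[expi t]) = \sum_(i < size p) sq p`_i.
Proof.
have -> : mean (fun t => sq p.[expi t]) = Re (cmean (fun t => p.[expi t] * (p.[expi t])^*)).
  by apply: eq_mean => t; rewrite mulJ_sq.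
pose F (i : 'I_(size p)) t : C := (p`_i)^* * (p.[expi t] * (expi t ^+ i)^*).
have cF0 (i : 'I_(size p)) : ccont (fun t => p.[expi t] * (expi t ^+ i)^*).
  by apply: ccontM; [exact: ccont_horner | apply: ccontJ; exact: ccontX].
have cF i : ccont (F i) by apply: ccontM => //; exact: ccont_cst.
have -> : cmean (fun t => p.[expi t] * (p.[expi t])^*) = \sum_(i < size p) (sq p`_i)%:C.
  rewrite (@eq_cmean _ _ (fun t => \sum_(i <- index_enum 'I_(size p)) F i t)).
    rewrite (proj1 (cmean_sum _ cF)); apply: eq_bigr => i _.
    by rewrite cmeanZ// cmean_coef mulrC mulJ_sq.
  move=> t; rewrite {2}horner_coef rmorph_sum mulr_sumr; apply: eq_bigr => i _.
  by rewrite /F rmorphM /=; ring.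
by rewrite -rmorph_sum.
Qed.

(** Cauchy-Schwarz against the constant sequence 1. *)
Lemma sq_sum_le (I : eqType) (r : seq I) (F : I -> C) :
  sq (\sum_(i <- r) F i) <= (size r)%:R * \sum_(i <- r) sq (F i).
Proof.
elim: r => [|i r IH]; first by rewrite !big_nil mulr0 /sq /= expr0n addr0.
rewrite !big_cons /=; set S := \sum_(j <- r) F j in IH *.
set T := \sum_(j <- r) sq (F j) in IH *; set m : R := (size r)%:R in IH *.
rewrite -[(size r).+1%:R]natr1 -/m.
have m0 : 0 <= m by exact: ler0n.
have T0 : 0 <= T by apply: sumr_ge0 => j _; exact: sq_ge0.
have [mz|mp] := eqVneq m 0.
  have r0 : r = [::].
    by move/eqP: mz; rewrite /m pnatr_eq0 => /eqP /size0nil.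
  by rewrite /S /T r0 !big_nil !addr0 mz add0r mul1r.
have mpos : 0 < m by rewrite lt_def mp.
(* The inequality (a + b)^2 <= (m + 1) (a^2 + b^2 / m), with the number [m] of
   remaining terms as weight. *)
have key : sq (F i + S) <= (m + 1) * (sq (F i) + sq S / m).
  rewrite /sq cReD cImD; move: (Re (F i)) (Im (F i)) (Re S) (Im S) => a b c d.
  have h : 0 <= ((m * a - c) ^+ 2 + (m * b - d) ^+ 2) / m.
    by rewrite divr_ge0// addr_ge0// sqr_ge0.
  rewrite -subr_ge0; apply: le_trans h _; rewrite le_eqVlt; apply/orP; left; apply/eqP.
  by field.
apply: le_trans key _; rewrite ler_wpM2l ?addr_ge0// lerD2l.
by rewrite ler_pdivrMr// mulrC.
Qed.

Lemma sq_horner_le (p : {poly C}) t :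
  sq p.[expi t] <= (size p)%:R * mean (fun s => sq p.[expi s]).
Proof.
rewrite mean_sq_horner horner_coef.
apply: le_trans (sq_sum_le _ _) _; rewrite [index_enum _]unlock -enumT size_enum_ord ler_wpM2l//.
by apply: ler_sum => i _; rewrite sqM sq_expiX mulr1.
Qed.

Lemma mean_sq_gt0 (p : {poly C}) : p != 0 -> 0 < mean (fun t => sq p.[expi t]).
Proof.
move=> p0; rewrite mean_sq_horner.
have sp : (0 < size p)%N by rewrite size_poly_gt0.
have lp : ((size p).-1 < size p)%N by rewrite prednK.
rewrite (bigD1 (Ordinal lp)) //= ltr_wpDr//.
  by apply: sumr_ge0 => i _; exact: sq_ge0.
by rewrite sq_gt0 -lead_coefE lead_coef_eq0.
Qed.

End Parseval.

Section GramSchmidt.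
Variable R : realType.
Notation C := R[i].
Variable ip : {poly C} -> {poly C} -> C.
Hypothesis ipD : forall p q r, ip (p + q) r = ip p r + ip q r.
Hypothesis ipZ : forall c p r, ip (c *: p) r = c * ip p r.
Hypothesis ipJ : forall p q, ip q p = (ip p q)^*.
Hypothesis ip_gt0 : forall p, p != 0 -> 0 < ip p p.

Let ipB p q r : ip (p - q) r = ip p r - ip q r.
Proof. by rewrite ipD -scaleN1r ipZ mulN1r. Qed.

Let ipDr p q r : ip r (p + q) = ip r p + ip r q.
Proof. by rewrite ipJ ipD rmorphD /= -!ipJ. Qed.

Let ipZr c p r : ip r (c *: p) = c^* * ip r p.
Proof. by rewrite ipJ ipZ rmorphM /= -ipJ. Qed.

(** Induction on the degree, subtracting the component along the monic
    polynomial of degree [n] that is orthogonal to the lower degrees. *)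
Lemma ortho_proj n (p : {poly C}) : exists2 g : {poly C}, (size g <= n)%N &
  forall q : {poly C}, (size q <= n)%N -> ip (p - g) q = 0.
Proof.
elim: n p => [|n IH] p.
  exists 0; first by rewrite size_poly0.
  move=> q; rewrite leqn0 size_poly_eq0 => /eqP ->.
  by rewrite -(scale0r 0) ipZr conjc0 mul0r.
have [gn sgn hgn] := IH 'X^n; have [g sg hg] := IH p.
pose e : {poly C} := 'X^n - gn.
have en : e`_n = 1 by rewrite coefB coefXn eqxx (nth_default 0 sgn) subr0.
have se : (size e <= n.+1)%N.
  rewrite (leq_trans (size_polyD _ _))// geq_max size_polyXn size_polyN leqnn.
  exact: leqW.
have e0 : e != 0 by apply/eqP => h; move: en; rewrite h coef0 => /esym/eqP; rewrite oner_eq0.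
have ee := ip_gt0 e0.
pose c := ip (p - g) e / ip e e.
exists (g + c *: e).
  rewrite (leq_trans (size_polyD _ _))// geq_max leqW//=.
  exact: leq_trans (size_scale_leq _ _) se.
have he (q : {poly C}) : (size q <= n.+1)%N -> exists2 q' : {poly C}, (size q' <= n)%N & q = q`_n *: e + q'.
  move=> sq; exists (q - q`_n *: e); last by rewrite addrC subrK.
  apply/leq_sizeP => j; rewrite leq_eqVlt => /predU1P[<-|nj].
    by rewrite coefB coefZ en mulr1 subrr.
  rewrite coefB coefZ (nth_default 0 (leq_trans sq nj)).
  by rewrite (nth_default 0 (leq_trans se nj)) mulr0 subr0.
move=> q /he [q' sq' ->].
have Xe : ip (p - (g + c *: e)) e = 0.
  by rewrite opprD addrA ipB ipZ /c divfK ?subrr// gt_eqF.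
have Xq : ip (p - (g + c *: e)) q' = 0.
  by rewrite opprD addrA ipB ipZ (hgn _ sq') (hg _ sq') mulr0 subrr.
by rewrite ipDr ipZr Xe Xq mulr0 addr0.
Qed.

Lemma orthonormal_family : exists phi : nat -> {poly C}, forall n,
  [/\ size (phi n) = n.+1, 0 < lead_coef (phi n), ip (phi n) (phi n) = 1 &
      forall q : {poly C}, (size q <= n)%N -> ip (phi n) q = 0].
Proof.
suff h n : exists p : {poly C}, [/\ size p = n.+1, 0 < lead_coef p, ip p p = 1 &
      forall q : {poly C}, (size q <= n)%N -> ip p q = 0].
  by have [phi hphi] := choice h; exists phi.
have [g sg hg] := ortho_proj n 'X^n.
pose e : {poly C} := 'X^n - g.
have sgX : (size (- g)%R < size ('X^n : {poly C}))%N by rewrite size_polyN size_polyXn.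
have se : size e = n.+1 by rewrite /e size_polyDl// size_polyXn.
have le : lead_coef e = 1 by rewrite /e lead_coefDl// lead_coefXn.
have e0 : e != 0 by rewrite -size_poly_eq0 se.
have ee := ip_gt0 e0.
have /complex_realP [a aE] : ip e e \is Num.real by rewrite ger0_real// ltW.
have a0 : 0 < a by rewrite -ltcR -aE.
pose c : C := (Num.sqrt a)^-1%:C.
have c0 : 0 < c by rewrite ltcR invr_gt0 sqrtr_gt0.
exists (c *: e); split.
- by rewrite size_scale// gt_eqF.
- by rewrite lead_coefZ le mulr1.
- rewrite ipZ ipZr aE conjc_real -!rmorphM.
  have sa : Num.sqrt a != 0 by rewrite gt_eqF// sqrtr_gt0.
  by rewrite -{3}(sqr_sqrtr (ltW a0)) expr2 mulKf// mulVf.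
- by move=> q sq; rewrite ipZ hg// mulr0.
Qed.

(** [Omega] ranges over whole orthonormal families, so a single polynomial with
    the right orthogonality has to be completed into such a family. *)
Lemma orthonormal_extend n (P : {poly C}) : size P = n.+1 -> 0 < lead_coef P ->
  ip P P = 1 -> (forall q : {poly C}, (size q <= n)%N -> ip P q = 0) ->
  exists phi : nat -> {poly C}, [/\ phi n = P,
    forall m, size (phi m) = m.+1 /\ 0 < lead_coef (phi m) &
    forall m k, ip (phi m) (phi k) = (m == k)%:R].
Proof.
move=> sP lP PP Pq; have [phi hphi] := orthonormal_family.
pose psi m := if m == n then P else phi m.
have hpsi m : [/\ size (psi m) = m.+1, 0 < lead_coef (psi m), ip (psi m) (psi m) = 1 &
      forall q : {poly C}, (size q <= m)%N -> ip (psi m) q = 0].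
  by rewrite /psi; case: eqP => [->|_].
exists psi; split; first by rewrite /psi eqxx.
  by move=> m; have [? ? _ _] := hpsi m.
move=> m k; case: (ltngtP m k) => [mk|km|->] /=.
- rewrite ipJ; have [_ _ _ ->] := hpsi k; first by rewrite conjc0.
  by have [-> _ _ _] := hpsi m.
- have [_ _ _ ->] := hpsi m => //.
  by have [-> _ _ _] := hpsi k.
- by have [_ _ -> _] := hpsi k.
Qed.

End GramSchmidt.

(** * Measures with a density *)

Section DensityMeasure.
Variable R : realType.
Notation leb := (@lebesgue_measure R).
Variable D : R -> R.
Hypothesis D_ge0 : forall t, 0 <= D t.
Hypothesis mD : measurable_fun [set: R] D.
Hypothesis D1 : (\int[leb]_(t in setT) (D t)%:E = 1)%E.

Let dm (A : set (measurableTypeR R)) : \bar R := (\int[leb]_(t in A) (D t)%:E)%E.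

Let dm0 : dm set0 = 0%E. Proof. by rewrite /dm integral_set0. Qed.

Let dm_ge0 A : (0 <= dm A)%E.
Proof. by apply: integral_ge0 => t _; rewrite lee_fin. Qed.

Let dm_sigma_additive : semi_sigma_additive dm.
Proof.
move=> /= F mF tF mUF; rewrite /dm; apply: cvg_toP.
  apply: ereal_nondecreasing_is_cvgn => i j ij.
  by apply: lee_sum_nneg_natr => // k _ _; apply: integral_ge0 => /= x _; rewrite lee_fin.
rewrite ge0_integral_bigcup//=.
  by apply: measurable_funTS; exact/measurable_EFinP.
by move=> x _; rewrite lee_fin.
Qed.

HB.instance Definition _ := isMeasure.Build _ _ _ dm dm0 dm_ge0 dm_sigma_additive.

Let dmT : dm setT = 1%E. Proof. exact: D1. Qed.

HB.instance Definition _ := @Measure_isProbability.Build _ _ R dm dmT.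

Lemma density_probability : exists sigma : probability (measurableTypeR R) R,
  forall A, sigma A = (\int[leb]_(t in A) (D t)%:E)%E.
Proof. by exists dm. Qed.

End DensityMeasure.

Section CircleMeasures.
Variable R : realType.
Notation C := R[i].
Notation Re := complex.Re.
Notation Im := complex.Im.
Notation leb := (@lebesgue_measure R).
Implicit Types f g : R -> R.

Lemma continuous_measurable f : continuous f ->
  measurable_fun [set: R] f.
Proof. by move=> cf; exact: measurable_realfun.continuous_measurable_fun. Qed.

Lemma continuous_bounded_circle f : continuous f ->
  exists M, forall t, circle t -> `|f t| <= M.
Proof.
move=> cf.
have cn : continuous (fun t => `|f t|).
  by move=> x; apply: cvg_norm; exact: cf.
have pp : - pi <= pi :> R by have := @pi_gt0 R; lra.
have [c _ cM] := EVT_max pp (continuous_subspaceT cn).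
exists `|f c| => t; rewrite /circle /= in_itv /= => /andP[t1 t2].
by apply: cM; rewrite in_itv /= (ltW t1).
Qed.

Lemma bounded_integrable_circle (sigma : probability (measurableTypeR R) R) f :
  measurable_fun [set: R] f ->
  (exists M, forall t, circle t -> `|f t| <= M) ->
  sigma.-integrable circle (EFin \o f).
Proof.
move=> mf [M hM]; apply: measurable_bounded_integrable.
- exact: measurable_circle.
- by rewrite (le_lt_trans (probability_le1 _ _))// ?ltry//; exact: measurable_circle.
- exact: measurable_funTS.
- exists M; split; first exact: num_real.
  by move=> y My t /= ct; exact: le_trans (hM _ ct) (ltW My).
Qed.

Lemma continuous_integrable_prob (sigma : probability (measurableTypeR R) R) f :
  continuous f -> sigma.-integrable circle (EFin \o f).
Proof.
move=> cf; apply: bounded_integrable_circle; first exact: continuous_measurable.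
exact: continuous_bounded_circle.
Qed.

(** The singular part is nonnegative and the density is at least
    [delta / (2 pi)], so the measure dominates a multiple of the Lebesgue
    measure on the circle. *)
Lemma steklov_ge (delta : R) (sigma : probability (measurableTypeR R) R) g :
  0 < delta -> steklov delta sigma -> continuous g -> (forall t, 0 <= g t) ->
  ((delta * mean g)%:E <= \int[sigma]_(t in circle) (g t)%:E)%E.
Proof.
move=> d0 [_ [f [[mf f0 [sigma_s [_ sE]]] fge]]] cg g0.
have k0 : 0 <= delta / (2 * pi) by apply: divr_ge0; apply: ltW => //; exact: pi2_gt0.
pose k : {nonneg R} := NngNum k0.
have mC : measurable (circle : set (measurableTypeR R)) := @measurable_circle R.
pose lam : {measure set (measurableTypeR R) -> \bar R} := leb.
pose nu : {measure set (measurableTypeR R) -> \bar R} := mscale k (mrestr lam mC).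
have nu_le S : measurable S -> (nu S <= sigma S)%E.
  move=> mS; rewrite sE//.
  have mSC : measurable (S `&` circle) by exact: measurableI.
  apply: le_trans (_ : (\int[leb]_(t in S) (f t)%:E <= _)%E); last first.
    by rewrite leeDl.
  apply: le_trans (_ : (\int[leb]_(t in S `&` circle) (f t)%:E <= _)%E); last first.
    apply: ge0_subset_integral => //.
      by apply/measurable_EFinP; exact: measurable_funTS.
    by move=> t _; rewrite lee_fin.
  have -> : nu S = (\int[leb]_(t in S `&` circle) (delta / (2 * pi))%:E)%E.
    by rewrite integral_cst//.
  apply: ae_ge0_le_integral => //.
  - by move=> t _; rewrite lee_fin.
  - by apply/measurable_EFinP; exact: measurable_funTS.
  - apply: (@filterS _ _ (ae_filter_ringOfSetsType _) _ _ _ fge) => t h [_ ct]; by rewrite lee_fin; exact: h.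
have mg : measurable_fun [set: R] (EFin \o g).
  by apply/measurable_EFinP; exact: continuous_measurable.
apply: le_trans (ge0_le_measure_integral nu_le mC _ mg); last first.
  by move=> t; rewrite lee_fin.
rewrite (eq_measure_integral (mscale k lam)); last first.
  move=> A mA AC; change ((k%:num)%:E * lam (A `&` circle) = (k%:num)%:E * lam A)%E.
  by rewrite setIidl.
rewrite ge0_integral_mscale//; last 2 first.
- exact: measurable_funTS.
- by move=> t _; rewrite lee_fin.
have ig := continuous_integrable_circle cg.
have -> : (\int[leb]_(t in circle) (g t)%:E)%E = (\int[leb]_(t in circle) g t)%:E.
  rewrite /Rintegral fineK//; exact: integrable_fin_num ig.
rewrite -EFinM lee_fin /mean (_ : k%:num = delta / (2 * pi))//.
by rewrite le_eqVlt; apply/orP; left; apply/eqP; ring.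
Qed.

(** The change of density in integrals is obtained from the Radon-Nikodym
    theorem, the derivative being almost everywhere the given density. *)
Lemma exists_density (w : R -> R) (delta : R) : continuous w ->
  (forall t, 0 <= w t) -> mean w = 1 -> (forall t, delta <= w t) ->
  exists sigma : probability (measurableTypeR R) R, steklov delta sigma /\
    forall f, continuous f -> \int[sigma]_(t in circle) f t = mean (fun t => f t * w t).
Proof.
move=> cw w0 mw wd.
have p2 := @pi2_gt0 R.
pose D (t : R) : R := w t / (2 * pi) * \1_circle t.
have D0 t : 0 <= D t by rewrite /D !mulr_ge0// invr_ge0 ltW.
have mD : measurable_fun [set: R] D.
  apply: measurable_funM.
    apply: continuous_measurable; apply: contM => //; exact: contC.
  by apply: measurable_indic; exact: measurable_circle.
have mED : measurable_fun [set: R] (EFin \o D) by exact/measurable_EFinP.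
have iw : leb.-integrable circle (EFin \o (fun t => w t / (2 * pi))).
  by apply: continuous_integrable_circle; apply: contM => //; exact: contC.
have mcirc : (\int[leb]_(t in circle) (D t)%:E = 1)%E.
  transitivity (\int[leb]_(t in circle) (w t / (2 * pi))%:E)%E.
    by apply: eq_integral => t tc; rewrite /D indicE tc mulr1.
  have fi : (\int[leb]_(t in circle) (w t / (2 * pi))%:E)%E \is a fin_num.
    by apply: (integrable_fin_num _ iw); exact: measurable_circle.
  rewrite -(fineK fi); congr EFin; rewrite -[RHS]mw /mean -RintegralZr//.
    exact: measurable_circle.
  exact: continuous_integrable_circle.
have mT : (\int[leb]_(t in setT) (D t)%:E = 1)%E.
  rewrite -[RHS]mcirc [RHS]integral_mkcond; apply: eq_integral => t _.
  by rewrite patchE /D; case: ifPn => // /negbTE; rewrite indicE => ->; rewrite mulr0.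
have [sigma sE] := density_probability D0 mD mT.
exists sigma; split.
  split; first by rewrite /on_circle sE.
  exists D; split.
    split => //; exists mzero; split.
      by exists set0; split => //.
    by move=> A mA; rewrite sE /mzero adde0.
  apply/aeW => t ct.
  rewrite /D indicE mem_set// mulr1 ler_pM2r ?invr_gt0//.
move=> f cf.
pose nu := charge_of_finite_measure sigma.
have dom : nu `<< leb.
  apply/null_content_dominatesP => A mA A0; rewrite /nu /= sE.
  by apply: null_set_integral => //; exact: measurable_funTS.
have aeD : ae_eq leb setT (Radon_Nikodym nu leb) (EFin \o D).
  apply: integral_ae_eq => //; first exact: Radon_Nikodym_integrable.
  by move=> E _ mE; rewrite -Radon_Nikodym_integral// /nu /= sE.
have mC := @measurable_circle R.
have mf : measurable_fun (circle : set R) (EFin \o f).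
  by apply: measurable_funTS; apply/measurable_EFinP; exact: continuous_measurable.
have isig := continuous_integrable_prob sigma cf.
rewrite /Rintegral -(Radon_Nikodym_change_of_variables dom mC isig).
have E : (\int[leb]_(t in circle) ((f t)%:E * Radon_Nikodym nu leb t))%E =
    (\int[leb]_(t in circle) (f t * w t / (2 * pi))%:E)%E.
  transitivity (\int[leb]_(t in circle) ((f t)%:E * (D t)%:E))%E.
    apply: ae_eq_integral => //.
    - apply: emeasurable_funM => //.
      by apply: measurable_funTS; apply: measurable_int; exact: Radon_Nikodym_integrable.
    - by apply: emeasurable_funM => //; exact: measurable_funTS.
    - apply: ae_eqe_mul2l.
      by apply: filterS aeD => t h _; exact: h.
  apply: eq_integral => t tc.
  by rewrite /D indicE tc mulr1 -EFinM mulrA.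
rewrite E.
rewrite -/(Rintegral _ _ _) RintegralZr//.
by apply: continuous_integrable_circle; exact: contM.
Qed.

End CircleMeasures.

(** * Bounds for the supremum of the entropy *)

Section EntropyBounds.
Variable R : realType.
Notation C := R[i].
Notation Re := complex.Re.
Notation Im := complex.Im.
Notation leb := (@lebesgue_measure R).

Lemma lnp_ge0 (x : R) : 0 <= lnp x.
Proof. by rewrite /lnp le_max lexx orbT. Qed.

Lemma lnp_le_sqr (r M : R) : 0 <= r -> 1 <= M -> r ^+ 2 <= M -> lnp r <= ln M / 2.
Proof.
move=> r0 M1 rM; have lM := ln_ge0 M1.
rewrite /lnp ge_max divr_ge0// andbT.
move: r0; rewrite le_eqVlt => /predU1P[<-|r0]; first by rewrite ln0// divr_ge0.
rewrite ler_pdivlMr// mulr_natr -lnXn// ler_ln// posrE ?exprn_gt0//.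
exact: lt_le_trans M1.
Qed.

Definition entropy_density (p : {poly C}) t : R := sq p.[expi t] * lnp (nrm p.[expi t]).

Lemma entropyE (sigma : probability (measurableTypeR R) R) (p : {poly C}) :
  entropy sigma p = (\int[sigma]_(t in circle) (entropy_density p t)%:E)%E.
Proof.
by apply: eq_integral => t _; rewrite /entropy_density normE /= sq_nrm.
Qed.

Lemma entropy_density_ge0 p t : 0 <= entropy_density p t.
Proof. by rewrite mulr_ge0 ?sq_ge0 ?lnp_ge0. Qed.

Lemma cont_nrm (F : R -> C) : ccont F -> continuous (fun t => nrm (F t)).
Proof.
move=> cF x; apply: (@continuous_comp _ _ _ (fun t => sq (F t)) Num.sqrt).
  exact: cont_sq.
exact: sqrt_continuous.
Qed.

Lemma measurable_entropy_density p : measurable_fun [set: R] (entropy_density p).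
Proof.
have cp := ccont_horner p.
apply: measurable_funM; first by apply: continuous_measurable; exact: cont_sq.
have mln : measurable_fun [set: R] (fun t => ln (nrm p.[expi t])).
  apply: measurableT_comp; first exact: measurable_ln.
  by apply: continuous_measurable; exact: cont_nrm.
exact: measurable_funrpos mln.
Qed.

Lemma orthonormal_norm1 (sigma : probability (measurableTypeR R) R)
    (phi : nat -> {poly C}) n : orthonormal_polys sigma phi ->
  (\int[sigma]_(t in circle) (sq (phi n).[expi t])%:E = 1)%E.
Proof.
move=> [_ /(_ n n)]; rewrite eqxx => /(congr1 (@complex.Re R)) /= h.
have cs : continuous (fun t => sq (phi n).[expi t]) by apply: cont_sq; exact: ccont_horner.
have ig := continuous_integrable_prob sigma cs.
rewrite -[LHS]fineK; last first.
  by apply: (integrable_fin_num _ ig); exact: measurable_circle.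
congr EFin; rewrite -[RHS]h; apply: eq_Rintegral => t _.
by rewrite -[X in _ = Re X]/((phi n).[expi t] * conjc (phi n).[expi t]) mulJ_sq.
Qed.

(** The bound [|phi_n|^2 <= (n+1)/delta] applies to the logarithm, and the other
    factor has integral 1. *)
Lemma entropy_le (delta : R) (sigma : probability (measurableTypeR R) R)
    (phi : nat -> {poly C}) n : 0 < delta < 1 -> steklov delta sigma ->
  orthonormal_polys sigma phi ->
  (entropy sigma (phi n) <= (ln (n.+1%:R / delta) / 2)%:E)%E.
Proof.
move=> /andP[d0 d1] sS ON.
have cs : continuous (fun t => sq (phi n).[expi t]) by apply: cont_sq; exact: ccont_horner.
have n1 := orthonormal_norm1 n ON.
have := steklov_ge d0 sS cs (fun t => sq_ge0 _); rewrite n1 lee_fin => hm.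
set M : R := n.+1%:R / delta.
have M1 : 1 <= M.
  rewrite ler_pdivlMr// mul1r (le_trans (ltW d1))//.
  by rewrite -[1]/(1%:R) ler_nat.
have sM t : sq (phi n).[expi t] <= M.
  apply: le_trans (sq_horner_le _ _) _.
  have [-> _] := (proj1 ON) n.
  by rewrite ler_wpM2l// -[delta^-1]mul1r ler_pdivlMr// mulrC.
have K0 : 0 <= ln M / 2 by rewrite divr_ge0// ln_ge0.
rewrite entropyE.
have mC := @measurable_circle R.
apply: le_trans (_ : (\int[sigma]_(t in circle) ((ln M / 2)%:E * (sq (phi n).[expi t])%:E) <= _)%E).
  apply: ge0_le_integral => //.
  - by move=> t _; rewrite lee_fin entropy_density_ge0.
  - apply: measurable_funTS; apply/measurable_EFinP; exact: measurable_entropy_density.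
  - apply: measurable_funTS; apply: emeasurable_funM => //.
    apply/measurable_EFinP; exact: continuous_measurable.
  - move=> t _; rewrite -EFinM lee_fin /entropy_density mulrC ler_wpM2r ?sq_ge0//.
    by rewrite lnp_le_sqr ?nrm_ge0// sq_nrm.
rewrite ge0_integralZl//.
- by rewrite n1 mule1.
- apply: measurable_funTS; apply/measurable_EFinP; exact: continuous_measurable.
- by move=> t _; rewrite lee_fin sq_ge0.
Qed.

Lemma Omega_le (delta : R) n : 0 < delta < 1 ->
  (Omega n (steklov delta) <= (ln (n.+1%:R / delta) / 2)%:E)%E.
Proof.
move=> d01; apply: ge_ereal_sup => x [sigma [phi [sS ON ->]]].
exact: entropy_le.
Qed.

Section Lower.
Variables (delta : R) (n : nat) (w : R -> R) (phi : {poly C}) (v0 b rho : R).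
Hypothesis delta_gt0 : 0 < delta.
Hypothesis cw : continuous w.
Hypothesis b_gt0 : 0 < b.
Hypothesis w_ge : forall t, b^-1 <= w t.
Hypothesis w_mass : mean w <= rho.
Hypothesis b_rho : delta * b * rho <= 1.
Hypothesis v0_gt0 : 0 < v0.
Hypothesis size_phi : size phi = n.+1.
Hypothesis lead_phi : lead_coef phi = v0%:C.
Hypothesis orth_phi : forall k, (k <= n)%N ->
  cmean (fun t => phi.[expi t] * (w t)%:C * (expi t ^+ k)^*) =
  if k == n then v0%:C^-1 else 0.

Let m0 := mean w.
Let w1 t := w t / m0.

Let m0_gt0 : 0 < m0.
Proof.
apply: lt_le_trans (_ : b^-1 <= _); first by rewrite invr_gt0.
by rewrite -[leLHS](@mean_cst R); apply: mean_le => //; exact: contC.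
Qed.

Let cw1 : continuous w1.
Proof. by apply: contM => //; exact: contC. Qed.

Let w_gt0 t : 0 < w t.
Proof. by apply: lt_le_trans (w_ge t); rewrite invr_gt0. Qed.

Let w1_gt0 t : 0 < w1 t. Proof. by rewrite divr_gt0. Qed.

Let w1_ge t : delta <= w1 t.
Proof.
rewrite ler_pdivlMr//; apply: le_trans (w_ge t).
rewrite -[b^-1]mul1r ler_pdivlMr// mulrAC; apply: le_trans b_rho.
by rewrite ler_wpM2l// mulr_ge0// ltW.
Qed.

Let mean_w1 : mean w1 = 1.
Proof.
rewrite (@eq_mean _ _ (fun t => m0^-1 * w t)); last by move=> t; rewrite mulrC.
by rewrite meanZ// mulVf// gt_eqF.
Qed.

Let ip (p q : {poly C}) : C := cmean (fun t => p.[expi t] * (q.[expi t])^* * (w1 t)%:C).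

Let cip (p q : {poly C}) : ccont (fun t => p.[expi t] * (q.[expi t])^* * (w1 t)%:C).
Proof.
apply: ccontM; last exact: ccontR.
by apply: ccontM; [exact: ccont_horner | apply: ccontJ; exact: ccont_horner].
Qed.

Let ipD p q r : ip (p + q) r = ip p r + ip q r.
Proof.
by rewrite /ip -cmeanD//; apply: eq_cmean => t; rewrite hornerD !mulrDl.
Qed.

Let ipZ c p r : ip (c *: p) r = c * ip p r.
Proof.
by rewrite /ip -cmeanZ//; apply: eq_cmean => t; rewrite hornerZ !mulrA.
Qed.

Let ipJ p q : ip q p = (ip p q)^*.
Proof.
rewrite /ip -cmeanJ//; apply: eq_cmean => t.
by rewrite !conjcM conjc_real conjcK [(_^*) * _]mulrC.
Qed.

Let ip_gt0 p : p != 0 -> 0 < ip p p.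
Proof.
move=> p0; have E : ip p p = (mean (fun t => sq p.[expi t] * w1 t))%:C.
  apply: complex_ext => /=.
    by apply: eq_mean => t; rewrite mulJ_sq -rmorphM.
  by rewrite -[RHS](@mean_cst R); apply: eq_mean => t; rewrite mulJ_sq -rmorphM.
rewrite E ltcR; apply: lt_le_trans (_ : delta * mean (fun t => sq p.[expi t]) <= _).
  by rewrite mulr_gt0// mean_sq_gt0.
have cs : continuous (fun t => sq p.[expi t]) by apply: cont_sq; exact: ccont_horner.
rewrite -meanZ//; apply: mean_le.
- by apply: contM => //; exact: contC.
- exact: contM.
- by move=> t; rewrite mulrC ler_wpM2l// sq_ge0.
Qed.

Let P : {poly C} := (Num.sqrt m0)%:C *: phi.

Let sm0 : 0 < Num.sqrt m0. Proof. by rewrite sqrtr_gt0. Qed.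

Let ip_phi (q : {poly C}) : (size q <= n.+1)%N -> ip phi q = (q`_n)^* / v0%:C / m0%:C.
Proof.
move=> sq.
pose F (i : 'I_n.+1) t : C := (m0^-1)%:C * (q`_i)^* * (phi.[expi t] * (w t)%:C * (expi t ^+ i)^*).
have cF0 (i : 'I_n.+1) : ccont (fun t => phi.[expi t] * (w t)%:C * (expi t ^+ i)^*).
  apply: ccontM; last by apply: ccontJ; exact: ccontX.
  by apply: ccontM; [exact: ccont_horner | exact: ccontR].
have cF i : ccont (F i) by apply: ccontM => //; exact: ccont_cst.
rewrite /ip (@eq_cmean _ _ (fun t => \sum_(i <- index_enum 'I_n.+1) F i t)).
  rewrite (proj1 (cmean_sum _ cF)) big_ord_recr /= big1 ?add0r.
    rewrite cmeanZ// orth_phi// eqxx fmorphV; ring.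
  move=> i _; rewrite cmeanZ// orth_phi ?(ltnW (ltn_ord i))//=.
  by rewrite ltn_eqF ?mulr0// ltn_ord.
move=> t; rewrite (horner_coef_wide _ sq) rmorph_sum mulr_sumr mulr_suml; apply: eq_bigr => i _.
by rewrite /F /w1 !rmorphM /=; ring.
Qed.

(** The weight [w] divided by its mean is at least [delta], since its mean is at
    most [rho] and [delta b rho <= 1]; the n-th orthonormal polynomial of the
    resulting measure is [phi] multiplied by the square root of the mean, so any
    continuous minorant [l] of its entropy density bounds the supremum below. *)
Lemma Omega_ge (l : R -> R) : continuous l ->
  (forall t, l t <= entropy_density P t) ->
  ((delta * mean l)%:E <= Omega n (steklov delta))%E.
Proof.
move=> cl lP.
have [sigma [sS sE]] := exists_density cw1 (fun t => ltW (w1_gt0 t)) mean_w1 w1_ge.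
have sP : size P = n.+1.
  by rewrite size_scale// eq_complex /= eqxx andbT gt_eqF.
have lP0 : 0 < lead_coef P.
  by rewrite lead_coefZ lead_phi -rmorphM ltcR mulr_gt0.
have Pn : P`_n = (Num.sqrt m0 * v0)%:C.
  by rewrite -[n]/(n.+1.-1) -sP -lead_coefE lead_coefZ lead_phi -rmorphM.
have v00 : v0 != 0 by rewrite gt_eqF.
have m00 : m0 != 0 by rewrite gt_eqF.
have PP : ip P P = 1.
  rewrite {1}/P ipZ ip_phi ?sP// Pn conjc_real -!fmorphV -!rmorphM.
  rewrite -(rmorph1 (real_complex R)); congr _%:C.
  rewrite -[X in _ / _ / X](sqr_sqrtr (ltW m0_gt0)).
  by field; rewrite v00 gt_eqF.
have Pq (q : {poly C}) : (size q <= n)%N -> ip P q = 0.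
  move=> sq; rewrite ipZ ip_phi ?(leqW sq)// (nth_default 0 sq) conjc0.
  by rewrite !mul0r mulr0.
have [ph [phn phS phO]] := orthonormal_extend ipD ipZ ipJ ip_gt0 sP lP0 PP Pq.
have ON : orthonormal_polys sigma ph.
  split=> [m|m k]; first exact: phS.
  rewrite -phO /circle_cintegral /ip; apply: complex_ext => /=.
    rewrite sE; last by case: (ccontM (ccont_horner (ph m)) (ccontJ (ccont_horner (ph k)))).
    apply: eq_mean => t.
    rewrite -[X in Re X * _]/((ph m).[expi t] * conjc (ph k).[expi t]) [RHS]cReM /=.
    by rewrite mulr0 subr0.
  rewrite sE; last by case: (ccontM (ccont_horner (ph m)) (ccontJ (ccont_horner (ph k)))).
  apply: eq_mean => t.
  rewrite -[X in Im X * _]/((ph m).[expi t] * conjc (ph k).[expi t]) [RHS]cImM /=.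
  by rewrite mulr0 add0r.
apply: le_trans (ereal_sup_ubound _); last first.
  by exists sigma, ph; split; [exact: sS | exact: ON | reflexivity].
rewrite phn entropyE.
(* Domination of measures only controls nonnegative functions: [l] is replaced
   by its positive part. *)
pose g t := (l t + `|l t|) / 2.
have cg : continuous g.
  apply: contM; last exact: contC.
  by apply: contD => // x; apply: cvg_norm; exact: cl.
have g0 t : 0 <= g t.
  by rewrite divr_ge0// -lerBlDl sub0r; have := ler_norm (- l t); rewrite normrN.
have gl t : l t <= g t.
  by rewrite ler_pdivlMr// mulr_natr mulr2n lerD2l ler_norm.
have gP t : g t <= entropy_density P t.
  rewrite /g; have [l0|l0] := leP 0 (l t).
    by rewrite ger0_norm// mulrDl -splitr.
  by rewrite ltr0_norm// subrr mul0r entropy_density_ge0.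
apply: le_trans (_ : (delta * mean g)%:E <= _)%E.
  rewrite lee_fin ler_wpM2l ?(ltW delta_gt0)//; exact: mean_le.
apply: le_trans (steklov_ge delta_gt0 sS cg g0) _.
have mC := @measurable_circle R.
apply: ge0_le_integral => //.
- by move=> t _; rewrite lee_fin.
- apply: measurable_funTS; apply/measurable_EFinP; exact: continuous_measurable.
- apply: measurable_funTS; apply/measurable_EFinP; exact: measurable_entropy_density.
- by move=> t _; rewrite lee_fin.
Qed.

End Lower.
End EntropyBounds.

(** * Entropy of the prescribed polynomial *)

Section FrameEntropy.
Variable R : realType.
Notation C := R[i].
Notation Re := complex.Re.
Notation Im := complex.Im.

(** A minorant that is quadratic in [P], so that its mean can be computed: where
    [|P| <= L] the left-hand side is nonpositive, and elsewhere [ln |P| >= ln L]. *)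
Lemma entropy_density_ge (P tau : {poly C}) (L t : R) : 1 <= L ->
  sq tau.[expi t] <= 1 ->
  ln L * (sq (tau * P).[expi t] - L ^+ 2 * sq tau.[expi t]) <= entropy_density P t.
Proof.
move=> L1 tau1; have lL := ln_ge0 L1; rewrite hornerM sqM.
have L0 : 0 < L by exact: lt_le_trans L1.
have [PL|LP] := leP (nrm P.[expi t]) L.
  apply: le_trans (entropy_density_ge0 _ _).
  rewrite [L ^+ 2 * _]mulrC -mulrBr mulr_ge0_le0// mulr_ge0_le0 ?sq_ge0//.
  by rewrite -sq_nrm subr_le0 lerXn2r ?nnegrE ?nrm_ge0 ?(ltW L0).
rewrite /entropy_density.
apply: le_trans (_ : ln L * sq P.[expi t] <= _); last first.
  rewrite mulrC ler_wpM2l ?sq_ge0// /lnp le_max ler_ln ?posrE ?(ltW LP)//.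
  exact: lt_trans LP.
rewrite ler_wpM2l// lerBlDr.
apply: le_trans (_ : 1 * sq P.[expi t] <= _).
  by rewrite ler_wpM2r ?sq_ge0.
by rewrite mul1r lerDl mulr_ge0 ?sqr_ge0 ?sq_ge0.
Qed.

Section Combine.
Variables (delta : R) (V G : {poly C}) (n d : nat) (v0 v1 g1 b mu : R) (r tau : {poly C}).
Hypothesis delta_gt0 : 0 < delta.
Hypothesis v1_gt0 : 0 < v1.
Hypothesis g1_gt0 : 0 < g1.
Hypothesis V0 : V.[0] = v0%:C.
Hypothesis G0 : G.[0] = 1.
Hypothesis ReV_ge : forall t, v1 <= Re V.[expi t].
Hypothesis ReG_ge : forall t, g1 <= Re G.[expi t].
Let U := V * G.
Hypothesis sizeU : (size U + d <= n)%N.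
Hypothesis sizeV : (size V + d <= n)%N.
Hypothesis b_gt0 : 0 < b.
Hypothesis upper_VG : forall t,
  sq V.[expi t] * (nrm G.[expi t] + `|Im G.[expi t]|) ^+ 2 <= b * Re G.[expi t].
Hypothesis size_r : (size r <= d.+1)%N.
Hypothesis lower_VG : forall t, 1 <= sq V.[expi t] * Re G.[expi t] * Re r.[expi t].
Hypothesis mass : delta * b * Re r.[0] <= 1.
Hypothesis tau_le1 : forall t, sq tau.[expi t] <= 1.
Hypothesis size_tau : (size (tau * (U ^+ 2 - V ^+ 2))%R <= n)%N.
Hypothesis mu_le : mu <= mean (frame_w V G n).

Lemma frame_Omega_ge (L : R) : 1 <= L ->
  ((delta * (ln L * (mu / 2 * mean (fun t => sq tau.[expi t] * (sq U.[expi t] + sq V.[expi t]))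
     - L ^+ 2 * mean (fun t => sq tau.[expi t]))))%:E <= Omega n (steklov delta))%E.
Proof.
move=> L1; have lL := ln_ge0 L1.
have cw : continuous (frame_w V G n) := frame_w_cont v1_gt0 g1_gt0 V0 G0 ReV_ge ReG_ge sizeU sizeV.
have wb t : b^-1 <= frame_w V G n t.
  by apply: (frame_w_ge n v1_gt0 g1_gt0 ReV_ge ReG_ge).
have wm : mean (frame_w V G n) <= Re r.[0].
  exact: (frame_mass v1_gt0 g1_gt0 V0 G0 ReV_ge ReG_ge sizeU sizeV size_r).
have v00 : 0 < v0 := frame_v0_gt0 v1_gt0 V0 ReV_ge.
have [sphi lphi] := frame_size v1_gt0 V0 G0 ReV_ge sizeU sizeV.
have orth := frame_orth v1_gt0 g1_gt0 V0 G0 ReV_ge ReG_ge sizeU sizeV.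
have test := frame_test v1_gt0 g1_gt0 ReV_ge ReG_ge sizeU sizeV size_tau.
set phi := frame_phi V G n in sphi lphi orth test.
have mul := mu_le; set w := frame_w V G n in cw wb wm orth mul *.
have m00 : 0 <= mean w.
  apply: le_trans (_ : b^-1 <= _); first by rewrite invr_ge0 ltW.
  by rewrite -[leLHS](@mean_cst R); apply: mean_le => //; exact: contC.
pose P : {poly C} := (Num.sqrt (mean w))%:C *: phi.
pose l t := ln L * (sq (tau * P).[expi t] - L ^+ 2 * sq tau.[expi t]).
have cs (p : {poly C}) : continuous (fun t => sq p.[expi t]).
  by apply: cont_sq; exact: ccont_horner.
have cZ (c : R) f : continuous f -> continuous (fun t : R => c * (f t : R)).
  by move=> cf; apply: contM => //; exact: contC.
have cd : continuous (fun t => sq (tau * P).[expi t] - L ^+ 2 * sq tau.[expi t]).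
  apply: contD; first exact: cs.
  by apply: contN; apply: (cZ (L ^+ 2)); exact: cs.
have cl : continuous l by apply: (cZ (ln L)).
have h := @Omega_ge R delta n w phi v0 b (Re r.[0]) delta_gt0 cw b_gt0 wb wm mass v00 sphi lphi orth l cl.
apply: le_trans (h _) => [|t]; last exact: entropy_density_ge.
rewrite lee_fin ler_wpM2l ?(ltW delta_gt0)// /l meanZ//.
rewrite ler_wpM2l// meanB//; last by apply: (cZ (L ^+ 2)); exact: cs.
rewrite meanZ// lerD2r.
have -> : mean (fun t => sq (tau * P).[expi t]) = mean w * mean (fun t => sq tau.[expi t] * sq phi.[expi t]).
  rewrite -meanZ; last by apply: contM; exact: cs.
  apply: eq_mean => t; rewrite hornerM hornerZ !sqM sqR sqr_sqrtr//; ring.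
rewrite test; set M := mean _.
have M0 : 0 <= M.
  rewrite -[leLHS](@mean_cst R); apply: mean_le.
  - exact: contC.
  - by apply: contM; [exact: cs | apply: contD; exact: cs].
  - by move=> t; apply: mulr_ge0; [|apply: addr_ge0]; exact: sq_ge0.
by rewrite [leRHS]mulrA [leLHS]mulrAC; apply: ler_wpM2r => //; apply: ler_wpM2r.
Qed.

End Combine.
End FrameEntropy.

(** * A positive lower bound in every degree *)

Section SmallDegree.
Variable R : realType.
Notation C := R[i].
Notation Re := complex.Re.
Notation Im := complex.Im.

(** With [G = 1] and [V = 1 - s z] the frame gives the Bernstein-Szego weight
    [1/|1 - s z|^2], for which [|phi_n|] is proportional to [|V|].
    The mean [1 + s^2] of [|V|^2] exceeds the threshold [L^2], whatever the
    degree [n >= 2]. *)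
Lemma Omega_ge_small (delta : R) : 0 < delta < 1 -> exists2 e0 : R, 0 < e0 &
  forall n, (2 <= n)%N -> (e0%:E <= Omega n (steklov delta))%E.
Proof.
move=> /andP[d0 d1].
pose s : R := (1 - delta) / 8.
have s0 : 0 < s by rewrite divr_gt0// subr_gt0.
have s1 : s < 1 / 8 by rewrite /s; lra.
pose L : R := 1 + s ^+ 2 / 8.
have L1 : 1 < L by rewrite ltrDl divr_gt0// exprn_gt0.
have lL : 0 < ln L by rewrite ln_gt0.
pose V : {poly C} := 1 - s%:C *: 'X.
have VE t : V.[expi t] = 1 - s%:C * expi t by rewrite /V !hornerE.
have ReV t : Re V.[expi t] = 1 - s * cos t.
  by rewrite VE cReB cReM /= mul0r subr0.
have sqVE t : sq V.[expi t] = 1 + s ^+ 2 + (- 2 * s) * cos (1%:R * t).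
  rewrite VE /sq cReB cImB cReM cImM /= mul1r !mul0r.
  have := cos2Dsin2 t; move: (cos t) (sin t) => c e ce.
  rewrite (_ : (1 - (s * c - 0)) ^+ 2 + (0 - (s * e + 0)) ^+ 2 = 1 - 2 * s * c + s ^+ 2 * (c ^+ 2 + e ^+ 2)); last by ring.
  by rewrite ce; ring.
have ReV_ge t : 1 - s <= Re V.[expi t].
  by rewrite ReV lerD2l lerN2; have := cos_le1 t; nra.
have V0 : V.[0] = 1%:C by rewrite /V !hornerE oppr0 addr0.
have ReG t : 1 <= Re (1 : {poly C}).[expi t] by rewrite hornerC.
have sV : (size V <= 2)%N.
  rewrite (leq_trans (size_polyD _ _))// geq_max size_poly1 size_polyN.
  by rewrite (leq_trans (size_scale_leq _ _))// size_polyX.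
have G0 : (1 : {poly C}).[0] = 1 by rewrite hornerC.
have v1 : 0 < 1 - s by lra.
exists (delta * (ln L * (s ^+ 2 / 2))).
  by apply: mulr_gt0 => //; apply: mulr_gt0 => //; apply: divr_gt0 => //; apply: exprn_gt0.
move=> n n2.
have sz1 : (size V + 0 <= n)%N by rewrite addn0 (leq_trans sV).
have sz2 : (size (V * 1)%R + 0 <= n)%N by rewrite mulr1.
(* The values of |V| lie between 1 - s and 1 + s, whence the constant majorant
   [r] of 1/|V|^2 and the bound [b] for |V|^2. *)
pose r : {poly C} := ((1 - s) ^- 2)%:C%:P.
pose b : R := (1 + s) ^+ 2.
have b0 : 0 < b by rewrite exprn_gt0//; lra.
have hA t : sq V.[expi t] * (nrm (1 : {poly C}).[expi t] + `|Im (1 : {poly C}).[expi t]|) ^+ 2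
    <= b * Re (1 : {poly C}).[expi t].
  rewrite hornerC /= normr0 addr0 mulr1 sqVE mul1r.
  have -> : nrm (1 : C) = 1 by rewrite (_ : 1 = 1%:C)// nrmR normr1.
  by rewrite expr1n mulr1 /b; have := cos_geN1 t; nra.
have hB t : 1 <= sq V.[expi t] * Re (1 : {poly C}).[expi t] * Re r.[expi t].
  rewrite !hornerC /= mulr1 ler_pdivlMr ?exprn_gt0// mul1r sqVE mul1r.
  by have := cos_le1 t; nra.
have hm : delta * b * Re r.[0] <= 1.
  rewrite hornerC /= /b ler_pdivrMr ?exprn_gt0// mul1r.
  have : delta = 1 - 8 * s by rewrite /s; lra.
  by move=> ->; nra.
have t1 t : sq (1 : {poly C}).[expi t] <= 1.
  by rewrite hornerC /sq /= expr1n expr0n addr0.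
have st : (size (1 * ((V * 1) ^+ 2 - V ^+ 2))%R <= n)%N.
  by rewrite mulr1 subrr mulr0 size_poly0.
have mw : 1 <= mean (frame_w V 1 n).
  have vi : inA (fun t => V.[expi t]^-1) 1%:C^-1.
    by rewrite -V0; exact: inAV (inA_horner V) v1 ReV_ge.
  have ci : continuous (fun t => Re (V.[expi t]^-1)) by case: vi => [[]].
  have mi : mean (fun t => Re (V.[expi t]^-1)) = 1.
    have := inA_mean 0 vi; rewrite eqxx invr1 => /(congr1 (@complex.Re R)) /= <-.
    by apply: eq_mean => t; rewrite expr0 mulr1.
  have cw : continuous (frame_w V 1 n).
    exact: frame_w_cont v1 ltr01 V0 G0 ReV_ge ReG sz2 sz1.
  (* |x|^2 >= 2 Re x - 1, and 1/V has mean 1/V(0). *)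
  apply: le_trans (_ : mean (fun t => 2 * Re (V.[expi t]^-1) - 1) <= _).
    rewrite meanB ?meanZ ?mi ?mean_cst//; [by lra| |exact: contC].
    by apply: contM => //; exact: contC.
  apply: mean_le => //.
    by apply: contD; [apply: contM => //; exact: contC | exact: contC].
  move=> t; have vn0 : V.[expi t] != 0.
    rewrite eq_complex negb_and; apply/orP; left; rewrite /= gt_eqF//.
    exact: lt_le_trans (ReV_ge t).
  have -> : frame_w V 1 n t = sq (V.[expi t]^-1).
    rewrite sqV /frame_w /frame_y mulr1 subrr mul0r addr0 hornerC.
    by rewrite /sq /= !expr1n !expr0n !addr0 !mulr1 mul1r.
  rewrite /sq; move: (Re _) (Im _) => x y.
  by have := sqr_ge0 (x - 1); have := sqr_ge0 y; nra.
have := @frame_Omega_ge R delta V 1 n 0 1 (1 - s) 1 b 1 r 1 d0 v1 ltr01 V0 G0 ReV_ge ReG sz2 sz1 b0 hA.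
move=> /(_ (size_polyC_leq1 _) hB hm t1 st mw L (ltW L1)).
apply: le_trans; rewrite lee_fin ler_wpM2l ?(ltW d0)// ler_wpM2l ?(ltW lL)//.
have c1 : continuous (fun t : R => cos (1%:R * t)).
  move=> x; apply: (@continuous_comp _ _ _ (fun t : R => 1%:R * t) (@cos R)).
    by apply: contM; [exact: contC | move=> y; exact: cvg_id].
  exact: continuous_cos.
have mV : mean (fun t => sq V.[expi t]) = 1 + s ^+ 2.
  rewrite (eq_mean sqVE) meanD ?mean_cst ?meanZ ?mean_cosM ?mulr0 ?addr0//.
    exact: contC.
  by apply: contM => //; exact: contC.
have s11 t : sq (1 : {poly C}).[expi t] = 1.
  by rewrite hornerC /sq /= expr1n expr0n addr0.
rewrite (eq_mean s11) mean_cst (@eq_mean _ _ (fun t => 2 * sq V.[expi t])); last first.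
  by move=> t; rewrite s11 mulr1; ring.
rewrite meanZ; last by apply: cont_sq; exact: ccont_horner.
rewrite mV /L; have : s ^+ 2 <= 1 by rewrite expr_le1 ?(ltW s0)//; lra.
have := sqr_ge0 s; move: (s ^+ 2) => q q0 q1; nra.
Qed.

End SmallDegree.

(** * A kernel of width 1/N *)

Section Kernel.
Variable R : realType.
Notation C := R[i].
Notation Re := complex.Re.
Notation Im := complex.Im.

Definition chord (t : R) : R := nrm (1 - expi t).

Lemma chord_ge0 t : 0 <= chord t. Proof. exact: nrm_ge0. Qed.

Lemma chord2 t : chord t ^+ 2 = 2 - 2 * cos t.
Proof.
rewrite sq_nrm /sq cReB cImB /=; have := cos2Dsin2 t.
by move: (cos t) (sin t) => c s cs; nra.
Qed.

Lemma chord_le2 t : chord t <= 2.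
Proof.
rewrite -(@ler_pXn2r _ 2) ?nnegrE ?chord_ge0// chord2.
by have := cos_geN1 t; nra.
Qed.

Section Fixed.
Variables N K : nat.
Hypothesis N2 : (2 <= N)%N.
Let n : R := N%:R.
Let r : R := 1 - n^-1.
Let xi : R := r ^+ K.
Hypothesis xi_small : xi * (1 + 2 * n) <= 1 / 2.

(** The partial sum of order [K] of the expansion of [(1/N) / (1 - (1 - 1/N) z)],
    which is about [1 / (1 + N (1 - z))]: its real part is of order
    [1 / (1 + p^2)] and its modulus at most of order [1 / p], with
    [p = N |1 - z|].  The truncation costs a multiple of [xi = (1 - 1/N)^K]. *)
Definition kernel : {poly C} := \poly_(i < K) ((1 - N%:R^-1) ^+ i / N%:R : R)%:C.

Let n2 : 2 <= n. Proof. by rewrite /n ler_nat. Qed.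
Let n0 : 0 < n. Proof. by have := n2; lra. Qed.
Let nV : n * n^-1 = 1. Proof. by rewrite mulfV// gt_eqF. Qed.
Let iv : 0 < n^-1 <= 1 / 2.
Proof.
rewrite invr_gt0 n0 /= -(@ler_pM2l _ n)// nV.
by have := n2; lra.
Qed.
Let r12 : 1 / 2 <= r < 1. Proof. by rewrite /r; have := iv; lra. Qed.
Let nr : n * r = n - 1. Proof. by rewrite /r mulrBr nV mulr1. Qed.
Let xi0 : 0 < xi. Proof. by apply: exprn_gt0; have := r12; lra. Qed.
Let xi1 : xi <= 1 / 10. Proof. by have := n2; have := xi_small; have := xi0; nra. Qed.

Lemma kernel0 : (0 < K)%N -> kernel.[0] = (N%:R^-1)%:C.
Proof. by move=> K0; rewrite horner_coef0 coef_poly K0 expr0 mul1r. Qed.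

Lemma size_kernel : (size kernel <= K)%N. Proof. exact: size_poly. Qed.

Let e t : C := (r%:C * expi t) ^+ K.
Let D t : C := n%:C * (1 - r%:C * expi t).

Let nrm_e t : nrm (e t) = xi.
Proof.
apply: (@complexI R); rewrite -normE /e normrX normrM expi_norm1 mulr1 normE nrmR.
by rewrite ger0_norm ?rmorphXn//; have := r12; lra.
Qed.

Let sqD t : sq (D t) = 1 + (n * r) * (n * chord t ^+ 2).
Proof.
rewrite /D sqM sqR chord2 /sq cReB cImB cReM cImM /=.
have -> : (1 - (r * cos t - 0 * sin t)) ^+ 2 + (0 - (r * sin t + 0 * cos t)) ^+ 2
  = 1 - 2 * r * cos t + r ^+ 2 * (cos t ^+ 2 + sin t ^+ 2) by ring.
rewrite cos2Dsin2 mulr1 nr.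
have h : n * r = n - 1 := nr.
transitivity (n ^+ 2 - 2 * (n * (n * r)) * cos t + (n * r) ^+ 2); first by ring.
by rewrite h; ring.
Qed.

Let p t := n * chord t.
Let S t := nrm (D t).

Let S2 t : S t ^+ 2 = 1 + (n * r) * (n * chord t ^+ 2).
Proof. by rewrite /S sq_nrm sqD. Qed.

Let p0 t : 0 <= p t. Proof. by rewrite mulr_ge0 ?chord_ge0// ltW. Qed.
Let S0 t : 0 <= S t. Proof. exact: nrm_ge0. Qed.

Let S2_ge t : 1 + p t ^+ 2 / 2 <= S t ^+ 2.
Proof.
rewrite S2 /p; have := chord_ge0 t; have := n0; have := r12; move: (chord t) => c.
rewrite (_ : n * r * (n * c ^+ 2) = r * (n * c) ^+ 2); last by ring.
by move=> h1 _ _; have := sqr_ge0 (n * c); nra.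
Qed.

Let S2_le t : S t ^+ 2 <= 1 + p t ^+ 2.
Proof.
rewrite S2 /p; have := chord_ge0 t; have := n0; have := r12; move: (chord t) => c.
rewrite (_ : n * r * (n * c ^+ 2) = r * (n * c) ^+ 2); last by ring.
by move=> h1 _ _; have := sqr_ge0 (n * c); nra.
Qed.

Let S_ge1 t : 1 <= S t.
Proof. by have := S2_ge t; have := S0 t; have := sqr_ge0 (p t); nra. Qed.

Let S_gep t : 7 / 10 * p t <= S t.
Proof. by have := S2_ge t; have := S0 t; have := p0 t; nra. Qed.

Let S_le t : S t <= 1 + 2 * n.
Proof.
have h := chord_le2 t; have := S2_le t; have := S0 t; have := p0 t.
have hp : p t <= 2 * n by rewrite /p mulrC ler_wpM2r// ltW.
have := n0; nra.
Qed.

Let xiS t : xi * S t <= 1 / 2.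
Proof. by apply: le_trans xi_small; rewrite ler_wpM2l ?S_le// ltW. Qed.

Let D_neq0 t : D t != 0.
Proof. by rewrite -sq_eq0 -sq_nrm gt_eqF// exprn_gt0//; exact: lt_le_trans (S_ge1 t). Qed.

Let kernelE t : kernel.[expi t] = (1 - e t) / D t.
Proof.
apply: (canRL (mulfK (D_neq0 t))).
have -> : 1 - e t = (1 - r%:C * expi t) * \sum_(i < K) (r%:C * expi t) ^+ i.
  by rewrite -[LHS]opprB /e subrX1 -mulNr opprB.
rewrite /kernel horner_poly /D mulrA [RHS]mulrC; congr (_ * _).
rewrite mulr_suml; apply: eq_bigr => i _.
rewrite exprMn -/n -/r mulrAC -rmorphM -rmorphXn; congr (_%:C * _).
by rewrite divfK// gt_eqF.
Qed.

Let nrm_div (x y : C) : nrm (x / y) = nrm x / nrm y.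
Proof. by rewrite nrmM /nrm sqV sqrtrV ?sq_ge0. Qed.

Lemma kernel_nrm_le t : nrm kernel.[expi t] <= 3 / 2.
Proof.
rewrite kernelE nrm_div -/(S t) ler_pdivrMr; last exact: lt_le_trans (S_ge1 t).
apply: le_trans (_ : 1 + xi <= _).
  apply: le_trans (nrmD _ _) _; rewrite nrmN nrm_e.
  by rewrite (_ : (1 : C) = 1%:C)// nrmR normr1.
by have := S_ge1 t; have := xi1; lra.
Qed.

Lemma kernel_nrm_decay t : N%:R * chord t * nrm kernel.[expi t] <= 3.
Proof.
have Sp : 0 < S t by exact: lt_le_trans (S_ge1 t).
rewrite kernelE nrm_div -/(S t) mulrA ler_pdivrMr// -/n -/(p t).
have h : nrm (1 - e t) <= 1 + xi.
  apply: le_trans (nrmD _ _) _; rewrite nrmN nrm_e.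
  by rewrite (_ : (1 : C) = 1%:C)// nrmR normr1.
apply: le_trans (_ : p t * (1 + xi) <= _); first by rewrite ler_wpM2l.
by have := S_gep t; have := p0 t; have := xi1; nra.
Qed.

Let Re_D t : Re (D t)^* = 1 + (n - 1) * chord t ^+ 2 / 2.
Proof.
rewrite chord2 cReJ /D cReM cReB cImB cReM cImM /= -nr.
transitivity (n - n * r * cos t); first by ring.
by rewrite nr; field.
Qed.

Let Re_eD t : `|Re (e t * (D t)^*)| <= xi * S t.
Proof.
apply: le_trans (_ : nrm (e t * (D t)^*) <= _).
  by rewrite -lecR -normE; exact: normc_ge_Re.
by rewrite nrmM nrm_e [nrm (_^*)]/nrm sqJ.
Qed.

(** The denominator is at most [2 N + 1] in modulus, so the smallness of [xi]
    keeps the truncation below half of the main term. *)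
Lemma kernel_Re_ge t : 1 / (2 * (1 + (N%:R * chord t) ^+ 2)) <= Re kernel.[expi t].
Proof.
rewrite kernelE Re_div -sq_nrm -/(S t) -/n -/(p t).
have Sp : 0 < S t ^+ 2 by rewrite exprn_gt0//; exact: lt_le_trans (S_ge1 t).
have q0 : 0 < 1 + p t ^+ 2 by rewrite ltr_wpDr// sqr_ge0.
rewrite mulrBl [1 * (D t)^*]mul1r cReB Re_D.
have := Re_eD t; have := xiS t; rewrite ler_norml => h1 /andP[_ h2].
have h3 : 1 / 2 <= 1 + (n - 1) * chord t ^+ 2 / 2 - Re (e t * (D t)^*).
  have h4 : 0 <= (n - 1) * chord t ^+ 2 by rewrite mulr_ge0 ?sqr_ge0//; have := n2; lra.
  by lra.
rewrite ler_pdivlMr// mulrC mulrA mulr1 ler_pdivrMr ?mulr_gt0//.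
apply: le_trans (S2_le t) _.
by rewrite mulrA ler_peMl// ?(ltW q0)//; lra.
Qed.

Let oneBk t : 1 - kernel.[expi t] = ((n - 1)%:C * (1 - expi t) + e t) / D t.
Proof.
rewrite kernelE; apply: (mulIf (D_neq0 t)); rewrite mulrBl mul1r !divfK ?D_neq0//.
have ab : n%:C * r%:C = n%:C - 1 :> C by rewrite -rmorphM nr rmorphB.
have nB : (n - 1)%:C = n%:C - 1 :> C by rewrite rmorphB.
rewrite nB /D.
move: (n%:C) (r%:C) (expi t) (e t) ab => a b' x y ab.
transitivity (a - (a * b') * x - 1 + y); first by ring.
by rewrite ab; ring.
Qed.

Let chordnr t : (n - 1) * chord t <= S t.
Proof.
have := S2 t; have := S0 t; rewrite nr; have := chord_ge0 t; have := n2.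
by move: (chord t) (S t) => c s; nra.
Qed.

Lemma nrm_1B_kernel t : nrm (1 - kernel.[expi t]) <= 1 + (1 - N%:R^-1) ^+ K.
Proof.
rewrite oneBk nrm_div -/(S t) -/n -/r -/xi.
have Sp : 0 < S t by exact: lt_le_trans (S_ge1 t).
rewrite ler_pdivrMr//.
apply: le_trans (nrmD _ _) _; rewrite nrmM nrm_e nrmR -/(chord t) ger0_norm; last first.
  by have := n2; lra.
by have := chordnr t; have := S_ge1 t; have := xi0; nra.
Qed.

Lemma nrm_1B_kernel_small t :
  nrm (1 - kernel.[expi t]) <= N%:R * chord t + (1 - N%:R^-1) ^+ K.
Proof.
rewrite oneBk nrm_div -/(S t) -/n -/r -/xi.
have Sp : 0 < S t by exact: lt_le_trans (S_ge1 t).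
rewrite ler_pdivrMr//.
apply: le_trans (nrmD _ _) _; rewrite nrmM nrm_e nrmR -/(chord t) ger0_norm; last first.
  by have := n2; lra.
have := chord_ge0 t; have := S_ge1 t; have := xi0; have := n2.
move: (chord t) (S t) => c s h1 h2 h3 h4.
apply: le_trans (_ : n * c + xi <= _); first by rewrite lerD2r; nra.
by rewrite ler_peMr// addr_ge0 ?mulr_ge0// ltW.
Qed.

Lemma Re_1B_kernel t : 3 / 8 * ((N%:R * chord t) ^+ 2 / (1 + (N%:R * chord t) ^+ 2))
    - (1 - N%:R^-1) ^+ K <= Re (1 - kernel.[expi t]).
Proof.
rewrite oneBk Re_div -sq_nrm -/(S t) -/n -/r -/xi -/(p t).
have Sp : 0 < S t ^+ 2 by rewrite exprn_gt0//; exact: lt_le_trans (S_ge1 t).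
have q0 : 0 < 1 + p t ^+ 2 by rewrite ltr_wpDr// sqr_ge0.
have h1 : Re ((n - 1)%:C * (1 - expi t) * (D t)^*) = r * (1 + r) / 2 * p t ^+ 2.
  rewrite -nr /p /D !cReM !cImM !cReJ !cImJ !cReM !cImM !cReB !cImB !cReM !cImM /=.
  rewrite exprMn chord2; have := cos2Dsin2 t; move: (cos t) (sin t) => c s cs.
  have cs' : s ^+ 2 = 1 - c ^+ 2 by lra.
  transitivity (n ^+ 2 * (r * (1 - c - r * c + r * c ^+ 2 + r * s ^+ 2))); first by ring.
  by rewrite cs'; field.
rewrite [(_ + e t) * _]mulrDl cReD h1 ler_pdivlMr//.
have h2 := Re_eD t; move: h2; rewrite ler_norml => /andP[h2 _].
have h3 : 3 / 8 * (p t ^+ 2 / (1 + p t ^+ 2)) * S t ^+ 2 <= 3 / 8 * p t ^+ 2.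
  rewrite -mulrA; apply: ler_wpM2l; first by lra.
  by rewrite mulrAC ler_pdivrMr// ler_wpM2l ?sqr_ge0//; exact: S2_le.
have h4 : 3 / 8 * p t ^+ 2 <= r * (1 + r) / 2 * p t ^+ 2.
  by apply: ler_wpM2r; [exact: sqr_ge0 | have := r12; nra].
have h5 : xi * S t <= xi * S t ^+ 2.
  by rewrite ler_wpM2l ?(ltW xi0)// expr2 ler_peMr.
by rewrite mulrBl; move: h2 h3 h4 h5; lra.
Qed.

End Fixed.
End Kernel.

(** * The bump and the damper *)

Section GeometricSums.
Variable R : realType.

Lemma bernoulli_ineq (a : R) k : 0 <= a -> 1 + k%:R * a <= (1 + a) ^+ k.
Proof.
move=> a0; elim: k => [|k IH]; first by rewrite mul0r addr0 expr0.
rewrite exprS -natr1; apply: le_trans (_ : (1 + a) * (1 + k%:R * a) <= _); last first.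
  by rewrite ler_wpM2l// addr_ge0.
have := ler0n R k; move: (k%:R) => m m0; nra.
Qed.

Lemma sum_expr_le (q : R) m : 1 < q -> \sum_(0 <= j < m) q ^+ j <= q ^+ m / (q - 1).
Proof.
move=> q1; have d0 : 0 < q - 1 by rewrite subr_gt0.
elim: m => [|m IH]; first by rewrite big_nil expr0 divr_ge0// ltW.
rewrite big_nat_recr//=; apply: le_trans (lerD IH (lexx _)) _.
rewrite le_eqVlt; apply/orP; left; apply/eqP; rewrite exprS; field.
by rewrite gt_eqF.
Qed.

Lemma sum_exprV (q : R) m : 1 < q ->
  \sum_(0 <= j < m) q ^- j = q / (q - 1) * (1 - q ^- m).
Proof.
move=> q1; have d0 : 0 < q - 1 by rewrite subr_gt0.
have q0 : 0 < q by lra.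
elim: m => [|m IH]; first by rewrite big_nil expr0 invr1 subrr mulr0.
rewrite big_nat_recr//= IH exprS; field.
by rewrite !gt_eqF// exprn_gt0.
Qed.

Lemma sum_exprV_le (q : R) m : 1 < q -> \sum_(0 <= j < m) q ^- j <= q / (q - 1).
Proof.
move=> q1; have q0 : 0 < q by lra.
rewrite sum_exprV// ler_piMr//; first by rewrite divr_ge0//; lra.
by rewrite gerBl invr_ge0 exprn_ge0// ltW.
Qed.

Lemma sum_exprV_tail (q : R) i m : 1 < q ->
  \sum_(i <= j < m) q ^- j <= q / (q - 1) * q ^- i.
Proof.
move=> q1; have q0 : 0 < q by lra.
have d0 : 0 < q - 1 by rewrite subr_gt0.
have c0 : 0 <= q / (q - 1) * q ^- i.
  by rewrite mulr_ge0 ?divr_ge0 ?invr_ge0 ?exprn_ge0// ltW.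
have [mi|im] := leqP m i; first by rewrite big_geq.
have := sum_exprV m q1; rewrite (big_cat_nat (leq0n i) (ltnW im)) /= sum_exprV// => h.
have -> : \sum_(i <= j < m) q ^- j = q / (q - 1) * (q ^- i - q ^- m).
  by apply: (addrI (q / (q - 1) * (1 - q ^- i))); rewrite h; ring.
rewrite ler_wpM2l ?divr_ge0 ?(ltW q0) ?(ltW d0)//.
by rewrite gerBl invr_ge0 exprn_ge0// ltW.
Qed.

(** The last of the scales [q^-i], [i <= J], that is not smaller than [x]. *)
Lemma scale_index (q x : R) J : 0 <= x <= 1 -> exists2 i, (i <= J)%N &
  q ^+ i * x <= 1 /\ (i = J \/ 1 < q ^+ i.+1 * x).
Proof.
move=> /andP[x0 x1]; elim: J => [|J [i iJ [ix [iE|iS]]]].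
- by exists 0%N => //; rewrite expr0 mul1r; split => //; left.
- have [h|h] := leP (q ^+ J.+1 * x) 1; first by exists J.+1 => //; split => //; left.
  by exists i; [exact: leqW | split => //; right; rewrite iE].
- by exists i; [exact: leqW | split => //; right].
Qed.

End GeometricSums.

Section Construction.
Variable R : realType.
Notation C := R[i].
Notation Re := complex.Re.
Notation Im := complex.Im.
Variables B J : nat.
Hypothesis B2 : (2 <= B)%N.

Definition scale j := (B * 64 ^ j)%N.

(** Large enough for the truncation errors at all the scales up to [J] to be
    below [cut_error]. *)
Definition cutoff := (8 * scale J ^ 2)%N.
Definition level_kernel j : {poly C} := kernel R (scale j) cutoff.
Let k := level_kernel.
Let x t : R := B%:R * chord t.
Let NJ : R := (scale J)%:R.
Definition cut_error : R := (8 * NJ)^-1.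
Let eps := cut_error.
Let xi j : R := (1 - (scale j)%:R^-1) ^+ cutoff.

Let scale2 j : (2 <= scale j)%N.
Proof. by rewrite /scale (leq_trans B2)// leq_pmulr// expn_gt0. Qed.

Let scaleE j : (scale j)%:R = B%:R * 64 ^+ j :> R.
Proof. by rewrite /scale natrM natrX. Qed.

Let scale_chord j t : (scale j)%:R * chord t = 64 ^+ j * x t.
Proof. by rewrite scaleE /x; ring. Qed.

Let x0 t : 0 <= x t. Proof. by rewrite mulr_ge0 ?chord_ge0. Qed.

Let NJ2 : 2 <= NJ. Proof. by rewrite /NJ (ler_nat _ 2). Qed.

Let eps0 : 0 < eps.
Proof. by rewrite invr_gt0 mulr_gt0//; have := NJ2; lra. Qed.

Lemma cut_error_le : eps <= (8 ^+ J)^-1 / 2.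
Proof.
rewrite /eps /cut_error -invfM lef_pV2 ?posrE ?mulr_gt0 ?exprn_gt0//; last first.
  by have := NJ2; lra.
rewrite /NJ scaleE.
have b2 : 2 <= B%:R :> R by rewrite (ler_nat _ 2).
have e8 : (8 : R) ^+ J <= 64 ^+ J by rewrite lerXn2r ?nnegrE//; lra.
have : 0 < (64 : R) ^+ J by rewrite exprn_gt0.
by nra.
Qed.

Let xi_ge0 j : 0 <= xi j.
Proof.
rewrite exprn_ge0// subr_ge0 invf_le1 ?ltr0n ?(leq_trans _ (scale2 j))//.
by rewrite (ler_nat _ 1) ltnW.
Qed.

(** Bernoulli: [(1 - 1/N)^K <= (1 + 1/N)^-K <= N / K]. *)
Let xi_le j : (j <= J)%N -> xi j <= eps.
Proof.
move=> jJ; set n : R := (scale j)%:R.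
have n2 : 2 <= n by rewrite /n (ler_nat _ 2).
have nNJ : n <= NJ by rewrite ler_nat /scale leq_mul2l leq_exp2l ?jJ ?orbT.
have n0 : 0 < n by lra.
have iv : 0 < n^-1 <= 1 / 2.
  rewrite invr_gt0 n0 /= -(@ler_pM2l _ n)// mulfV ?gt_eqF//; lra.
have h := @bernoulli_ineq R n^-1 cutoff (ltW (proj1 (andP iv))).
have big : 8 * NJ <= (1 + n^-1) ^+ cutoff.
  apply: le_trans h; rewrite /cutoff natrM natrX -/NJ.
  apply: le_trans (_ : 8 * NJ ^+ 2 * NJ^-1 <= _).
    by rewrite expr2 mulrA mulfK// gt_eqF//; have := NJ2; lra.
  apply: le_trans (_ : 8 * NJ ^+ 2 * n^-1 <= _); last by rewrite lerDr.
  rewrite ler_wpM2l ?mulr_ge0 ?sqr_ge0// lef_pV2 ?posrE//; have := NJ2; lra.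
have prod : (1 - n^-1) ^+ cutoff * (1 + n^-1) ^+ cutoff <= 1.
  rewrite -exprMn exprn_ile1//.
    by rewrite mulr_ge0//; lra.
  by have := sqr_ge0 n^-1; move: (n^-1) => a; nra.
rewrite /eps /cut_error -[leRHS]mul1r ler_pdivlMr; last by rewrite mulr_gt0//; have := NJ2; lra.
apply: le_trans prod; rewrite ler_wpM2l//; exact: xi_ge0.
Qed.

Let xi_small j : (j <= J)%N -> xi j * (1 + 2 * (scale j)%:R) <= 1 / 2.
Proof.
move=> jJ.
have nNJ : (scale j)%:R <= NJ by rewrite ler_nat /scale leq_mul2l leq_exp2l ?jJ ?orbT.
have n0 : 0 <= (scale j)%:R :> R by [].
apply: le_trans (_ : eps * (1 + 2 * NJ) <= _).
  by apply: ler_pM; [exact: xi_ge0 | lra | exact: xi_le | lra].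
have n2 := NJ2; have n8 : 0 < 8 * NJ by lra.
rewrite /eps /cut_error mulrC ler_pdivrMr//; lra.
Qed.

Let k_Re j t : (j <= J)%N -> 1 / (2 * (1 + (64 ^+ j * x t) ^+ 2)) <= Re (k j).[expi t].
Proof. by move=> jJ; rewrite -scale_chord; exact: kernel_Re_ge (xi_small jJ) t. Qed.

Let k_Re0 j t : (j <= J)%N -> 0 <= Re (k j).[expi t].
Proof.
move=> jJ; apply: le_trans (k_Re t jJ).
by rewrite divr_ge0// mulr_ge0// addr_ge0// sqr_ge0.
Qed.

Let k_nrm j t : (j <= J)%N -> nrm (k j).[expi t] <= 3 / 2.
Proof. by move=> jJ; exact: kernel_nrm_le (xi_small jJ) t. Qed.

Let k_decay j t : (j <= J)%N -> 64 ^+ j * x t * nrm (k j).[expi t] <= 3.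
Proof. by move=> jJ; rewrite -scale_chord; exact: kernel_nrm_decay (xi_small jJ) t. Qed.

Let k1_nrm j t : (j <= J)%N -> nrm (1 - (k j).[expi t]) <= 1 + eps.
Proof.
move=> jJ; apply: le_trans (nrm_1B_kernel cutoff (scale2 j) t) _.
by rewrite lerD2l xi_le.
Qed.

Let k1_small j t : (j <= J)%N -> nrm (1 - (k j).[expi t]) <= 64 ^+ j * x t + eps.
Proof.
move=> jJ; apply: le_trans (nrm_1B_kernel_small cutoff (scale2 j) t) _.
by rewrite scale_chord lerD2l xi_le.
Qed.

Let k1_Re j t : (j <= J)%N ->
  3 / 8 * ((64 ^+ j * x t) ^+ 2 / (1 + (64 ^+ j * x t) ^+ 2)) - eps <= Re (1 - (k j).[expi t]).
Proof.
move=> jJ; apply: le_trans (Re_1B_kernel cutoff (scale2 j) t).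
by rewrite scale_chord lerD2l lerN2 xi_le.
Qed.

(** Real part of order [16^i] at distance [64^-i] from the point 1. *)
Definition bump_tail : {poly C} := \sum_(0 <= j < J.+1) (16 ^+ j)%:C *: k j.

(** The additional peak [64^J k_J] raises the modulus to the order [64^i] at
    distance [64^-i], but the real part mainly within distance [64^-J]. *)
Definition bump : {poly C} := bump_tail + (64 ^+ J)%:C *: k J.

(** The coefficients sum up to about 1, and the terms with [j <= i] are small
    within distance [64^-i] of the point 1, which leaves a modulus of order
    [16^-i]; the constant prevents it from falling below [8^-J]. *)
Definition damper : {poly C} :=
  ((8 ^+ J)^-1)%:C%:P + \sum_(0 <= j < J.+1) (15 / 16 * 16 ^- j)%:C *: (1 - k j).

Let h2 t := bump_tail.[expi t].
Let h t := bump.[expi t].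
Let V t := damper.[expi t].

Let ReZ (a : R) (y : C) : Re (a%:C * y) = a * Re y.
Proof. by rewrite cReM /= mul0r subr0. Qed.

Let nrmZ (a : R) (y : C) : 0 <= a -> nrm (a%:C * y) = a * nrm y.
Proof. by move=> a0; rewrite nrmM nrmR ger0_norm. Qed.

Let Re_sum (I : Type) (r : seq I) (F : I -> C) : Re (\sum_(i <- r) F i) = \sum_(i <- r) Re (F i).
Proof. by elim: r => [|i r IH]; rewrite ?big_nil ?big_cons// cReD IH. Qed.

Let nrm_sum_le (I : Type) (r : seq I) (F : I -> C) :
  nrm (\sum_(i <- r) F i) <= \sum_(i <- r) nrm (F i).
Proof.
elim: r => [|i r IH]; first by rewrite !big_nil /nrm /sq /= expr0n addr0 sqrtr0.
by rewrite !big_cons; apply: le_trans (nrmD _ _) _; rewrite lerD2l.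
Qed.

Let h2E t : h2 t = \sum_(0 <= j < J.+1) (16 ^+ j)%:C * (k j).[expi t].
Proof. by rewrite /h2 horner_sum; apply: eq_bigr => j _; rewrite hornerZ. Qed.

Let hE t : h t = h2 t + (64 ^+ J)%:C * (k J).[expi t].
Proof. by rewrite /h hornerD hornerZ. Qed.

Let VE t : V t = ((8 ^+ J)^-1)%:C +
  \sum_(0 <= j < J.+1) (15 / 16 * 16 ^- j)%:C * (1 - (k j).[expi t]).
Proof.
rewrite /V hornerD hornerC horner_sum; congr (_ + _).
by apply: eq_bigr => j _; rewrite hornerZ hornerD hornerN hornerC.
Qed.

Let m4 : (4 : R) - 1 = 3. Proof. by ring. Qed.
Let m16 : (16 : R) - 1 = 15. Proof. by ring. Qed.
Let e16 j : 0 <= (16 : R) ^+ j. Proof. exact: exprn_ge0. Qed.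
Let b16 j : 0 <= 15 / 16 * (16 : R) ^- j.
Proof. by rewrite mulr_ge0 ?invr_ge0 ?exprn_ge0//; lra. Qed.

Let ReE t : Re (h2 t) = \sum_(0 <= j < J.+1) 16 ^+ j * Re (k j).[expi t].
Proof. by rewrite h2E Re_sum; apply: eq_bigr => j _; rewrite ReZ. Qed.

Lemma bump_tail_Re_ge i t : (i <= J)%N ->
  16 ^+ i / (2 * (1 + (64 ^+ i * x t) ^+ 2)) <= Re (h2 t).
Proof.
move=> iJ; rewrite ReE (bigD1_seq i) ?mem_index_iota ?iota_uniq//=.
rewrite -[leLHS]addr0 lerD//.
  by rewrite -[_ / _]mulr1 -mulrA [_^-1 * 1]mulrC ler_wpM2l// k_Re.
rewrite big_seq_cond sumr_ge0// => j; rewrite mem_index_iota => /andP[/= jJ _].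
by rewrite mulr_ge0// k_Re0.
Qed.

Lemma bump_tail_Re_ge0 t : 0 <= Re (h2 t).
Proof.
rewrite ReE big_seq_cond sumr_ge0// => j; rewrite mem_index_iota => /andP[/= jJ _].
by rewrite mulr_ge0// k_Re0.
Qed.

Lemma bump_Re_ge t :
  Re (h2 t) + 64 ^+ J / (2 * (1 + (64 ^+ J * x t) ^+ 2)) <= Re (h t).
Proof.
rewrite hE cReD ReZ lerD2l.
by rewrite -[_ / _]mulr1 -mulrA [_^-1 * 1]mulrC ler_wpM2l ?exprn_ge0// k_Re.
Qed.

(** At distance [x], [|k_j|] is at most [3 / (64^j x)], and [16^j / 64^j] is
    summable. *)
Lemma bump_nrm_decay t : x t * nrm (h t) <= 7.
Proof.
apply: le_trans (_ : x t * (\sum_(0 <= j < J.+1) 16 ^+ j * nrm (k j).[expi t]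
   + 64 ^+ J * nrm (k J).[expi t]) <= _).
  rewrite ler_wpM2l// hE; apply: le_trans (nrmD _ _) _.
  rewrite nrmZ ?exprn_ge0// lerD2r h2E; apply: le_trans (nrm_sum_le _ _) _.
  by apply: ler_sum => j _; rewrite nrmZ.
rewrite mulrDr mulr_sumr.
apply: le_trans (_ : \sum_(0 <= j < J.+1) 3 * 4 ^- j + 3 <= _).
  apply: lerD; last by rewrite mulrA [x t * _]mulrC k_decay.
  apply: ler_sum_nat => j /andP[_ jJ].
  have := k_decay t (jJ : (j <= J)%N); have -> : (64 : R) ^+ j = 16 ^+ j * 4 ^+ j.
    by rewrite -exprMn -natrM.
  move=> hh; rewrite ler_pdivlMr ?exprn_gt0//; apply: le_trans hh.
  by rewrite le_eqVlt; apply/orP; left; apply/eqP; ring.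
rewrite -mulr_sumr; have := @sum_exprV_le R 4 J.+1 ltac:(lra); rewrite m4; lra.
Qed.

Lemma bump_nrm_le t : nrm (h t) <= 4 * 64 ^+ J.
Proof.
apply: le_trans (_ : \sum_(0 <= j < J.+1) 16 ^+ j * (3 / 2)
   + 64 ^+ J * (3 / 2) <= _).
  rewrite hE; apply: le_trans (nrmD _ _) _.
  rewrite nrmZ ?exprn_ge0//; apply: lerD; last by rewrite ler_wpM2l ?exprn_ge0// k_nrm.
  rewrite h2E; apply: le_trans (nrm_sum_le _ _) _.
  by apply: ler_sum_nat => j /andP[_ jJ]; rewrite nrmZ// ler_wpM2l// k_nrm.
have s16 : \sum_(0 <= j < J.+1) (16 : R) ^+ j <= 16 * 16 ^+ J / 15.
  by have := @sum_expr_le R 16 J.+1 ltac:(lra); rewrite m16 exprS.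
have e64 : (16 : R) ^+ J <= 64 ^+ J by apply: lerXn2r; rewrite ?nnegrE; lra.
have p64 : 0 <= (64 : R) ^+ J by exact: exprn_ge0.
rewrite -mulr_suml; move: s16 e64 p64.
by move: (\sum_(0 <= j < J.+1) _) (16 ^+ J) (64 ^+ J) => s a b; lra.
Qed.

Let sum_b : \sum_(0 <= j < J.+1) (15 / 16 * (16 : R) ^- j) = 1 - 16 ^- J.+1.
Proof. by rewrite -mulr_sumr sum_exprV; [field; rewrite expf_neq0|lra]. Qed.

Let sum_b_le1 : \sum_(0 <= j < J.+1) (15 / 16 * (16 : R) ^- j) <= 1.
Proof. by rewrite sum_b gerBl invr_ge0 exprn_ge0. Qed.

Let nrmV_le t : nrm (V t) <= (8 ^+ J)^-1 +
  \sum_(0 <= j < J.+1) 15 / 16 * 16 ^- j * nrm (1 - (k j).[expi t]).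
Proof.
rewrite VE; apply: le_trans (nrmD _ _) _.
rewrite nrmR ger0_norm ?invr_ge0 ?exprn_ge0// lerD2l.
apply: le_trans (nrm_sum_le _ _) _.
by apply: ler_sum => j _; rewrite nrmZ.
Qed.

Lemma damper_nrm_le t : nrm (V t) <= 1 + 2 * (8 ^+ J)^-1.
Proof.
apply: le_trans (nrmV_le t) _.
apply: le_trans (_ : (8 ^+ J)^-1 + \sum_(0 <= j < J.+1) 15 / 16 * 16 ^- j * (1 + eps) <= _).
  rewrite lerD2l; apply: ler_sum_nat => j /andP[_ jJ].
  by rewrite ler_wpM2l// k1_nrm.
rewrite -mulr_suml; have := cut_error_le; have := eps0; have := sum_b_le1.
have := b16; rewrite -/eps; move: (\sum_(0 <= j < J.+1) _) => s _ s1 e0 e8; nra.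
Qed.

(** For [j <= i] the term [16^-j (1 - k_j)] is of order [16^-j 64^j x], that is
    [4^j x]; these terms sum up to [4^i x <= 16^-i], as do the [16^-j] for
    [j > i]. *)
Lemma damper_nrm_small i t : (i <= J)%N -> 64 ^+ i * x t <= 1 ->
  nrm (V t) <= 2 * (8 ^+ J)^-1 + 2 * 16 ^- i.
Proof.
move=> iJ ix; apply: le_trans (nrmV_le t) _.
pose c j : R := 15 / 16 * 16 ^- j.
apply: le_trans (_ : (8 ^+ J)^-1 + (\sum_(0 <= j < J.+1) c j * eps +
   (\sum_(0 <= j < i.+1) 4 ^+ j * x t + \sum_(i.+1 <= j < J.+1) c j)) <= _).
  rewrite lerD2l.
  rewrite (big_cat_nat (leq0n i.+1)) //= [X in _ <= X + _](big_cat_nat (leq0n i.+1)) //=.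
  rewrite addrACA; apply: lerD.
    rewrite -big_split /=; apply: ler_sum_nat => j /andP[_ ji].
    have jJ : (j <= J)%N by apply: leq_trans iJ.
    apply: le_trans (_ : c j * (64 ^+ j * x t + eps) <= _).
      by rewrite ler_wpM2l ?b16// k1_small.
    rewrite mulrDr [leLHS]addrC lerD2l.
    have -> : (64 : R) ^+ j = 16 ^+ j * 4 ^+ j by rewrite -exprMn -natrM.
    have -> : c j * (16 ^+ j * 4 ^+ j * x t) = 15 / 16 * (4 ^+ j * x t).
      by rewrite /c; field; rewrite expf_neq0.
    have : 0 <= 4 ^+ j * x t by rewrite mulr_ge0// exprn_ge0.
    by lra.
  rewrite -big_split /=; apply: ler_sum_nat => j /andP[_ jJ].
  apply: le_trans (_ : c j * (1 + eps) <= _).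
    by rewrite ler_wpM2l ?b16// k1_nrm.
  by rewrite mulrDr mulr1 addrC.
have s1 : \sum_(0 <= j < J.+1) c j * eps <= eps.
  by rewrite -mulr_suml ler_piMl ?(ltW eps0).
have s2 : \sum_(0 <= j < i.+1) 4 ^+ j * x t <= 4 / 3 * 16 ^- i.
  rewrite -mulr_suml; have := @sum_expr_le R 4 i.+1 ltac:(lra); rewrite m4 => s4.
  apply: le_trans (_ : 4 ^+ i.+1 / 3 * x t <= _); first by rewrite ler_wpM2r.
  have e : (64 : R) ^+ i = 16 ^+ i * 4 ^+ i by rewrite -exprMn -natrM.
  rewrite ler_pdivlMr ?exprn_gt0// exprS; move: ix; rewrite e.
  by move: (16 ^+ i) (4 ^+ i) (x t) => a b y; lra.
have s3 : \sum_(i.+1 <= j < J.+1) c j <= 1 / 16 * 16 ^- i.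
  rewrite /c -mulr_sumr; have := @sum_exprV_tail R 16 i.+1 J.+1 ltac:(lra); rewrite m16.
  rewrite exprS invfM; move: (16 ^- i) (\sum_(_ <= j < _) _) => a s; lra.
have p16 : 0 <= (16 : R) ^- i by rewrite invr_ge0 exprn_ge0.
by have := cut_error_le; rewrite -/eps; have := eps0; lra.
Qed.

Let Re_V t : Re (V t) = (8 ^+ J)^-1 +
  \sum_(0 <= j < J.+1) 15 / 16 * 16 ^- j * Re (1 - (k j).[expi t]).
Proof.
by rewrite VE cReD Re_sum; congr (_ + _); apply: eq_bigr => j _; rewrite ReZ.
Qed.

(** All the terms have an almost nonnegative real part, so the one of index [i]
    can be retained alone; half of the constant term pays for the truncation
    errors. *)
Lemma damper_Re_ge i t : (i <= J)%N ->
  (8 ^+ J)^-1 / 2 + 15 / 16 * 16 ^- i *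
    (3 / 8 * ((64 ^+ i * x t) ^+ 2 / (1 + (64 ^+ i * x t) ^+ 2))) <= Re (V t).
Proof.
move=> iJ; rewrite Re_V.
pose c j : R := 15 / 16 * 16 ^- j.
pose f j : R := 3 / 8 * ((64 ^+ j * x t) ^+ 2 / (1 + (64 ^+ j * x t) ^+ 2)).
have f0 j : 0 <= f j.
  apply: mulr_ge0; first by lra.
  by rewrite divr_ge0 ?addr_ge0 ?sqr_ge0.
apply: le_trans (_ : (8 ^+ J)^-1 + \sum_(0 <= j < J.+1) c j * (f j - eps) <= _); last first.
  rewrite lerD2l; apply: ler_sum_nat => j /andP[_ jJ].
  by rewrite ler_wpM2l ?b16// k1_Re.
have -> : \sum_(0 <= j < J.+1) c j * (f j - eps) =
   \sum_(0 <= j < J.+1) c j * f j - (\sum_(0 <= j < J.+1) c j) * eps.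
  rewrite mulr_suml -sumrB; apply: eq_bigr => j _; ring.
have s1 : (\sum_(0 <= j < J.+1) c j) * eps <= eps by rewrite ler_piMl ?(ltW eps0).
have s2 : c i * f i <= \sum_(0 <= j < J.+1) c j * f j.
  rewrite (bigD1_seq i) ?mem_index_iota ?iota_uniq//= lerDl sumr_ge0// => j _.
  by rewrite mulr_ge0// b16.
have := cut_error_le; rewrite -/eps -/(c i) -/(f i); lra.
Qed.

Lemma damper_nrm_ge t : 0 < x t -> 1 - 3 / x t <= nrm (V t).
Proof.
move=> xt.
pose c j : R := 15 / 16 * 16 ^- j.
have -> : V t = ((8 ^+ J)^-1 + \sum_(0 <= j < J.+1) c j)%:C -
   \sum_(0 <= j < J.+1) (c j)%:C * (k j).[expi t].
  rewrite VE rmorphD rmorph_sum /= -addrA -sumrB; congr (_ + _).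
  by apply: eq_bigr => j _; rewrite mulrBr mulr1.
apply: le_trans (nrmB _ _); apply: lerB.
  rewrite nrmR; apply: le_trans (ler_norm _); rewrite sum_b.
  have : (16 : R) ^- J.+1 <= (8 ^+ J)^-1.
    rewrite lef_pV2 ?posrE ?exprn_gt0// exprS.
    have : (8 : R) ^+ J <= 16 ^+ J by rewrite lerXn2r ?nnegrE//; lra.
    have : 0 < (16 : R) ^+ J by rewrite exprn_gt0.
    lra.
  lra.
apply: le_trans (nrm_sum_le _ _) _.
apply: le_trans (_ : \sum_(0 <= j < J.+1) c j * (3 / x t) <= _).
  apply: ler_sum_nat => j /andP[_ jJ]; rewrite nrmZ ?b16// ler_wpM2l ?b16//.
  rewrite ler_pdivlMr//; apply: le_trans (k_decay t (jJ : (j <= J)%N)).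
  rewrite [leLHS]mulrC ler_wpM2r ?nrm_ge0// ler_peMl// ?(ltW xt)// exprn_ege1//; lra.
by rewrite -mulr_suml ler_piMl// divr_ge0 ?(ltW xt).
Qed.

Let cutoff0 : (0 < cutoff)%N.
Proof. by rewrite muln_gt0 /= expn_gt0 (leq_trans _ (scale2 J)). Qed.

Let k0 j : (k j).[0] = ((scale j)%:R^-1)%:C.
Proof. exact: kernel0. Qed.

Let Bpos : 0 < B%:R :> R. Proof. by rewrite ltr0n (leq_trans _ B2). Qed.

Lemma bump_tail0 : exists2 a : R, bump_tail.[0] = a%:C & 0 <= a <= 2 / B%:R.
Proof.
exists (\sum_(0 <= j < J.+1) 16 ^+ j * (scale j)%:R^-1).
  rewrite horner_sum rmorph_sum; apply: eq_bigr => j _.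
  by rewrite hornerZ k0 -rmorphM.
apply/andP; split; first by apply: sumr_ge0 => j _; rewrite mulr_ge0 ?invr_ge0.
rewrite (eq_bigr (fun j => B%:R^-1 * 4 ^- j)).
  rewrite -mulr_sumr [leRHS]mulrC ler_wpM2l ?invr_ge0//.
  have := @sum_exprV_le R 4 J.+1 ltac:(lra); rewrite m4; lra.
move=> j _; rewrite scaleE (_ : (64 : R) ^+ j = 16 ^+ j * 4 ^+ j); last by rewrite -exprMn -natrM.
by field; rewrite !expf_neq0// gt_eqF.
Qed.

Lemma bump0 : exists2 a : R, bump.[0] = a%:C & 0 <= a <= 3 / B%:R.
Proof.
have [a aE /andP[a0 a2]] := bump_tail0.
exists (a + B%:R^-1).
  rewrite hornerD hornerZ aE k0 rmorphD -rmorphM scaleE; congr (_ + _%:C).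
  by field; rewrite expf_neq0// gt_eqF.
rewrite addr_ge0 ?invr_ge0//=.
by apply: le_trans (lerD a2 (lexx _)) _; rewrite le_eqVlt; apply/orP; left; apply/eqP; ring.
Qed.

Lemma damper0 : exists a : R, damper.[0] = a%:C.
Proof.
exists ((8 ^+ J)^-1 + \sum_(0 <= j < J.+1) 15 / 16 * 16 ^- j * (1 - (scale j)%:R^-1)).
rewrite hornerD hornerC horner_sum rmorphD rmorph_sum; congr (_ + _).
have RM (a b : R) : a%:C * (1 - b%:C) = (a * (1 - b))%:C :> C.
  by rewrite rmorphM rmorphB.
by apply: eq_bigr => j _; rewrite hornerZ hornerD hornerN hornerC k0 RM.
Qed.

Let size_sumP (F : nat -> {poly C}) m : (forall j, (size (F j) <= cutoff)%N) ->
  (size (\sum_(0 <= j < m) F j)%R <= cutoff)%N.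
Proof.
move=> hF; elim: m => [|m IH]; first by rewrite big_nil size_poly0.
by rewrite big_nat_recr//= (leq_trans (size_polyD _ _))// geq_max IH hF.
Qed.

Let size_k j : (size (k j) <= cutoff)%N. Proof. exact: size_kernel. Qed.

Lemma size_bump_tail : (size bump_tail <= cutoff)%N.
Proof. by apply: size_sumP => j; rewrite (leq_trans (size_scale_leq _ _)). Qed.

Lemma size_bump : (size bump <= cutoff)%N.
Proof.
rewrite (leq_trans (size_polyD _ _))// geq_max size_bump_tail.
by rewrite (leq_trans (size_scale_leq _ _)).
Qed.

Lemma size_damper : (size damper <= cutoff)%N.
Proof.
rewrite (leq_trans (size_polyD _ _))// geq_max (leq_trans (size_polyC_leq1 _)) //=.
apply: size_sumP => j; rewrite (leq_trans (size_scale_leq _ _))//.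
by rewrite (leq_trans (size_polyD _ _))// geq_max size_polyN size_k size_poly1 cutoff0.
Qed.

End Construction.

(** * Inequalities between the bump and the damper *)

Section Inequalities.
Variable R : realType.

(** Away from the point 1, at a distance at least [s / 14], the bump is at most
    [7 * 14 / s], so that [(s / 14)^2 H] is at most [s / 2]. *)
Lemma far_upper (s y v H Rh c0 : R) : 0 < s -> s <= 1 / 1000 ->
  s / 14 <= y -> 0 <= v -> v <= 1 + s -> 0 <= H -> y * H <= 7 ->
  0 <= Rh -> 1 - s / 4 <= c0 ->
  v ^+ 2 * (1 + 2 * ((s / 14) ^+ 2 * H)) ^+ 2 <= (1 + s) ^+ 5 * (c0 + (s / 14) ^+ 2 * Rh).
Proof.
move=> s0 s1 sy v0 vs H0 yH Rh0 c01.
have zH : (s / 14) * H <= 7 by apply: le_trans yH; rewrite ler_wpM2r.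
have e1 : 1 + 2 * ((s / 14) ^+ 2 * H) <= 1 + s by move: s0 zH; clear; nra.
have e0 : 0 <= 1 + 2 * ((s / 14) ^+ 2 * H) by rewrite addr_ge0// mulr_ge0// mulr_ge0// sqr_ge0.
have s10 : 0 <= 1 + s by apply: ltW; apply: addr_gt0.
apply: le_trans (_ : (1 + s) ^+ 2 * (1 + s) ^+ 2 <= _).
  by apply: ler_pM; rewrite ?sqr_ge0//; apply: lerXn2r; rewrite ?nnegrE.
rewrite -exprD [(1 + s) ^+ 5]exprSr -mulrA ler_peMr//.
  exact: exprn_ge0.
have h : 0 <= (s / 14) ^+ 2 * Rh by rewrite mulr_ge0 ?sqr_ge0.
by move: h c01 s0 s1; clear; move: (_ * Rh) => w; nra.
Qed.

Lemma quarter_le (p P M : R) : 0 <= P -> 0 <= p <= 1 ->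
  P / (2 * (1 + p ^+ 2)) <= M -> P / 4 <= M.
Proof.
move=> P0 /andP[p0 p1]; apply: le_trans.
have h : p ^+ 2 <= 1 by rewrite expr_le1.
have q : 0 < 2 * (1 + p ^+ 2) by rewrite mulr_gt0// ltr_wpDr// sqr_ge0.
by rewrite ler_wpM2l// lef_pV2 ?posrE//; move: h; clear; lra.
Qed.

(** The contribution of the levels [j <= i] of the bump near the point 1: [a]
    stands for the size [16^-i] of the damper and [P] for the size [16^i] of
    the real part of the bump.  Since the bump has size [F = 64^i], the product
    [a^2 H^2] is of order [P]. *)
Lemma near_level (q a H F P : R) : 0 <= q -> q * 448 <= 1 / 25 -> 0 <= H ->
  0 <= F -> H <= 448 * F -> 0 <= P -> a ^+ 2 * F ^+ 2 = P ->
  64 * a ^+ 2 * (q ^+ 2 * H) ^+ 2 <= q ^+ 2 * (P / 8).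
Proof.
move=> q0 q1 H0 F0 HF P0 aF.
have h1 : q * H <= F / 25.
  apply: le_trans (_ : q * (448 * F) <= _); first by rewrite ler_wpM2l.
  have : q * 448 * F <= 1 / 25 * F by rewrite ler_wpM2r.
  by clear; lra.
have h2 : (q * H) ^+ 2 <= (F / 25) ^+ 2.
  by apply: lerXn2r; rewrite ?nnegrE ?mulr_ge0.
have h3 : a ^+ 2 * (q * H) ^+ 2 <= P / 25 ^+ 2.
  apply: le_trans (_ : a ^+ 2 * (F / 25) ^+ 2 <= _); first by rewrite ler_wpM2l ?sqr_ge0.
  by rewrite expr_div_n mulrA aF.
have -> : 64 * a ^+ 2 * (q ^+ 2 * H) ^+ 2 = q ^+ 2 * (64 * (a ^+ 2 * (q * H) ^+ 2)) by ring.
by rewrite ler_wpM2l ?sqr_ge0//; move: h3 P0; clear; lra.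
Qed.

(** The contribution of the peak [64^J k_J], which balances the constant term
    [e = 8^-J] of the damper; here [E = 64^J]. *)
Lemma near_peak (q e E H y : R) : 0 <= q -> q <= 1 / 100 -> 0 < E -> 0 <= y ->
  e ^+ 2 * E = 1 -> 0 <= H -> y * H <= 7 -> H <= 4 * E ->
  64 * e ^+ 2 * (q ^+ 2 * H) ^+ 2 <= q ^+ 2 * (E / (2 * (1 + (E * y) ^+ 2))).
Proof.
move=> q0 q1 E0 y0 eE H0 yH HE.
have q2 : q ^+ 2 <= (1 / 100) ^+ 2 by apply: lerXn2r; rewrite ?nnegrE// divr_ge0.
pose D := 1 + (E * y) ^+ 2.
have D0 : 0 < D by rewrite ltr_wpDr// sqr_ge0.
have H2D : H ^+ 2 * D <= 65 * E ^+ 2.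
  have h1 : H ^+ 2 <= 16 * E ^+ 2.
    have : H ^+ 2 <= (4 * E) ^+ 2.
      by apply: lerXn2r => //; rewrite nnegrE ?mulr_ge0// ltW.
    by clear; lra.
  have h2 : (y * H) ^+ 2 <= 49.
    have : (y * H) ^+ 2 <= 7 ^+ 2 by apply: lerXn2r; rewrite ?nnegrE ?mulr_ge0.
    by clear; lra.
  have h3 : E ^+ 2 * (y * H) ^+ 2 <= E ^+ 2 * 49 by rewrite ler_wpM2l ?sqr_ge0.
  rewrite /D (_ : H ^+ 2 * (1 + (E * y) ^+ 2) = H ^+ 2 + E ^+ 2 * (y * H) ^+ 2); last by ring.
  by move: h1 h3; clear; lra.
have h : e ^+ 2 * H ^+ 2 <= 65 * (E / D).
  rewrite mulrA ler_pdivlMr// -mulrA.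
  apply: le_trans (_ : e ^+ 2 * (65 * E ^+ 2) <= _).
    by rewrite ler_wpM2l ?sqr_ge0.
  have -> : e ^+ 2 * (65 * E ^+ 2) = e ^+ 2 * E * (65 * E) by ring.
  by rewrite eE mul1r.
have ED : 0 <= E / D by rewrite divr_ge0 ?ltW.
have h2 : q ^+ 2 * (e ^+ 2 * H ^+ 2) <= (1 / 100) ^+ 2 * (65 * (E / D)).
  by apply: ler_pM => //; first [exact: sqr_ge0 | by apply: mulr_ge0; exact: sqr_ge0].
have -> : 64 * e ^+ 2 * (q ^+ 2 * H) ^+ 2 = q ^+ 2 * (64 * (q ^+ 2 * (e ^+ 2 * H ^+ 2))) by ring.
have -> : E / (2 * (1 + (E * y) ^+ 2)) = (E / D) / 2 by rewrite /D; field; rewrite gt_eqF.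
by rewrite ler_wpM2l ?sqr_ge0//; move: h2 ED; clear; lra.
Qed.

(** Near the point 1, with [v = |V|], [H = |h|], [Rh = Re h], and [M] the real
    part of the bump without its peak.  The extreme scale is given by
    [E = 64^J] and [e = 8^-J], the scale of the point by [F = 64^i],
    [a = 16^-i] and [P = 16^i].  After expansion of the squares, the terms with
    [e^2 H^2] and [a^2 H^2] are controlled by [Re h], the others by [c0]. *)
Lemma near_upper (s y v H Rh M c0 E e F a P : R) : 0 < s -> s <= 1 / 1000 ->
  0 <= y -> y < s / 14 -> 0 <= v -> v <= 2 * e + 2 * a -> 0 <= H -> y * H <= 7 ->
  H <= 4 * E -> 0 < E -> e ^+ 2 * E = 1 -> 0 < e -> e <= s / 2 ->
  1 <= F -> 0 < a -> a * P = 1 -> a ^+ 2 * F ^+ 2 = P -> a ^+ 2 * F <= 1 ->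
  F * y <= 1 -> (F = E /\ a <= e \/ 1 < 64 * F * y) ->
  P / (2 * (1 + (F * y) ^+ 2)) <= M ->
  M + E / (2 * (1 + (E * y) ^+ 2)) <= Rh -> 1 / 2 <= c0 ->
  v ^+ 2 * (1 + 2 * ((s / 14) ^+ 2 * H)) ^+ 2 <= (1 + s) ^+ 5 * (c0 + (s / 14) ^+ 2 * Rh).
Proof.
move=> s0 s1 y0 ys v0 vea H0 yH HE E0 eE e0 es F1 a0 aP aF aF1 Fy FE hM hRh c01.
have F0 : 0 <= F by apply: le_trans F1.
have P0 : 0 < P by have : 0 < a * P by [rewrite aP]; rewrite pmulr_rgt0.
have MP : P / 4 <= M by apply: quarter_le hM; rewrite ?(ltW P0)// mulr_ge0.
have q448 : s / 14 * 448 <= 1 / 25 by move: s1; clear; lra.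
have q100 : s / 14 <= 1 / 100 by move: s1; clear; lra.
have y3 : y <= 1 / 3000 by move: ys s1; clear; lra.
have e40 : e <= 1 / 40 by move: es s1; clear; lra.
have s10 : 1 <= 1 + s by rewrite lerDl ltW.
have q0 : 0 <= s / 14 by rewrite divr_ge0// ltW.
move: (s / 14) q0 q448 q100 => q q0 q448 q100.
have HF : H <= 448 * F.
  case: FE => [[FE _]|FE]; first by move: HE E0; rewrite FE; clear; lra.
  have h1 : 64 * F * (y * H) <= 64 * F * 7 by rewrite ler_wpM2l// mulr_ge0.
  have h2 : 1 * H <= 64 * F * y * H by rewrite ler_wpM2r// ltW.
  by move: h1 h2; clear; lra.
have e2 : e ^+ 2 <= (1 / 40) ^+ 2 by apply: lerXn2r => //; rewrite nnegrE ?divr_ge0// ltW.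
have a2 : a ^+ 2 <= 1 / 46.
  case: FE => [[_ ae]|FE].
    have : a ^+ 2 <= e ^+ 2 by apply: lerXn2r; rewrite ?nnegrE// ltW.
    by move: e2; clear; lra.
  have h1 : 64 * F * y <= 64 * F * (1 / 3000) by rewrite ler_wpM2l// mulr_ge0.
  have h2 : 46 <= F by move: h1 FE; clear; lra.
  have h3 : a ^+ 2 * 46 <= a ^+ 2 * F by rewrite ler_wpM2l ?sqr_ge0.
  by move: h3 aF1; clear; lra.
have v2 : v ^+ 2 <= 8 * e ^+ 2 + 8 * a ^+ 2.
  apply: le_trans (_ : (2 * e + 2 * a) ^+ 2 <= _).
    by apply: lerXn2r; rewrite ?nnegrE// (le_trans v0).
  by have := sqr_ge0 (e - a); clear; nra.
have g2 : (1 + 2 * (q ^+ 2 * H)) ^+ 2 <= 2 + 8 * (q ^+ 2 * H) ^+ 2.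
  by have := sqr_ge0 (1 - 2 * (q ^+ 2 * H)); clear; nra.
have t3 := near_level q0 q448 H0 F0 HF (ltW P0) aF.
have t4 := near_peak q0 q100 E0 y0 eE H0 yH HE.
apply: le_trans (_ : (8 * e ^+ 2 + 8 * a ^+ 2) * (2 + 8 * (q ^+ 2 * H) ^+ 2) <= _).
  by apply: ler_pM => //; exact: sqr_ge0.
have b1 : 1 <= (1 + s) ^+ 5 by rewrite exprn_ege1.
have hh : q ^+ 2 * (P / 8) + q ^+ 2 * (E / (2 * (1 + (E * y) ^+ 2))) <= q ^+ 2 * Rh.
  rewrite -mulrDr ler_wpM2l ?sqr_ge0//; apply: le_trans hRh; rewrite lerD2r.
  by apply: le_trans MP; move: P0; clear; lra.
move: (E / _) hh t4 => Z hh t4.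
have pos : 0 <= 64 * e ^+ 2 * (q ^+ 2 * H) ^+ 2 by apply: mulr_ge0; [rewrite mulr_ge0 ?sqr_ge0 | exact: sqr_ge0].
have pos2 : 0 <= 64 * a ^+ 2 * (q ^+ 2 * H) ^+ 2 by apply: mulr_ge0; [rewrite mulr_ge0 ?sqr_ge0 | exact: sqr_ge0].
have -> : (8 * e ^+ 2 + 8 * a ^+ 2) * (2 + 8 * (q ^+ 2 * H) ^+ 2) =
  16 * e ^+ 2 + 16 * a ^+ 2 + (64 * e ^+ 2 * (q ^+ 2 * H) ^+ 2 + 64 * a ^+ 2 * (q ^+ 2 * H) ^+ 2).
  by ring.
move: (64 * e ^+ 2 * _) (64 * a ^+ 2 * _) pos pos2 t3 t4 => X Y X0 Y0 t3 t4.
move: (q ^+ 2 * (P / 8)) (q ^+ 2 * Z) (q ^+ 2 * Rh) hh t3 t4 => U W T hh t3 t4.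
apply: le_trans (_ : c0 + T <= _).
  by move: hh t3 t4 c01 e2 a2; clear; lra.
by rewrite ler_peMl//; move: hh t3 t4 c01 X0 Y0; clear; lra.
Qed.

(** [v^2] is at least of order [P^-2], while [Rh] and [M] are at least of order
    [P]; a large [C] makes up for the constants. *)
Lemma near_lower (m s y v rv M Rh c0 C F a P : R) : 0 < m -> 0 < s -> 0 <= y ->
  rv <= v -> 1 <= F -> 0 < a -> a * P = 1 ->
  F * y <= 1 -> P / (2 * (1 + (F * y) ^+ 2)) <= M -> M <= Rh -> 0 <= c0 ->
  a / m <= rv -> 16 * m ^+ 2 / (s / 14) ^+ 2 <= C ->
  1 <= v ^+ 2 * (c0 + (s / 14) ^+ 2 * Rh) * (1 + s + C * M).
Proof.
move=> m0 s0 y0 rvv F1 a0 aP Fy hM MRh c00 arv hC.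
pose eta := (s / 14) ^+ 2; rewrite -/eta in hC *.
have eta0 : 0 < eta by rewrite exprn_gt0// divr_gt0.
have P0 : 0 < P by have : 0 < a * P by [rewrite aP]; rewrite pmulr_rgt0.
have MP : P / 4 <= M.
  by apply: quarter_le hM; rewrite ?(ltW P0)// mulr_ge0// (le_trans _ F1).
have C0 : 0 < C by apply: lt_le_trans hC; rewrite divr_gt0// mulr_gt0// exprn_gt0.
have a100 : 0 <= a / m by rewrite divr_ge0 ?ltW.
have v2 : (a / m) ^+ 2 <= v ^+ 2.
  by apply: lerXn2r; rewrite ?nnegrE ?(le_trans _ rvv)// (le_trans _ arv).
have g2 : eta * (P / 4) <= c0 + eta * Rh.
  have : eta * (P / 4) <= eta * Rh by rewrite ler_wpM2l ?(ltW eta0)// (le_trans MP).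
  by move: c00; clear; lra.
have r2 : C * (P / 4) <= 1 + s + C * M.
  have : C * (P / 4) <= C * M by rewrite ler_wpM2l ?(ltW C0).
  by move: s0; clear; lra.
have q0 : 0 <= eta * (P / 4) by rewrite mulr_ge0 ?divr_ge0 ?ltW.
have q1 : 0 <= C * (P / 4) by rewrite mulr_ge0 ?divr_ge0 ?ltW.
apply: le_trans (_ : (a / m) ^+ 2 * (eta * (P / 4)) * (C * (P / 4)) <= _); last first.
  apply: ler_pM => //; first by rewrite mulr_ge0// sqr_ge0.
  by apply: ler_pM => //; exact: sqr_ge0.
have -> : (a / m) ^+ 2 * (eta * (P / 4)) * (C * (P / 4)) =
   (a * P) ^+ 2 * (eta * C) / (16 * m ^+ 2) by field; rewrite gt_eqF.
by rewrite aP expr1n mul1r ler_pdivlMr ?mulr_gt0 ?exprn_gt0// mul1r [leRHS]mulrC -ler_pdivrMr.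
Qed.

(** All the quantities are bounded away from 0 by constants depending on [X]
    only, and [C] is chosen after [X]. *)
Lemma mid_lower (s y v M Rh c0 C X : R) : 0 < s -> 1 <= y -> y <= X ->
  17 / 100 <= v -> 1 / (2 * (1 + y ^+ 2)) <= M -> M <= Rh -> 1 / 2 <= c0 ->
  160 * (1 + X ^+ 2) <= C ->
  1 <= v ^+ 2 * (c0 + (s / 14) ^+ 2 * Rh) * (1 + s + C * M).
Proof.
move=> s0 y1 yX v17 hM MRh c01 hC.
have X2 : 0 < 1 + X ^+ 2 by rewrite ltr_wpDr// sqr_ge0.
have y2 : 0 < 1 + y ^+ 2 by rewrite ltr_wpDr// sqr_ge0.
have hX : 1 / (2 * (1 + X ^+ 2)) <= M.
  apply: le_trans hM; rewrite !div1r lef_pV2 ?posrE ?mulr_gt0// ler_pM2l// lerD2l.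
  by apply: lerXn2r; rewrite ?nnegrE// ?(le_trans _ yX)// (le_trans _ y1).
have M0 : 0 <= M by apply: le_trans hX; rewrite divr_ge0// ltW// mulr_gt0.
have v2 : 1 / 40 <= v ^+ 2.
  have v0 : 0 <= v by apply: le_trans v17; rewrite divr_ge0.
  have : (17 / 100) ^+ 2 <= v ^+ 2 by apply: lerXn2r; rewrite ?nnegrE// divr_ge0.
  by clear; lra.
have g2 : 1 / 2 <= c0 + (s / 14) ^+ 2 * Rh.
  have : 0 <= (s / 14) ^+ 2 * Rh by rewrite mulr_ge0 ?sqr_ge0// (le_trans M0).
  by move: c01; clear; lra.
have r2 : 80 <= 1 + s + C * M.
  have : 160 * (1 + X ^+ 2) * (1 / (2 * (1 + X ^+ 2))) <= C * M.
    by apply: ler_pM => //; [rewrite mulr_ge0// ltW | rewrite divr_ge0// ltW// mulr_gt0].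
  rewrite (_ : 160 * (1 + X ^+ 2) * (1 / (2 * (1 + X ^+ 2))) = 80); last first.
    by field; rewrite gt_eqF.
  by move: s0; clear; lra.
apply: le_trans (_ : 1 / 40 * (1 / 2) * 80 <= _); first by clear; lra.
by apply: ler_pM => //; apply: ler_pM; rewrite ?divr_ge0.
Qed.

(** [|V|] and [c0] are at least [1 - s / 4], and the factor [1 + s] compensates. *)
Lemma far_lower (s y v M Rh c0 C : R) : 0 < s -> s <= 1 / 1000 -> 12 / s <= y ->
  1 - 3 / y <= v -> 0 <= M -> M <= Rh -> 1 - s / 4 <= c0 -> 0 <= C ->
  1 <= v ^+ 2 * (c0 + (s / 14) ^+ 2 * Rh) * (1 + s + C * M).
Proof.
move=> s0 s1 ys hv M0 MRh c01 C0.
have y0 : 0 < y by apply: lt_le_trans ys; rewrite divr_gt0.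
have h3 : 3 / y <= s / 4.
  by rewrite ler_pdivrMr//; move: ys; rewrite ler_pdivrMr// mulrC; clear; lra.
have v1 : 1 - s / 4 <= v by move: h3 hv; clear; lra.
have s4 : 0 <= 1 - s / 4 by move: s0 s1; clear; lra.
have v2 : (1 - s / 4) ^+ 2 <= v ^+ 2 by apply: lerXn2r; rewrite ?nnegrE// (le_trans s4).
have g2 : 1 - s / 4 <= c0 + (s / 14) ^+ 2 * Rh.
  have : 0 <= (s / 14) ^+ 2 * Rh by rewrite mulr_ge0 ?sqr_ge0// (le_trans M0).
  by move: c01; clear; lra.
have r2 : 1 + s <= 1 + s + C * M by rewrite lerDl mulr_ge0.
apply: le_trans (_ : (1 - s / 4) ^+ 2 * (1 - s / 4) * (1 + s) <= _); last first.
  apply: ler_pM => //; [by rewrite mulr_ge0 ?sqr_ge0| by rewrite addr_ge0// ltW|].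
  by apply: ler_pM => //; exact: sqr_ge0.
by move: s0 s1; clear; nra.
Qed.

Lemma sin_le_id (x : R) : 0 <= x -> `|sin x| <= x.
Proof.
rewrite le_eqVlt => /predU1P[<-|x0]; first by rewrite sin0 normr0.
have [c _] := @MVT R (@sin R) (@cos R) 0 x x0 (fun y _ => is_derive_sin y) (continuous_subspaceT (@continuous_sin R)).
rewrite sin0 !subr0 => ->; rewrite normrM (ger0_norm (ltW x0)) ler_piMl ?(ltW x0)//.
exact: cos_max.
Qed.

(** From [cos y = 1 - 2 sin(y/2)^2] and [|sin x| <= x]. *)
Lemma cos_ge_sqr (x : R) : 1 - x ^+ 2 / 2 <= cos x.
Proof.
have h (y : R) : 0 <= y -> 1 - y ^+ 2 / 2 <= cos y.
  move=> y0; have y20 : 0 <= y / 2 by rewrite divr_ge0.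
  have := sin_le_id y20 => sl.
  have -> : cos y = 1 - 2 * sin (y / 2) ^+ 2.
    rewrite [in LHS](splitr y) -mulr2n cos_mulr2n cos2sin2 mulr2n; ring.
  have : `|sin (y / 2)| ^+ 2 <= (y / 2) ^+ 2 by rewrite lerXn2r ?nnegrE.
  rewrite real_normK ?num_real//; move: (sin _ ^+ 2) => q; lra.
have [x0|x0] := leP 0 x; first exact: h.
by have := h (- x); rewrite cosN sqrrN; apply; lra.
Qed.

Lemma chord_le_norm (x : R) : chord x <= `|x|.
Proof.
rewrite -(@ler_pXn2r _ 2) ?nnegrE ?chord_ge0// chord2 real_normK ?num_real//.
by have := cos_ge_sqr x; lra.
Qed.

End Inequalities.

(** * Concentration near the point 1 *)

Section Concentration.
Variable R : realType.
Notation C := R[i].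
Notation Re := complex.Re.
Notation Im := complex.Im.

(** [m] times the length [2 a], divided by [2 pi <= 8]. *)
Lemma mean_ge_interval (f : R -> R) (a m : R) : continuous f ->
  (forall t, 0 <= f t) -> 0 < a <= 1 -> 0 <= m ->
  (forall t, `|t| <= a -> m <= f t) -> m * a / 4 <= mean f.
Proof.
move=> cf f0 /andP[a0 a1] m0 fm.
have pi2 := @pi_ge2 R.
have pi4 : pi <= 4 :> R by have /andP[_] := @pihalf_02 R; lra.
have p0 := @pi2_gt0 R.
pose I : set R := `[- a, a]%classic.
have mI : measurable (I : set (measurableTypeR R)) by exact: measurable_itv.
have sub : I `<=` circle.
  move=> t; rewrite /I /circle /= !in_itv /= => /andP[t1 t2].
  by apply/andP; split; lra.
have fin := continuous_integrable_circle cf.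
have finI : (@lebesgue_measure R).-integrable I (EFin \o f).
  by apply: integrableS fin => //; exact: measurable_circle.
have mass : fine (@lebesgue_measure R I) = 2 * a.
  rewrite lebesgue_measure_itv /= lte_fin ifT; last by lra.
  by rewrite /=; ring.
have finm : (@lebesgue_measure R).-integrable I (EFin \o cst m).
  apply: continuous_compact_integrable; first exact: segment_compact.
  by apply: continuous_subspaceT; exact: contC.
have h1 : m * (2 * a) <= \int[@lebesgue_measure R]_(t in I) f t.
  rewrite -mass -(@Rintegral_cst _ _ _ (@lebesgue_measure R) I mI m).
  apply: le_Rintegral => // t; rewrite /I /= in_itv /= => /andP[t1 t2].
  by apply: fm; rewrite ler_norml t1 t2.
have h2 : \int[@lebesgue_measure R]_(t in I) f t <= \int[@lebesgue_measure R]_(t in circle) f t.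
  rewrite /Rintegral; apply: fine_le.
  - by apply: integrable_fin_num.
  - by apply: integrable_fin_num => //; exact: measurable_circle.
  apply: ge0_subset_integral => //.
  - exact: measurable_circle.
  - by have /integrableP[] := fin.
  - by move=> t _; rewrite lee_fin.
rewrite /mean ler_pdivlMr//; apply: le_trans (le_trans h1 h2).
have ma : 0 <= m * a by rewrite mulr_ge0// ltW.
have : m * a * pi <= m * a * 4 by rewrite ler_wpM2l.
by move: (pi) => p; clear; lra.
Qed.

(** A polynomial whose squared modulus is a Fejer kernel normalized to have
    maximum 1: it is concentrated on an arc of length of order [1/N]. *)
Definition fejer_root N : {poly C} := \poly_(i < N) (N%:R^-1 : R)%:C.

Lemma size_fejer_root N : (0 < N)%N -> size (fejer_root N) = N.
Proof.
by move=> N0; rewrite size_poly_eq// -(rmorph0 (real_complex R)) (inj_eq (@complexI R)) invr_eq0 pnatr_eq0 -lt0n.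
Qed.

Lemma mean_sq_fejer_root N : (0 < N)%N ->
  mean (fun t => sq (fejer_root N).[expi t]) = N%:R^-1.
Proof.
move=> N0; have n0 : N%:R != 0 :> R by rewrite pnatr_eq0 -lt0n.
rewrite mean_sq_horner size_fejer_root//.
rewrite (eq_bigr (fun=> (N%:R^-1) ^+ 2)); last first.
  by move=> i _; rewrite coef_poly ltn_ord sqR.
by rewrite sumr_const card_ord -[LHS]mulr_natl expr2 mulVKf.
Qed.

Lemma sq_fejer_root_le1 N t : (0 < N)%N -> sq (fejer_root N).[expi t] <= 1.
Proof.
move=> N0; apply: le_trans (sq_horner_le _ _) _.
by rewrite size_fejer_root// mean_sq_fejer_root// mulfV// pnatr_eq0 -lt0n.
Qed.

(** On this arc all the angles [i t], [i < N], are at most [1/2]. *)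
Lemma sq_fejer_root_ge N t : (0 < N)%N -> `|t| <= (2 * N%:R)^-1 ->
  1 / 2 <= sq (fejer_root N).[expi t].
Proof.
move=> N0 tN; have n0 : 0 < N%:R :> R by rewrite ltr0n.
have h : 7 / 8 <= Re (fejer_root N).[expi t].
  rewrite horner_poly.
  have -> : Re (\sum_(i < N) (N%:R^-1)%:C * expi t ^+ i) = \sum_(i < N) N%:R^-1 * cos (i%:R * t).
    elim/big_rec2: _ => // i y1 y2 _ <-.
    by rewrite cReD cReM expiX /= mul0r subr0.
  apply: le_trans (_ : \sum_(i < N) N%:R^-1 * (7 / 8) <= _).
    by rewrite sumr_const card_ord -[leRHS]mulr_natl mulVKf// gt_eqF.
  apply: ler_sum => i _; rewrite ler_wpM2l ?invr_ge0 ?(ltW n0)//.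
  apply: le_trans (cos_ge_sqr _).
  have it : `|i%:R * t| <= 1 / 2.
    rewrite normrM ger0_norm//.
    apply: le_trans (_ : N%:R * (2 * N%:R)^-1 <= _).
      by apply: ler_pM => //; rewrite ler_nat ltnW.
    by rewrite invfM mulrCA mulfV ?mulr1 ?gt_eqF// div1r.
  have : `|i%:R * t| ^+ 2 <= (1 / 2) ^+ 2 by apply: lerXn2r; rewrite ?nnegrE.
  by rewrite real_normK ?num_real//; clear; lra.
apply: le_trans (_ : (7 / 8) ^+ 2 <= _); first by clear; lra.
rewrite -sq_nrm; apply: lerXn2r; rewrite ?nnegrE ?nrm_ge0//.
exact: le_trans h (Re_le_nrm _).
Qed.

End Concentration.

(** * Large degrees *)

Section LargeScale.
Variable R : realType.
Notation C := R[i].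
Notation Re := complex.Re.
Notation Im := complex.Im.

(** The frame is applied to the damper [V], to [G = c0 + q^2 h] with [h] the bump
    and [c0] such that [G(0) = 1], to [r = 1 + s + A h2] with [h2] the bump
    without its peak, to the test polynomial of order [N = B 64^J], and to
    [L = 2^J].  The bound for the weight uses [b = (1+s)^5], and [r(0)] is at
    most [1 + 2 s]; since [delta <= 1 - 1000 s] the mass condition holds.  On the
    arc of length [1/N] the product [V G] has squared modulus at least
    [q^4 64^J / 25], which gives a fixed mass [q^4 / (400 B)], whereas [L^2 / N]
    is the small number [16^-J / B]. *)
Lemma Omega_ge_scale (delta s A : R) (B J n : nat) (q := s / 14) :
  0 < delta -> 0 < s -> delta <= 1 - 1000 * s ->
  16 * 100 ^+ 2 / (s / 14) ^+ 2 <= A -> 160 * (1 + (12 / s) ^+ 2) <= A ->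
  (2 <= B)%N -> 3 / B%:R <= s / 4 -> A * (2 / B%:R) <= s ->
  2 * (8 ^+ J)^-1 <= s -> (16 ^+ J)^-1 <= q ^+ 4 / (400 * 8) ->
  (5 * cutoff B J <= n)%N ->
  ((delta * (J%:R * ln 2 * (q ^+ 4 / ((400 * 8) * B%:R))))%:E <= Omega n (steklov delta))%E.
Proof.
move=> delta_gt0 s_gt0 delta_s A1 A2 B2 B3 B4 J1 J2 nJ.
have s1 : s <= 1 / 1000 by move: delta_gt0 delta_s; clear; lra.
have q0 : 0 < q by rewrite divr_gt0.
have q1 : q ^+ 2 <= 1.
  by rewrite expr_le1 ?(ltW q0)// /q; move: s1; clear; lra.
pose x t : R := B%:R * chord t.
pose V : {poly C} := damper R B J.
pose h : {poly C} := bump R B J.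
pose h2 : {poly C} := bump_tail R B J.
pose k := cutoff B J.
have [a0 h0 /andP[a00 a03]] := bump0 R J B2.
have [a2 h20 /andP[a20 a22]] := bump_tail0 R J B2.
have [v0 V0] := damper0 R J B2.
have b0 : 0 < B%:R :> R by rewrite ltr0n (leq_trans _ B2).
have A0 : 0 < A.
  by apply: lt_le_trans A1; rewrite divr_gt0 ?mulr_gt0 ?exprn_gt0// divr_gt0.
have x0 t : 0 <= x t by rewrite mulr_ge0 ?chord_ge0.
(* This value makes G(0) = 1. *)
pose c0 := 1 - q ^+ 2 * a0.
have c0s : 1 - s / 4 <= c0.
  rewrite lerD2l lerN2; apply: le_trans B3; apply: le_trans a03.
  by rewrite ler_piMl.
have c0h : 1 / 2 <= c0 by apply: le_trans c0s; move: s1; clear; lra.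
have c01 : c0 <= 1 by rewrite gerBl mulr_ge0 ?sqr_ge0.
have c00 : 0 <= c0 by apply: le_trans c0h; rewrite divr_ge0.
pose G : {poly C} := c0%:C%:P + (q ^+ 2)%:C *: h.
pose r : {poly C} := (1 + s)%:C%:P + A%:C *: h2.
have ReZ (a : R) (y : C) : Re (a%:C * y) = a * Re y by rewrite cReM /= mul0r subr0.
have ImZ (a : R) (y : C) : Im (a%:C * y) = a * Im y by rewrite cImM /= mul0r addr0.
have GE t : G.[expi t] = c0%:C + (q ^+ 2)%:C * h.[expi t] by rewrite hornerD hornerZ hornerC.
have ReG t : Re G.[expi t] = c0 + q ^+ 2 * Re h.[expi t] by rewrite GE cReD ReZ.
have Rer t : Re r.[expi t] = 1 + s + A * Re h2.[expi t].
  by rewrite hornerD hornerZ hornerC cReD ReZ.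
have h20' t : 0 <= Re h2.[expi t] := bump_tail_Re_ge0 J B2 t.
have hh2 t : Re h2.[expi t] <= Re h.[expi t].
  apply: le_trans (bump_Re_ge J B2 t); rewrite lerDl divr_ge0 ?exprn_ge0//.
  by rewrite mulr_ge0// addr_ge0// sqr_ge0.
have h0' t : 0 <= Re h.[expi t] by apply: le_trans (hh2 t).
have ImG t : nrm G.[expi t] + `|Im G.[expi t]| <= 1 + 2 * (q ^+ 2 * nrm h.[expi t]).
  have hZ : nrm ((q ^+ 2)%:C * h.[expi t]) = q ^+ 2 * nrm h.[expi t].
    by rewrite nrmM nrmR ger0_norm ?sqr_ge0.
  have n1 : nrm G.[expi t] <= 1 + q ^+ 2 * nrm h.[expi t].
    rewrite GE; apply: le_trans (nrmD _ _) _.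
    by rewrite hZ nrmR ger0_norm// lerD2r.
  have n2 : `|Im G.[expi t]| <= q ^+ 2 * nrm h.[expi t].
    rewrite GE cImD ImZ /= add0r normrM ger0_norm ?sqr_ge0//.
    by rewrite ler_wpM2l ?sqr_ge0// Im_le_nrm.
  by move: n1 n2; clear; lra.
have e8 : 0 < (8 ^+ J : R)^-1 by rewrite invr_gt0 exprn_gt0.
have i16 (i : nat) : 0 < (16 : R) ^+ i by exact: exprn_gt0.
have i64 (i : nat) : 0 < (64 : R) ^+ i by exact: exprn_gt0.
have e168 : (16 ^+ J : R)^-1 <= (8 ^+ J)^-1.
  by rewrite lef_pV2 ?posrE ?exprn_gt0//; apply: lerXn2r; rewrite ?nnegrE// ler_nat.
have sqVG t : sq V.[expi t] * (nrm G.[expi t] + `|Im G.[expi t]|) ^+ 2 <= (1 + s) ^+ 5 * Re G.[expi t].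
  rewrite ReG -sq_nrm.
  apply: le_trans (_ : nrm V.[expi t] ^+ 2 * (1 + 2 * (q ^+ 2 * nrm h.[expi t])) ^+ 2 <= _).
    rewrite ler_wpM2l ?sqr_ge0//; apply: lerXn2r => //; rewrite nnegrE.
      by rewrite addr_ge0 ?nrm_ge0.
    by rewrite addr_ge0// mulr_ge0// mulr_ge0 ?sqr_ge0 ?nrm_ge0.
  have [xq|xq] := leP q (x t).
    apply: (@far_upper _ s (x t)); rewrite ?nrm_ge0//.
    - by apply: le_trans (damper_nrm_le J B2 t) _; rewrite lerD2l.
    - exact: bump_nrm_decay.
  have x1 : 0 <= x t <= 1.
    by rewrite x0 (le_trans (ltW xq))// /q; move: s1; clear; lra.
  (* [i] is the scale of the point: 64^i x <= 1 < 64^(i+1) x, unless i = J. *)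
  have [i iJ [ix iE]] := scale_index 64 J x1.
  apply: (@near_upper _ s (x t) _ _ _ (Re h2.[expi t]) _ (64 ^+ J) (8 ^+ J)^-1
    (64 ^+ i) (16 ^+ i)^-1 (16 ^+ i)); rewrite ?nrm_ge0 ?invr_gt0//.
  - exact: damper_nrm_small.
  - exact: bump_nrm_decay.
  - exact: bump_nrm_le.
  - by rewrite exprVn -exprM mulnC exprM -natrX mulVf// gt_eqF.
  - by move: J1; clear; lra.
  - by rewrite exprn_ege1// ler1n.
  - by rewrite mulVf// gt_eqF.
  - rewrite -exprMn (_ : (16 ^+ i)^-1 * 64 ^+ i = 4 ^+ i :> R).
      by rewrite -exprM mulnC exprM; congr (_ ^+ i); rewrite -natrX.
    by rewrite (_ : (64 : R) = 16 * 4) ?exprMn ?mulKf ?gt_eqF// -natrM.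
  - rewrite expr2 -mulrA (_ : (16 ^+ i)^-1 * 64 ^+ i = 4 ^+ i :> R).
      rewrite mulrC ler_pdivrMr// mul1r; apply: lerXn2r; rewrite ?nnegrE// ler_nat//.
    by rewrite (_ : (64 : R) = 16 * 4) ?exprMn ?mulKf ?gt_eqF// -natrM.
  - case: iE => [->|iE]; [by left | by right; rewrite -exprS].
  - exact: bump_tail_Re_ge.
  - exact: bump_Re_ge.
have e8V t : (8 ^+ J)^-1 / 2 <= Re V.[expi t].
  apply: le_trans (damper_Re_ge B2 t (leq0n J)); rewrite lerDl.
  apply: mulr_ge0; first by rewrite !divr_ge0// exprn_ge0.
  apply: mulr_ge0; first by rewrite divr_ge0.
  by apply: divr_ge0; rewrite ?sqr_ge0// addr_ge0// sqr_ge0.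
have far1 (y : R) : 1 <= y -> 1 / 2 <= y ^+ 2 / (1 + y ^+ 2).
  move=> y1; have y2 : 1 <= y ^+ 2 by rewrite exprn_ege1.
  by rewrite ler_pdivlMr ?(lt_le_trans _ (lerD ler01 y2))//; move: y2; clear; lra.
have sqVGr t : 1 <= sq V.[expi t] * Re G.[expi t] * Re r.[expi t].
  rewrite ReG Rer -sq_nrm.
  have [x1|x1] := leP (x t) 1; last have [xX|xX] := leP (x t) (12 / s).
  - have x01 : 0 <= x t <= 1 by rewrite x0.
    have [i iJ [ix iE]] := scale_index 64 J x01.
    apply: (@near_lower _ 100 s (x t) _ (Re V.[expi t]) _ _ _ _ (64 ^+ i) (16 ^+ i)^-1
       (16 ^+ i)); rewrite ?invr_gt0 ?Re_le_nrm//.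
    + by rewrite exprn_ege1// ler1n.
    + by rewrite mulVf// gt_eqF.
    + exact: bump_tail_Re_ge.
    have [iJ'|Ji] := ltnP i J.
      have y1 : 1 <= 64 ^+ i.+1 * x t.
        by case: iE => [iE|/ltW//]; move: iJ'; rewrite iE ltnn.
      apply: le_trans (damper_Re_ge B2 t iJ').
      have := far1 _ y1; rewrite /= -/(x t) [16 ^+ i.+1]exprS invfM.
      move: ((_ * x t) ^+ 2 / _) => w w2.
      have : 0 < (16 ^+ i : R)^-1 by rewrite invr_gt0.
      move: (16 ^+ i)^-1 w2 e8 => a w2 e80 a1.
      have aw : a * (1 / 2) <= a * w by rewrite ler_wpM2l// ltW.
      by move: aw e80 a1; clear; lra.
    have -> : i = J by apply/eqP; rewrite eqn_leq iJ.
    by apply: le_trans (e8V t); move: e168 e8; clear; lra.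
  - apply: (@mid_lower _ s (x t) _ _ _ _ _ (12 / s)) => //; first exact: ltW.
      apply: le_trans (Re_le_nrm _).
      apply: le_trans (damper_Re_ge B2 t (leq0n J)).
      have := far1 _ (ltW x1); rewrite /= -/(x t) !expr0 [1 * x t]mul1r divr1.
      by move: (x t ^+ 2 / _) e8 => w; clear; lra.
    by have := bump_tail_Re_ge B2 t (leq0n J); rewrite !expr0 !mul1r.
  - apply: (@far_lower _ s (x t)) => //; [exact: ltW | | exact: ltW].
    by apply: damper_nrm_ge => //; rewrite -/(x t); apply: lt_trans x1.
have N0 : (0 < scale B J)%N by rewrite muln_gt0 expn_gt0 (leq_trans _ B2).
have k0 : (0 < k)%N by rewrite muln_gt0 expn_gt0 N0.
have Nk : (scale B J <= k)%N.
  by rewrite /k /cutoff expnS expn1 mulnA leq_pmull// muln_gt0.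
have sV : (size V <= k)%N by exact: size_damper.
have sG : (size G <= k)%N.
  rewrite (leq_trans (size_polyD _ _))// geq_max (leq_trans (size_polyC_leq1 _))//=.
  by rewrite (leq_trans (size_scale_leq _ _))// size_bump.
have sr : (size r <= k.+1)%N.
  rewrite (leq_trans (size_polyD _ _))// geq_max (leq_trans (size_polyC_leq1 _))//=.
  by rewrite (leq_trans (size_scale_leq _ _))// leqW// size_bump_tail.
have sU : (size (V * G)%R <= k + k)%N.
  by rewrite (leq_trans (size_polyMleq _ _))// (leq_trans (leq_pred _))// leq_add.
have n5 : (k + (k + k + (k + k)) <= n)%N.
  by move: nJ; rewrite -/k; move: (k) => w; clear; lia.
have n3 : (k + k + k <= n)%N.
  by move: n5; move: (k) => w; clear; lia.
pose tau := fejer_root R (scale B J).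
have size_M (P Q : {poly C}) a b : (size P <= a -> size Q <= b -> size (P * Q)%R <= a + b)%N.
  by move=> Pa Qb; rewrite (leq_trans (size_polyMleq _ _))// (leq_trans (leq_pred _))// leq_add.
have st : (size (tau * ((V * G) ^+ 2 - V ^+ 2))%R <= n)%N.
  apply: leq_trans n5.
  apply: (size_M); first by rewrite size_fejer_root.
  rewrite (leq_trans (size_polyD _ _))// geq_max size_polyN !expr2 size_M//=.
  by rewrite (leq_trans (size_M _ _ _ _ sV sV))// leq_addr.
have sVd : (size V + k <= n)%N.
  by apply: leq_trans n3; rewrite leq_add2r (leq_trans sV)// leq_addr.
have sUd : (size (V * G)%R + k <= n)%N by apply: leq_trans n3; rewrite leq_add2r.
have v1 : 0 < (8 ^+ J : R)^-1 / 2 by rewrite divr_gt0.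
have c0p : 0 < c0 by apply: lt_le_trans c0h; rewrite divr_gt0.
have G0 : G.[0] = 1.
  by rewrite hornerD hornerZ hornerC h0 -rmorphM -rmorphD subrK.
have ReG0 t : c0 <= Re G.[expi t] by rewrite ReG lerDl mulr_ge0 ?sqr_ge0.
have bp : 0 < (1 + s) ^+ 5 by rewrite exprn_gt0// addr_gt0.
have r0 : Re r.[0] <= 1 + 2 * s.
  rewrite hornerD hornerZ hornerC cReD ReZ h20 /=.
  have : A * a2 <= A * (2 / B%:R) by rewrite ler_wpM2l// ltW.
  by move: B4; clear; lra.
have s7 : (1 + s) ^+ 5 * (1 + 2 * s) <= 1 + 12 * s.
  have s2 : s ^+ 2 <= s / 100.
    by rewrite expr2 ler_wpM2l ?(ltW s_gt0)//; move: s1; clear; lra.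
  have p0 : 0 <= 1 + s by rewrite addr_ge0// ltW.
  have p2 : (1 + s) ^+ 2 <= 1 + 3 * s by move: s2 s_gt0; clear; lra.
  have p4 : (1 + s) ^+ 2 * (1 + s) ^+ 2 <= 1 + 7 * s.
    apply: le_trans (_ : (1 + 3 * s) * (1 + 3 * s) <= _).
      by apply: ler_pM => //; exact: sqr_ge0.
    by move: s2 s_gt0; clear; lra.
  have p5 : (1 + s) ^+ 5 <= 1 + 9 * s.
    rewrite exprSr [_ ^+ 4](exprD _ 2 2).
    apply: le_trans (_ : (1 + 7 * s) * (1 + s) <= _); first by rewrite ler_wpM2r.
    by move: s2 s_gt0; clear; lra.
  apply: le_trans (_ : (1 + 9 * s) * (1 + 2 * s) <= _).
    by rewrite ler_wpM2r// addr_ge0// mulr_ge0// ltW.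
  by move: s2 s_gt0; clear; lra.
have mass : delta * (1 + s) ^+ 5 * Re r.[0] <= 1.
  apply: le_trans (_ : (1 - 1000 * s) * (1 + 12 * s) <= _); last first.
    by have := sqr_ge0 s; move: s_gt0; clear; lra.
  rewrite -mulrA; apply: ler_pM; rewrite ?(ltW delta_gt0)//.
    rewrite mulr_ge0 ?(ltW bp)// hornerD hornerZ hornerC cReD ReZ h20 /=.
    by rewrite addr_ge0 ?mulr_ge0// ?(ltW A0)// addr_ge0// ltW.
  by apply: le_trans s7; rewrite ler_wpM2l ?(ltW bp).
have cw : continuous (frame_w V G n) := frame_w_cont v1 c0p V0 G0 e8V ReG0 sUd sVd.
have wb t : ((1 + s) ^+ 5)^-1 <= frame_w V G n t.
  by apply: (frame_w_ge n v1 c0p e8V ReG0).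
have mub : ((1 + s) ^+ 5)^-1 <= mean (frame_w V G n).
  by rewrite -[leLHS](@mean_cst R); apply: mean_le => //; exact: contC.
have mu2 : 1 / 2 <= ((1 + s) ^+ 5)^-1.
  rewrite div1r lef_pV2 ?posrE//.
  have : (1 + s) ^+ 5 * 1 <= (1 + s) ^+ 5 * (1 + 2 * s).
    by rewrite ler_wpM2l ?(ltW bp)// lerDl mulr_ge0// ltW.
  by move: s7 s1; clear; lra.
have tau1 t : sq tau.[expi t] <= 1 by exact: sq_fejer_root_le1.
pose L : R := 2 ^+ J.
have L1 : 1 <= L by rewrite exprn_ege1// ler1n.
have main := frame_Omega_ge delta_gt0 v1 c0p V0 G0 e8V ReG0 sUd sVd bp sqVG sr sqVGr
  mass tau1 st mub L1.
apply: le_trans main; rewrite lee_fin ler_wpM2l ?(ltW delta_gt0)//.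
have -> : ln L = J%:R * ln 2 by rewrite /L lnXn// mulr_natl.
apply: ler_wpM2l; first by rewrite mulr_ge0// ln_ge0// ler1n.
rewrite (mean_sq_fejer_root R N0).
pose f t := sq tau.[expi t] * (sq (V * G).[expi t] + sq V.[expi t]).
have cs (p : {poly C}) : continuous (fun t => sq p.[expi t]).
  by apply: cont_sq; exact: ccont_horner.
have cf : continuous f by apply: contM; [exact: cs | apply: contD; exact: cs].
have NE : (scale B J)%:R = B%:R * 64 ^+ J :> R by rewrite /scale natrM natrX.
have NR1 : 1 <= (scale B J)%:R :> R by rewrite ler1n.
have conc : q ^+ 4 * 64 ^+ J / 50 * (2 * (scale B J)%:R)^-1 / 4 <= mean f.
  apply: mean_ge_interval => //.
  - by move=> t; apply: mulr_ge0; [|apply: addr_ge0]; exact: sq_ge0.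
  - rewrite invr_gt0 invf_le1 ?mulr_gt0// ?(lt_le_trans _ NR1)//=.
    by move: NR1; clear; lra.
  - by rewrite !mulr_ge0 ?exprn_ge0// ltW.
  move=> t tN; have tau2 := sq_fejer_root_ge N0 tN.
  have pt : 64 ^+ J * x t <= 1 / 2.
    have -> : 64 ^+ J * x t = (scale B J)%:R * chord t by rewrite NE /x; ring.
    apply: le_trans (_ : (scale B J)%:R * (2 * (scale B J)%:R)^-1 <= _).
      by rewrite ler_wpM2l// (le_trans (chord_le_norm t)).
    by rewrite invfM mulrCA mulfV ?mulr1 ?div1r// gt_eqF// (lt_le_trans _ NR1).
  have hp : 64 ^+ J * (2 / 5) <= Re h.[expi t].
    apply: le_trans (bump_Re_ge J B2 t); rewrite /= -/(x t).
    apply: le_trans (_ : 64 ^+ J / (2 * (1 + (64 ^+ J * x t) ^+ 2)) <= _); last by rewrite lerDr.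
    rewrite ler_wpM2l ?exprn_ge0//.
    have p2 : (64 ^+ J * x t) ^+ 2 <= (1 / 2) ^+ 2.
      by apply: lerXn2r; rewrite ?nnegrE// mulr_ge0// exprn_ge0.
    have D0 : 0 < 2 * (1 + (64 ^+ J * x t) ^+ 2) by rewrite mulr_gt0// ltr_wpDr// sqr_ge0.
    rewrite -[leRHS]div1r ler_pdivlMr//.
    by move: p2; clear; lra.
  have gp : q ^+ 2 * (64 ^+ J * (2 / 5)) <= nrm G.[expi t].
    apply: le_trans (Re_le_nrm _); rewrite ReG.
    apply: le_trans (_ : q ^+ 2 * Re h.[expi t] <= _); last by rewrite lerDr.
    by rewrite ler_wpM2l ?sqr_ge0.
  have vp : (8 ^+ J)^-1 / 2 <= nrm V.[expi t] by apply: le_trans (e8V t) (Re_le_nrm _).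
  have up : q ^+ 4 * 64 ^+ J / 25 <= sq (V * G).[expi t].
    rewrite hornerM -sq_nrm nrmM.
    apply: le_trans (_ : ((8 ^+ J)^-1 / 2 * (q ^+ 2 * (64 ^+ J * (2 / 5)))) ^+ 2 <= _).
      rewrite le_eqVlt; apply/orP; left; apply/eqP.
      have e64 : (8 ^+ J)^-1 ^+ 2 * 64 ^+ J = 1 :> R.
        by rewrite exprVn -exprM mulnC exprM -natrX mulVf// gt_eqF.
      transitivity (q ^+ 4 * 64 ^+ J / 25 * ((8 ^+ J)^-1 ^+ 2 * 64 ^+ J)).
        by rewrite e64 mulr1.
      by field.
    have p1 : 0 <= (8 ^+ J : R)^-1 / 2 by exact: ltW.
    have p2 : 0 <= q ^+ 2 * (64 ^+ J * (2 / 5)).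
      by rewrite mulr_ge0 ?sqr_ge0// mulr_ge0 ?exprn_ge0// divr_ge0.
    apply: lerXn2r; rewrite ?nnegrE; first exact: mulr_ge0.
      by rewrite mulr_ge0 ?nrm_ge0.
    exact: ler_pM.
  rewrite /f; apply: le_trans (_ : 1 / 2 * (q ^+ 4 * 64 ^+ J / 25) <= _).
    by rewrite le_eqVlt; apply/orP; left; apply/eqP; field.
  apply: ler_pM => //.
    by rewrite divr_ge0// mulr_ge0 ?exprn_ge0// ltW.
  by apply: le_trans up _; rewrite lerDl sq_ge0.
have e1 : q ^+ 4 * 64 ^+ J / 50 * (2 * (scale B J)%:R)^-1 / 4 = q ^+ 4 / (400 * B%:R).
  by rewrite NE; field; rewrite !gt_eqF.
have e2 : L ^+ 2 * (scale B J)%:R^-1 = (16 ^+ J)^-1 / B%:R.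
  have -> : L ^+ 2 = 4 ^+ J.
    by rewrite /L -exprM mulnC exprM; congr (_ ^+ J); rewrite -natrX.
  rewrite NE (_ : (64 : R) = 16 * 4) ?exprMn; last by rewrite -natrM.
  by field; rewrite !gt_eqF// exprn_gt0.
have e3 : (16 ^+ J)^-1 / B%:R <= q ^+ 4 / (400 * 8) / B%:R by rewrite ler_wpM2r// invr_ge0 ltW.
have e4 : 1 / 2 / 2 * (q ^+ 4 / (400 * B%:R)) <= ((1 + s) ^+ 5)^-1 / 2 * mean f.
  apply: ler_pM; last by rewrite -e1.
  - by rewrite !divr_ge0.
  - apply: divr_ge0; first exact: exprn_ge0 (ltW q0).
    by apply: mulr_ge0; [exact: ler0n | exact: ltW].
  - by apply: ler_wpM2r => //; rewrite invr_ge0.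
rewrite e2.
have e5 : q ^+ 4 / ((400 * 8) * B%:R) = 1 / 2 / 2 * (q ^+ 4 / (400 * B%:R)) - q ^+ 4 / (400 * 8) / B%:R.
  by field; rewrite gt_eqF.
by rewrite e5; apply: lerB.
Qed.

End LargeScale.

(** * Growth like the logarithm *)

Section Logarithm.
Variable R : realType.

Lemma exists_nat_ge (y : R) : exists2 m : nat, (2 <= m)%N & y <= m%:R.
Proof.
exists (Num.truncn `|y|).+2 => //; apply: le_trans (ler_norm y) _.
by rewrite -addn1 natrD ler_wpDr// ltW// -Num.Theory.truncn_lt_nat.
Qed.

Lemma invr_expr_le (p : nat) (e : R) J : (2 <= p)%N -> 0 < e -> e^-1 <= J%:R ->
  ((p%:R ^+ J)^-1 : R) <= e.
Proof.
move=> p2 e0 eJ; rewrite -[leRHS]invrK lef_pV2 ?posrE ?invr_gt0 ?exprn_gt0//; last first.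
  by rewrite ltr0n (leq_trans _ p2).
by apply: le_trans eJ _; rewrite -natrX ler_nat ltnW// ltn_expl.
Qed.

(** The constants are chosen in the order [s], [A], [B], [J]. *)
Lemma Omega_ge_linear (delta : R) : 0 < delta < 1 ->
  exists2 c : R, 0 < c & exists B J0 : nat, [/\ (0 < B)%N, (0 < J0)%N &
    forall J n, (J0 <= J)%N -> (5 * cutoff B J <= n)%N ->
      ((c * J%:R)%:E <= Omega n (steklov delta))%E].
Proof.
move=> /andP[d0 d1].
have [s s0 ds] : exists2 s : R, 0 < s & delta <= 1 - 1000 * s.
  exists ((1 - delta) / 1000); first by rewrite divr_gt0 ?subr_gt0 ?ltr0n.
  by rewrite mulrC divfK ?pnatr_eq0// opprB addrC subrK.
pose q := s / 14.
have q0 : 0 < q by rewrite divr_gt0.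
have [A A0 [A1 A2]] : exists2 A : R, 0 <= A &
    16 * 100 ^+ 2 / q ^+ 2 <= A /\ 160 * (1 + (12 / s) ^+ 2) <= A.
  have [m _ hm] := exists_nat_ge (16 * 100 ^+ 2 / q ^+ 2).
  have [m' _ hm'] := exists_nat_ge (160 * (1 + (12 / s) ^+ 2)).
  exists (m%:R + m'%:R); first by rewrite addr_ge0.
  by split; [apply: le_trans hm _ | apply: le_trans hm' _]; rewrite ?lerDl ?lerDr ler0n.
have [B B2 hB] := exists_nat_ge (12 / s + A * 2 / s).
have b0 : 0 < B%:R :> R by rewrite ltr0n (leq_trans _ B2).
have As : 0 <= A * 2 / s by rewrite divr_ge0 ?mulr_ge0// ltW.
have ss : 0 <= 12 / s by rewrite divr_ge0// ltW.
have B3 : 3 / B%:R <= s / 4.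
  rewrite ler_pdivrMr// mulrAC ler_pdivlMr//.
  have : 12 / s <= B%:R by apply: le_trans hB; rewrite lerDl.
  by rewrite ler_pdivrMr// mulrC; apply: le_trans; rewrite -natrM.
have B4 : A * (2 / B%:R) <= s.
  rewrite mulrA ler_pdivrMr//.
  have : A * 2 / s <= B%:R by apply: le_trans hB; rewrite lerDr.
  by rewrite ler_pdivrMr// [B%:R * s]mulrC.
have q4 : 0 < q ^+ 4 / (400 * 8) by rewrite divr_gt0 ?exprn_gt0 ?mulr_gt0 ?ltr0n.
have s20 : 0 < s / 2 by rewrite divr_gt0.
have [J0 J02 hJ] := exists_nat_ge ((s / 2)^-1 + (q ^+ 4 / (400 * 8))^-1).
exists (delta * (ln 2 * (q ^+ 4 / ((400 * 8) * B%:R)))).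
  apply: mulr_gt0; [exact: d0 | apply: mulr_gt0; first by rewrite ln_gt0 ?ltr1n].
  apply: divr_gt0; first exact: exprn_gt0.
  by apply: mulr_gt0; [apply: mulr_gt0; rewrite ltr0n | exact: b0].
exists B, J0; split; [exact: ltnW | exact: ltnW |] => J n J0J nJ.
have hJ' : (s / 2)^-1 + (q ^+ 4 / (400 * 8))^-1 <= J%:R.
  by apply: le_trans hJ _; rewrite ler_nat.
have s2J : (s / 2)^-1 <= J%:R.
  by apply: le_trans hJ'; rewrite lerDl invr_ge0 ltW.
have q4J : (q ^+ 4 / (400 * 8))^-1 <= J%:R.
  by apply: le_trans hJ'; rewrite lerDr invr_ge0 ltW.
have -> : delta * (ln 2 * (q ^+ 4 / ((400 * 8) * B%:R))) * J%:R =
   delta * (J%:R * ln 2 * (q ^+ 4 / ((400 * 8) * B%:R))) by ring.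
apply: (@Omega_ge_scale _ delta s A B J n) => //.
- have := @invr_expr_le 8 _ J isT s20 s2J.
  by rewrite ler_pdivlMr// mulrC.
- exact: (@invr_expr_le 16 _ J isT q4 q4J).
Qed.

(** For given [n] the largest [J] allowed by the degrees is taken; then
    [n < 5 cutoff (J+1)], which is exponential in [J]. *)
Lemma Omega_ge_log (delta : R) : 0 < delta < 1 ->
  exists2 c : R, 0 < c & exists n0 : nat, forall n, (n0 <= n)%N ->
    ((c * ln n%:R)%:E <= Omega n (steklov delta))%E.
Proof.
move=> d01; have [c c0 [B [J0 [B0 J00 hc]]]] := Omega_ge_linear d01.
pose D := (40 * B ^ 2 * 64 ^ 2)%N.
have D1 : (1 < D)%N.
  rewrite /D -mulnA; apply: (@leq_trans (40 * 1)) => //.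
  by rewrite leq_pmul2l// muln_gt0 !expn_gt0 B0.
have lD : 0 < ln D%:R :> R by rewrite ln_gt0// ltr1n.
exists (c / (2 * ln D%:R)); first by rewrite divr_gt0 ?mulr_gt0.
exists (5 * cutoff B J0)%N => n n0.
have ex : exists J, (5 * cutoff B J <= n)%N by exists J0.
have bd J : (5 * cutoff B J <= n -> J <= n)%N.
  apply: leq_trans; apply: (@leq_trans (scale B J)).
    by rewrite (leq_trans (ltnW (ltn_expl J (isT : 1 < 64)%N)))// leq_pmull.
  have sJ : (0 < scale B J)%N by rewrite muln_gt0 B0 expn_gt0.
  by rewrite /cutoff mulnA expnS expn1 (leq_trans (leq_pmulr _ sJ))// leq_pmull.
case: (ex_maxnP ex bd) => J hJ maxJ.
have J0J : (J0 <= J)%N by exact: maxJ.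
have nJ : (n < 5 * cutoff B J.+1)%N.
  by rewrite ltnNge; apply/negP => /maxJ; rewrite ltnn.
apply: le_trans (hc J n J0J hJ); rewrite lee_fin.
have nD : (n <= D ^ (2 * J))%N.
  apply: leq_trans (ltnW nJ) _.
  apply: (@leq_trans (D ^ J.+1)).
    have -> : (5 * cutoff B J.+1 = 40 * B ^ 2 * (64 ^ 2) ^ J.+1)%N.
      by rewrite /cutoff /scale mulnA expnMn -expnM [(J.+1 * 2)%N]mulnC expnM mulnA.
    have X0 : (0 < 40 * B ^ 2)%N by rewrite muln_gt0 expn_gt0 B0.
    by rewrite /D expnMn leq_mul2r -[X in (X <= _)%N]expn1 leq_pexp2l ?orbT.
  by rewrite leq_exp2l// mul2n -addnn -addn1 leq_add2l (leq_trans J00).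
have [->|np] := posnP n; first by rewrite [ln 0%:R]ln0// mulr0 mulr_ge0// ltW.
have lnD : ln n%:R <= (2 * ln D%:R) * J%:R :> R.
  have -> : 2 * ln D%:R * J%:R = ln (D ^ (2 * J))%:R :> R.
    rewrite natrX lnXn ?ltr0n ?(ltnW D1)// -mulr_natl natrM; ring.
  by rewrite ler_ln ?posrE ?ltr0n ?expn_gt0 ?(ltnW D1)// ler_nat.
rewrite -mulrA ler_wpM2l ?(ltW c0)// mulrC ler_pdivrMr ?mulr_gt0//.
by rewrite mulrC.
Qed.

End Logarithm.

Theorem lemma8p1 (R : realType) (delta : R) (hdelta : 0 < delta < 1) :
  exists c C : R, 0 < c /\ c <= C /\
    forall n : nat, (2 <= n)%N ->
      ((c * ln n%:R)%:E <= Omega n (steklov delta))%E /\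
      (Omega n (steklov delta) <= (C * ln n%:R)%:E)%E.
Proof.
have [c1 c10 [n0 hn0]] := Omega_ge_log hdelta.
have [e0 e00 he0] := Omega_ge_small hdelta.
have /andP[d0 d1] := hdelta.
have l2 : 0 < ln 2 :> R by rewrite ln_gt0// ltr1n.
have lm : 0 < ln n0.+2%:R :> R by rewrite ln_gt0// ltr1n.
have ld : 0 <= ln delta^-1 by rewrite ln_ge0// invf_ge1// ltW.
pose c := Num.min c1 (e0 / ln n0.+2%:R).
have c0 : 0 < c by rewrite lt_min c10 divr_gt0.
exists c, (c + (1 + ln delta^-1 / ln 2)); split => //; split.
  by rewrite lerDl addr_ge0// divr_ge0// ltW.
move=> n n2.
have np : 0 < n%:R :> R by rewrite ltr0n (leq_trans _ n2).
have ln2n : ln 2 <= ln n%:R :> R by rewrite ler_ln ?posrE// (ler_nat _ 2).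
have lnn : 0 <= ln n%:R :> R by apply: le_trans ln2n; exact: ltW.
split.
  have [nn0|n0n] := leqP n0 n.
    apply: le_trans (hn0 n nn0); rewrite lee_fin ler_wpM2r// /c ge_min lexx//.
  apply: le_trans (he0 n n2); rewrite lee_fin.
  apply: le_trans (_ : e0 / ln n0.+2%:R * ln n%:R <= _).
    by rewrite ler_wpM2r// /c ge_min lexx orbT.
  rewrite mulrAC ler_pdivrMr// ler_wpM2l ?(ltW e00)// ler_ln ?posrE// ler_nat.
  exact: leqW (leqW (ltnW n0n)).
apply: le_trans (Omega_le n hdelta) _; rewrite lee_fin.
rewrite lnM ?posrE ?invr_gt0// ler_pdivrMr//.
have ln1 : ln n.+1%:R <= 2 * ln n%:R :> R.
  have -> : 2 * ln n%:R = ln (n ^ 2)%:R :> R by rewrite natrX lnXn// mulr_natl.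
  rewrite ler_ln ?posrE ?ltr0n ?expn_gt0 ?(leq_trans _ n2)// ler_nat.
  rewrite -mulnn; apply: (@leq_trans (n + n)).
    by rewrite -addn1 leq_add2l (leq_trans _ n2).
  by rewrite addnn -muln2 leq_mul2l n2 orbT.
have lnd : ln delta^-1 <= ln delta^-1 / ln 2 * ln n%:R.
  rewrite -mulrA ler_peMr// mulrC ler_pdivlMr// mul1r//.
have cn : 0 <= c * ln n%:R by rewrite mulr_ge0// ltW.
move: (ln delta^-1 / ln 2) lnd => w lnd; have := ld.
by move: (ln n.+1%:R) (ln delta^-1) (ln n%:R) ln1 lnd cn lnn => x y z; clear; nra.
Qed.
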